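(* Let $q$ be a complex number with $|q|<1$ and let $z$ be a nonzero complex number such that no denominator below vanishes. Then \begin{align*} \sum_{k=-\infty}^\infty\frac{(-z;q)_k}{(z^2q;q^2)_k}q^{\binom{k}2}z^k ={}&\frac{(-z;q)_\infty(q;q^2)_\infty}{(z^2;q)_\infty(q^2/z^2;q^2)_\infty}(q^3,z^3,z^{-3}q^3;q^3)_\infty,\\ \sum_{k=-\infty}^\infty\frac{(-z;q^2)_k}{(zq;q)_{2k}}q^{k(k+1)}z^k ={}&\frac{(q/z;q)_\infty(-zq^2;q^2)_\infty}{(z^2q^2,q^2/z^2,q;q^2)_\infty}(q^6,-z^3q^3,-z^{-3}q^3;q^6)_\infty,\\ \sum_{k=-\infty}^\infty\frac{(-z;q^2)_k}{(z;q)_{2k}}q^{k(k-1)}z^k ={}&\frac{(q/z;q)_\infty(-z;q^2)_\infty}{(z^2,q^2/z^2,q;q^2)_\infty}(q^6;q^6)_\infty \left[(-z^3q,-z^{-3}q^5;q^6)_\infty+z^2(-z^3q^5,-z^{-3}q;q^6)_\infty\right],\\ \sum_{k=-\infty}^\infty\frac{q^{2k^2}}{(z;q)_{2k+1}}z^{2k} ={}&\frac{(q/z;q)_\infty}{(z^2,q^2/z^2,q;q^2)_\infty}(q^8;q^8)_\infty \left[(-z^4q^3,-z^{-4}q^5;q^8)_\infty+z(-z^4q^5,-z^{-4}q^3;q^8)_\infty\right]. \end{align*}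
   Context: For complex $a$ and $k\in\mathbb Z\cup\{\infty\}$ the $q$-shifted factorial is $(a;q)_0=1$, $(a;q)_k=\prod_{j=1}^k(1-aq^{j-1})$ for $k>0$ (including $k=\infty$, an infinite product), and $(a;q)_k=\prod_{j=1}^{-k}(1-aq^{-j})^{-1}$ for $k<0$. Also $(a_1,\dots,a_m;q)_k=(a_1;q)_k\cdots(a_m;q)_k$, and $\binom k2=k(k-1)/2$. *)

(* Defs.v *)
From mathcomp Require Import all_boot all_order all_algebra.
From mathcomp Require Import classical_sets reals topology normedtype sequences.

Set Implicit Arguments.
Unset Strict Implicit.
Unset Printing Implicit Defensive.

Import Order.TTheory GRing.Theory Num.Theory.
Import numFieldNormedType.Exports.

Local Open Scope classical_set_scope.
Local Open Scope ring_scope.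

(* Everything is stated over a numFieldType K, whose norm topology is provided by
   numFieldNormedType, and is used with K := R[i], R : realType. *)
Section QSeries.
Variable K : numFieldType.
Implicit Types (a q : K) (k : int) (s : seq K).

(* (a; q)_k, where Negz n is - n.+1. Since 0^-1 = 0 and inversion is involutive,
   for k < 0 the reciprocal 1 / (a; q)_k is always the polynomial
   \prod_(1 <= j <= - k) (1 - a q^-j), which is also its conventional value when
   that polynomial vanishes. *)
Definition qpoch a q k : K :=
  match k with
  | Posz n => \prod_(j < n) (1 - a * q ^+ j)
  | Negz n => \prod_(j < n.+1) (1 - a * q ^- j.+1)^-1
  end.

Definition qpoch_inf a q : K := limn (fun n => \prod_(j < n) (1 - a * q ^+ j)).

Definition qpochs_inf s q : K := \prod_(a <- s) qpoch_inf a q.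

(* The division is exact. *)
Definition binz2 k : int := (k * (k - 1) %/ 2)%Z.

(* A bilateral series converges to l when its nonnegative and negative parts
   both converge, with sums adding up to l. *)
Definition is_bisum (u : int -> K) (l : K) : Prop :=
  exists sp sn : K,
    [/\ series (fun n => u (Posz n)) @ \oo --> sp,
        series (fun n => u (Negz n)) @ \oo --> sn
      & l = sp + sn].

End QSeries.

(* Main.v *)
Require Import Defs.
From mathcomp Require Import all_boot all_order all_algebra.
From mathcomp Require Import complex.
From mathcomp Require Import boolp classical_sets reals topology normedtype sequences.
From mathcomp Require Import ring lra zify.

(** Each series is the left-hand side of a bilateral Bailey-type transformation.
    With [theta x q = (x, q/x; q)_oo], multiplying the [k]-th term by a suitable
    product of theta functions and expanding one factor, by Lebesgue's identity
    [sum_s q^(s+1 choose 2) (A;q)_s/(q;q)_s = (-q;q)_oo (Aq;q^2)_oo] for the first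
    series and by its analogue [prod_quad_sum] for the others, gives an absolutely
    convergent double sum over [(k, s)].  Summing first over [s] with [r = k - s]
    fixed is a limit case of the q-Chu-Vandermonde sum ([cauchy_sum]), and what is
    left is a sum over [r] of Jacobi triple product terms.  The three quadratic
    series are the cases [b = q^2/t, q/t, 0] of one transformation with
    [t = z, z/q, z].

    The factor [theta (-z) q] of that transformation vanishes at [z = -1], a value
    that the second series admits; there the identity follows by dominated
    convergence along points of the unit circle.

    Sums are taken over arbitrary finite subsets, over an abstract [numFieldType]
    in which absolutely summable families are summable, so that the infinite
    products of moduli that serve as majorants live in the same field. *)

Set Implicit Arguments.
Unset Strict Implicit.
Unset Printing Implicit Defensive.

Import Order.TTheory GRing.Theory Num.Theory.
Import numFieldNormedType.Exports.
Local Open Scope ring_scope.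

(** * Unordered summation *)

Section UnorderedSums.
Context {K : numFieldType}.

(** The theta factor is what makes the diagonals summable. Being constant, it may be rewritten in
    row [k] as a theta function at an argument shifted by a power of [q] depending on [k], times a
    Gaussian factor [jt]. On the diagonal [k = r + s] this Gaussian factor cancels the one produced
    by reversing the finite product in the expansion, and only a one-variable sum with a closed form
    remains. The price is a final division by theta.

    The one-variable sums all come from q-difference equations in a parameter: suitable multiples of
    the terms at two parameter values differ by [B s - B s.+1]. Iteration drives the parameter to
    [0], where dominated convergence identifies the limit.

    The delicate point is absolute convergence of the double family. Its infinite products grow like
    inverse Gaussians in [k], and for [k < 0] the majorants cancel the available Gaussian factors
    exactly, so that only a geometric ratio is left. The bounds therefore use exact
    quasi-periodicity of theta functions of moduli instead of crude estimates. *)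

Definition hsum {I : eqType} (f : I -> K) (l : K) : Prop :=
  forall e : K, 0 < e -> exists s : seq I, forall t : seq I,
    uniq t -> {subset s <= t} -> `|\sum_(i <- t) f i - l| < e.

Definition asum {I : eqType} (f : I -> K) : Prop :=
  exists M : K, forall s : seq I, uniq s -> \sum_(i <- s) `|f i| <= M.

Lemma big_uniq_subset {I : eqType} (f : I -> K) (s t : seq I) :
  uniq s -> uniq t -> {subset s <= t} ->
  \sum_(i <- t) f i = \sum_(i <- s) f i + \sum_(i <- t | i \notin s) f i.
Proof.
move=> us ut st; rewrite (bigID (mem s)) /=; congr (_ + _).
rewrite -big_filter; apply: perm_big; apply: uniq_perm => //.
  exact: filter_uniq.
by move=> x; rewrite mem_filter; case xs: (x \in s) => //=; rewrite st.
Qed.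

Lemma ler_sum_subset {I : eqType} (g : I -> K) (s t : seq I) :
  (forall i, 0 <= g i) -> uniq s -> uniq t -> {subset s <= t} ->
  \sum_(i <- s) g i <= \sum_(i <- t) g i.
Proof.
move=> g0 us ut st; rewrite (big_uniq_subset g us ut st) lerDl.
by apply: sumr_ge0.
Qed.

Lemma hsum_unique {I : eqType} (f : I -> K) l l' :
  hsum f l -> hsum f l' -> l = l'.
Proof.
move=> h h'; apply/eqP; rewrite -subr_eq0 -normr_le0.
apply/negPn/negP => /negP ll'.
have d0 : 0 < `|l - l'|.
  by rewrite normr_gt0; apply: contra_notN ll' => /eqP ->; rewrite normr0.
have d2 : 0 < `|l - l'| / 2 by rewrite divr_gt0.
have [s hs] := h _ d2; have [t ht] := h' _ d2.
pose r := undup (s ++ t).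
have ur : uniq r by exact: undup_uniq.
have := hs r ur; have := ht r ur; rewrite /r.
move=> /(_ _)/wrap[|h1]; first by move=> x; rewrite mem_undup mem_cat orbC => ->.
move=> /(_ _)/wrap[|h2]; first by move=> x; rewrite mem_undup mem_cat => ->.
have := ltrD h1 h2; rewrite -splitr -[X in _ + X < _]normrN.
move=> /(le_lt_trans (ler_normD _ _)).
set S := \sum_(i <- _) _.
by rewrite (_ : S - l' + - (S - l) = l - l') ?ltxx //; ring.
Qed.

Lemma eq_hsum {I : eqType} (f g : I -> K) l : f =1 g -> hsum f l -> hsum g l.
Proof.
move=> fg h e e0; have [s hs] := h e e0; exists s => t ut st.
by rewrite -(eq_bigr _ (fun i _ => fg i)); apply: hs.
Qed.

Lemma hsumD {I : eqType} (f g : I -> K) l m :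
  hsum f l -> hsum g m -> hsum (fun i => f i + g i) (l + m).
Proof.
move=> hf hg e e0; have e2 : 0 < e / 2 by rewrite divr_gt0.
have [s hs] := hf _ e2; have [t ht] := hg _ e2.
exists (s ++ t) => r ur str.
rewrite big_split /= (splitr e) opprD addrACA.
apply: le_lt_trans (ler_normD _ _) _; apply: ltrD.
  by apply: hs => // x xs; apply: str; rewrite mem_cat xs.
by apply: ht => // x xs; apply: str; rewrite mem_cat xs orbT.
Qed.

Lemma hsum0 {I : eqType} : hsum (fun _ : I => 0) 0.
Proof. by move=> e e0; exists [::] => t _ _; rewrite big1 // subrr normr0. Qed.

Lemma hsumZ {I : eqType} (c : K) (f : I -> K) l :
  hsum f l -> hsum (fun i => c * f i) (c * l).
Proof.
have [->|c0 hf e e0] := eqVneq c 0.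
  by move=> _; rewrite mul0r; apply: eq_hsum hsum0 => i; rewrite mul0r.
have [|s hs] := hf (e / `|c|); first by rewrite divr_gt0 ?normr_gt0.
exists s => t ut st; rewrite -mulr_sumr -mulrBr normrM mulrC.
by rewrite -ltr_pdivlMr ?normr_gt0 //; apply: hs.
Qed.

Lemma hsum_bigop {I J : eqType} (s : seq I) (F : I -> J -> K) g :
  (forall i, hsum (F i) (g i)) ->
  hsum (fun j => \sum_(i <- s) F i j) (\sum_(i <- s) g i).
Proof.
move=> h; elim: s => [|a s IH].
  by rewrite big_nil; apply: eq_hsum hsum0 => j; rewrite big_nil.
by rewrite big_cons; apply: eq_hsum (hsumD (h a) IH) => j; rewrite big_cons.
Qed.

Lemma big_pmap_ocancel {I J : eqType} (h : I -> J) (h' : J -> option I) (f : J -> K)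
    (s : seq J) :
  ocancel h' h -> (forall j, h' j = None -> f j = 0) ->
  \sum_(i <- pmap h' s) f (h i) = \sum_(j <- s) f j.
Proof.
move=> hK f0; elim: s => [|j s IH]; first by rewrite !big_nil.
rewrite big_cons -IH /=; have := hK j; case hj: (h' j) => [i|] /=.
  by move=> <-; rewrite big_cons.
by rewrite f0 // add0r.
Qed.

(** Finite index lists travel by [map h] and [pmap h'], and whatever lies outside the image of [h]
    contributes zero. The inverse is partial so that a sum over [nat] can become a sum over [int]
    supported on a half-line. *)
Lemma hsum_pcan {I J : eqType} (h : I -> J) (h' : J -> option I) (f : J -> K) l :
  pcancel h h' -> ocancel h' h -> (forall j, h' j = None -> f j = 0) ->
  hsum (fun i => f (h i)) l <-> hsum f l.
Proof.
move=> hK h'K f0; split=> hf e e0; have [s hs] := hf e e0.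
  exists (map h s) => t ut st; rewrite -(big_pmap_ocancel t h'K f0).
  apply: hs; first exact: (pmap_uniq h'K ut).
  move=> i si; rewrite mem_pmap; apply/mapP; exists (h i); rewrite ?hK //.
  by apply: st; rewrite map_f.
exists (pmap h' s) => t ut st.
have uht : uniq (map h t) by rewrite map_inj_uniq //; apply: pcan_inj hK.
pose w := undup (map h t ++ s).
have := hs w (undup_uniq _).
move=> /(_ _)/wrap[|]; first by move=> x xs; rewrite mem_undup mem_cat xs orbT.
rewrite (@big_uniq_subset _ f (map h t) w) ?undup_uniq //; last first.
  by move=> x xs; rewrite mem_undup mem_cat xs.
rewrite big_map.
suff -> : \sum_(i <- w | i \notin map h t) f i = 0 by rewrite addr0.
rewrite big_seq_cond big1 // => j.
rewrite mem_undup mem_cat => /andP[/orP[->//|js] jt]; apply: f0.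
case hj: (h' j) => [i|] //; case/negP: jt.
have := h'K j; rewrite hj /= => <-; apply: map_f; apply: st.
by rewrite mem_pmap -hj map_f.
Qed.

Lemma hsum_bij {I J : eqType} (h : I -> J) (h' : J -> I) (f : J -> K) l :
  cancel h h' -> cancel h' h -> hsum (fun i => f (h i)) l <-> hsum f l.
Proof.
by move=> hK h'K; apply: (@hsum_pcan _ _ h (fun j => Some (h' j))) => // x /=; rewrite ?hK.
Qed.

Lemma hsum_norm_le {I : eqType} (f : I -> K) l M :
  hsum f l -> (forall s, uniq s -> \sum_(i <- s) `|f i| <= M) -> `|l| <= M.
Proof.
move=> h hM; apply/ler_addgt0Pl => e e0; have [s hs] := h e e0.
have := hs (undup s) (undup_uniq _).
move=> /(_ _)/wrap[|hl]; first by move=> x; rewrite mem_undup.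
rewrite -[l](subrK (\sum_(i <- undup s) f i)) (le_trans (ler_normD _ _)) //.
rewrite lerD //; first by rewrite distrC ltW.
by rewrite (le_trans (ler_norm_sum _ _ _)) // hM // undup_uniq.
Qed.

Lemma asum_le {I : eqType} (f g : I -> K) :
  (forall i, `|f i| <= `|g i|) -> asum g -> asum f.
Proof.
move=> fg [M hM]; exists M => s us; apply: le_trans (hM s us).
exact: ler_sum.
Qed.

Lemma asumD {I : eqType} (f g : I -> K) :
  asum f -> asum g -> asum (fun i => f i + g i).
Proof.
move=> [M hM] [N hN]; exists (M + N) => s us.
apply: le_trans (lerD (hM s us) (hN s us)); rewrite -big_split /=.
by apply: ler_sum => i _; exact: ler_normD.
Qed.

Lemma asumZ {I : eqType} c (f : I -> K) : asum f -> asum (fun i => c * f i).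
Proof.
move=> [M hM]; exists (`|c| * M) => s us.
by under eq_bigr do rewrite normrM; rewrite -mulr_sumr ler_wpM2l // hM.
Qed.

Lemma asum_inj {I J : eqType} (h : I -> J) (f : J -> K) :
  injective h -> asum f -> asum (fun i => f (h i)).
Proof.
move=> hI [M hM]; exists M => s us.
by rewrite -(big_map h xpredT (fun j => `|f j|)) hM // map_inj_uniq.
Qed.

Lemma asum_prod {I J : eqType} (f : I -> K) (g : J -> K) :
  asum f -> asum g -> asum (fun x : I * J => f x.1 * g x.2).
Proof.
move=> [M hM] [N hN]; exists (M * N) => s us.
pose A := undup (map fst s); pose B := undup (map snd s).
have uAB : uniq [seq (a, b) | a <- A, b <- B].
  by apply: allpairs_uniq; rewrite ?undup_uniq // => -[? ?] [? ?] _ _.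
apply: (@le_trans _ _ (\sum_(x <- [seq (a, b) | a <- A, b <- B]) `|f x.1 * g x.2|)).
  apply: ler_sum_subset => // -[a b] abs.
  apply/allpairsP; exists (a, b); rewrite !mem_undup; split=> //=.
    by apply/mapP; exists (a, b).
  by apply/mapP; exists (a, b).
rewrite big_allpairs /=.
have -> : \sum_(a <- A) \sum_(b <- B) `|f a * g b|
    = (\sum_(a <- A) `|f a|) * (\sum_(b <- B) `|g b|).
  rewrite mulr_suml; apply: eq_bigr => a _; rewrite mulr_sumr.
  by apply: eq_bigr => b _; rewrite normrM.
rewrite ler_pM ?sumr_ge0 //; first by rewrite hM ?undup_uniq.
by rewrite hN ?undup_uniq.
Qed.

Definition hcomplete : Prop :=
  forall (I : eqType) (f : I -> K), asum f -> exists l, hsum f l.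

(** Let [s] be good for [F]. For a finite [A] containing the first components of [s], choose [B]
    large enough for the finitely many rows in [A], and containing the second components of [s]. The
    sum over the rectangle is then within [e / 2] of [l] and within [e / 2] of the sum of [g] over
    [A]. *)
Lemma fubini_hsum {I J : eqType} (F : I * J -> K) (g : I -> K) l :
  hsum F l -> (forall i, hsum (fun j => F (i, j)) (g i)) -> hsum g l.
Proof.
move=> hF hg e e0; have e2 : 0 < e / 2 by rewrite divr_gt0.
have [s hs] := hF _ e2; exists (map fst s) => A uA sA.
have [t ht] := hsum_bigop A hg e2.
pose B := undup (map snd s ++ t).
have uAB : uniq [seq (a, b) | a <- A, b <- B].
  by apply: allpairs_uniq; rewrite ?undup_uniq // => -[? ?] [? ?] _ _.
have := hs _ uAB; move=> /(_ _)/wrap[|h1].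
  move=> [a b] abs; apply/allpairsP; exists (a, b); split=> //=.
    by apply: sA; apply/mapP; exists (a, b).
  by rewrite mem_undup mem_cat; apply/orP; left; apply/mapP; exists (a, b).
have := ht B (undup_uniq _); move=> /(_ _)/wrap[|h2].
  by move=> x xt; rewrite mem_undup mem_cat xt orbT.
rewrite exchange_big /= in h2; rewrite big_allpairs /= in h1.
rewrite (splitr e); apply: le_lt_trans (ltrD h2 h1).
rewrite -[X in _ <= X + _]normrN; apply: le_trans (ler_normD _ _).
by rewrite le_eqVlt; apply/orP; left; apply/eqP; congr `|_|; ring.
Qed.

End UnorderedSums.
Arguments hcomplete : clear implicits.

(** * Limits, series and dominated convergence *)

Section Sequences.
Context {K : numFieldType}.

Lemma seq_cvg_unique (u : nat -> K) (l m : K) :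
  (u n @[n --> \oo] --> l)%classic -> (u n @[n --> \oo] --> m)%classic -> l = m.
Proof. by move=> h h'; apply: (cvg_unique (@norm_hausdorff K K) h h'). Qed.

Lemma eq_seq_cvg (u v : nat -> K) (l : K) : u =1 v ->
  (u n @[n --> \oo] --> l)%classic -> (v n @[n --> \oo] --> l)%classic.
Proof. by move=> /funext ->. Qed.

Lemma seq_cvgD (u v : nat -> K) (l m : K) :
  (u n @[n --> \oo] --> l)%classic -> (v n @[n --> \oo] --> m)%classic ->
  (u n + v n @[n --> \oo] --> l + m)%classic.
Proof. exact: cvgD. Qed.

Lemma seq_cvgM (u v : nat -> K) (l m : K) :
  (u n @[n --> \oo] --> l)%classic -> (v n @[n --> \oo] --> m)%classic ->
  (u n * v n @[n --> \oo] --> l * m)%classic.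
Proof. exact: cvgM. Qed.

Lemma seq_cvgZ (c : K) (u : nat -> K) (l : K) :
  (u n @[n --> \oo] --> l)%classic -> (c * u n @[n --> \oo] --> c * l)%classic.
Proof. by move=> h; apply: seq_cvgM h; exact: cvg_cst. Qed.

Lemma seq_cvg_sub (u : nat -> K) (f : nat -> nat) (l : K) : (forall n, (n <= f n)%N) ->
  (u n @[n --> \oo] --> l)%classic -> (u (f n) @[n --> \oo] --> l)%classic.
Proof.
move=> fn /cvgrPdist_lt h; apply/cvgrPdist_lt => e e0; have [N _ hN] := h e e0.
by exists N => // n /= Nn; apply: hN => /=; apply: leq_trans (fn n).
Qed.

Lemma hsum_series (f : nat -> K) l :
  hsum f l -> (series f n @[n --> \oo] --> l)%classic.
Proof.
move=> h; apply/cvgrPdist_lt => e e0; have [s hs] := h e e0.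
near=> n; rewrite distrC /series /=; apply: hs; first exact: iota_uniq.
move=> x xs; rewrite mem_index_iota /=.
apply: (@leq_trans (\max_(i <- s) i).+1).
  by rewrite ltnS; apply: (@leq_bigmax_seq _ s xpredT id).
by near: n; exact: nbhs_infty_ge.
Unshelve. all: by end_near. Qed.

Lemma hsum_cvg0 (f : nat -> K) l : hsum f l -> (f n @[n --> \oo] --> (0 : K))%classic.
Proof.
move=> /hsum_series h; apply: cvg_series_cvg_0.
by apply/cvg_ex; exists l; exact: h.
Qed.

(** Engine of the q-difference equations: [a] will be a combination of the terms at two parameter
    values and [B] its telescoping certificate, each time with [B 0 = 0]. *)
Lemma hsum_telescope (a B : nat -> K) l :
  hsum a l -> (forall s, a s = B s - B s.+1) ->
  (B n @[n --> \oo] --> (0 : K))%classic -> l = B 0%N.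
Proof.
move=> /hsum_series h aB B0.
have c : (B 0%N - B n @[n --> \oo] --> B 0%N - 0)%classic by apply: cvgB => //; apply: cvg_cst.
rewrite subr0 in c; apply: (seq_cvg_unique h).
apply: cvg_trans c; apply: near_eq_cvg; near=> n.
rewrite /series /= -[LHS]opprB -telescope_sumr // -sumrN.
by apply: eq_bigr => i _; rewrite aB opprB.
Unshelve. all: by end_near. Qed.

Lemma asum_nat (f : nat -> K) M :
  (forall n, \sum_(k < n) `|f k| <= M) -> asum f.
Proof.
move=> hM; exists M => s us; pose n := (\max_(i <- s) i).+1.
apply: le_trans (hM n); rewrite -(big_mkord xpredT (fun k => `|f k|)).
apply: ler_sum_subset => //; first exact: iota_uniq.
move=> x xs; rewrite mem_index_iota /= ltnS.
by apply: (@leq_bigmax_seq _ s xpredT id).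
Qed.

Lemma geometric_sum_le (Q : K) n : 0 <= Q -> Q < 1 ->
  \sum_(k < n) Q ^+ k <= (1 - Q)^-1.
Proof.
move=> Q0 Q1; have d0 : 0 < 1 - Q by rewrite subr_gt0.
rewrite -[leRHS]mul1r ler_pdivlMr // mulrC -opprB mulNr -subrX1 opprB.
by rewrite lerBlDr lerDl exprn_ge0.
Qed.

Lemma asum_geometric (Q : K) : 0 <= Q -> Q < 1 -> asum (fun n : nat => Q ^+ n).
Proof.
move=> Q0 Q1; apply: (@asum_nat _ (1 - Q)^-1) => n.
apply: le_trans (geometric_sum_le n Q0 Q1); apply: ler_sum => i _.
by rewrite ger0_norm // exprn_ge0.
Qed.

Definition int_of_sign (x : bool * nat) : int := if x.1 then Posz x.2 else Negz x.2.

Definition sign_of_int (k : int) : bool * nat :=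
  match k with Posz n => (true, n) | Negz n => (false, n) end.

Lemma int_of_signK : cancel int_of_sign sign_of_int.
Proof. by case=> [[] n]. Qed.

Lemma sign_of_intK : cancel sign_of_int int_of_sign.
Proof. by case. Qed.

Lemma asum_int (u : int -> K) :
  asum (fun n => u (Posz n)) -> asum (fun n => u (Negz n)) -> asum u.
Proof.
move=> [M hM] [N hN]; exists (M + N) => s us.
pose P k := if k is Posz n then Some n else None.
pose G k := if k is Negz n then Some n else None.
have -> : \sum_(k <- s) `|u k| =
    \sum_(n <- pmap P s) `|u (Posz n)| + \sum_(n <- pmap G s) `|u (Negz n)|.
  elim: s {us} => [|k s IH]; first by rewrite !big_nil addr0.
  by rewrite big_cons IH; case: k => n /=; rewrite !big_cons; ring.
apply: lerD.
  by apply: hM; apply: (@pmap_uniq _ _ P Posz) us => -[].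
by apply: hN; apply: (@pmap_uniq _ _ G Negz) us => -[].
Qed.

Lemma hsum_bool (f : bool -> K) l : hsum f l -> l = f true + f false.
Proof.
move=> h; apply: (hsum_unique h) => e e0; exists [:: true; false] => t ut st.
suff -> : \sum_(i <- t) f i = f true + f false by rewrite subrr normr0.
rewrite (@big_uniq_subset _ _ f [:: true; false]) // !big_cons big_nil addr0.
by rewrite big1 ?addr0 // => -[].
Qed.

(** The sign identifies [int] with [bool * nat], and Fubini over the two-element factor separates
    the nonnegative part from the negative one. *)
Lemma hsum_is_bisum (Kc : hcomplete K) (u : int -> K) l :
  asum u -> hsum u l -> is_bisum u l.
Proof.
move=> au hu.
have [sp hp] : exists l, hsum (fun n => u (Posz n)) l.
  by apply: Kc; apply: asum_inj au => i j [].
have [sn hn] : exists l, hsum (fun n => u (Negz n)) l.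
  by apply: Kc; apply: asum_inj au => i j [].
exists sp, sn; split; [exact: hsum_series|exact: hsum_series|].
have hb : hsum (fun x => u (int_of_sign x)) l.
  by apply/(hsum_bij _ _ int_of_signK sign_of_intK).
by have := @fubini_hsum _ _ _ _ (fun b : bool => if b then sp else sn) _ hb;
  move=> /(_ _)/wrap[[]//|/hsum_bool].
Qed.

(** With no suprema assumed in [K], small tails come from completeness applied to the norms: their
    finite sums converge, and two of them within [e / 2] of the limit differ by less than [e]. *)
Lemma asum_tail (Kc : hcomplete K) {I : eqType} (g : I -> K) e :
  asum g -> 0 < e -> exists2 s, uniq s & forall t : seq I, uniq t ->
    {subset s <= t} -> \sum_(i <- t | i \notin s) `|g i| < e.
Proof.
move=> ag e0; have e2 : 0 < e / 2 by rewrite divr_gt0.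
have [|l hl] := Kc _ (fun i => `|g i|).
  by apply: asum_le ag => i; rewrite normr_id.
have [s hs] := hl _ e2; exists (undup s); first exact: undup_uniq.
move=> t ut st.
have h1 : {subset s <= t} by move=> x xs; apply: st; rewrite mem_undup.
have h2 : {subset s <= undup s} by move=> x; rewrite mem_undup.
have := ltrD (hs t ut h1) (hs _ (undup_uniq _) h2); rewrite -splitr.
rewrite -[X in _ + X]normrN => /(le_lt_trans (ler_normD _ _)).
rewrite (big_uniq_subset _ (undup_uniq s) ut st).
apply: le_lt_trans; apply: le_trans (real_ler_norm _).
  by rewrite le_eqVlt; apply/orP; left; apply/eqP; ring.
apply: ger0_real.
rewrite [X in 0 <= X](_ : _ = \sum_(i <- t | i \notin undup s) `|g i|); last by ring.
by apply: sumr_ge0.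
Qed.

Lemma hsum_tail_le {I : eqType} (f : I -> K) l s e :
  hsum f l -> uniq s -> (forall t : seq I, uniq t ->
    {subset s <= t} -> \sum_(i <- t | i \notin s) `|f i| <= e) ->
  `|l - \sum_(i <- s) f i| <= e.
Proof.
move=> hf us he; apply/ler_addgt0Pl => d d0; have [t ht] := hf d d0.
pose w := undup (s ++ t).
have uw : uniq w by exact: undup_uniq.
have sw : {subset s <= w} by move=> x xs; rewrite mem_undup mem_cat xs.
have tw : {subset t <= w} by move=> x xs; rewrite mem_undup mem_cat xs orbT.
have := lerD (ltW (ht w uw tw)) (he w uw sw); apply: le_trans.
apply: le_trans (lerD (lexx _) (ler_norm_sum _ _ _)).
rewrite (big_uniq_subset f us uw sw) -[X in _ <= X + _]normrN.
apply: le_trans (ler_normD _ _).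
by rewrite le_eqVlt; apply/orP; left; apply/eqP; congr `|_|; ring.
Qed.

Lemma norm_lim_le (u : nat -> K) (l M : K) :
  (u n @[n --> \oo] --> l)%classic -> (forall n, `|u n| <= M) -> `|l| <= M.
Proof.
move=> /cvgrPdist_lt h hM; apply/ler_addgt0Pl => e e0.
have [N _ hN] := h e e0; have /ltW := hN N (leqnn N).
move=> /lerD/(_ (hM N)); apply: le_trans.
by apply: le_trans (ler_normD _ _); rewrite subrK.
Qed.

Lemma cvg_bigsum {I : eqType} (s : seq I) (f : nat -> I -> K) (f0 : I -> K) :
  (forall i, f n i @[n --> \oo] --> f0 i)%classic ->
  (\sum_(i <- s) f n i @[n --> \oo] --> \sum_(i <- s) f0 i)%classic.
Proof.
move=> h; elim: s => [|a s IH].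
  by rewrite big_nil; under eq_fun do rewrite big_nil; exact: cvg_cst.
by rewrite big_cons; under eq_fun do rewrite big_cons; exact: cvgD.
Qed.

Lemma cvg_bigprod {I : eqType} (s : seq I) (f : nat -> I -> K) (f0 : I -> K) :
  (forall i, f n i @[n --> \oo] --> f0 i)%classic ->
  (\prod_(i <- s) f n i @[n --> \oo] --> \prod_(i <- s) f0 i)%classic.
Proof.
move=> h; elim: s => [|a s IH].
  by rewrite big_nil; under eq_fun do rewrite big_nil; exact: cvg_cst.
by rewrite big_cons; under eq_fun do rewrite big_cons; exact: cvgM.
Qed.

(** Dominated convergence. The limit family inherits the bound by [g]; outside a finite [s] both
    remainders are at most [e / 3], and on [s] the sums converge term by term. *)
Lemma tannery (Kc : hcomplete K) {I : eqType} (f : nat -> I -> K) (f0 g : I -> K)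
    (L : nat -> K) (L0 : K) :
  asum g -> (forall n i, `|f n i| <= `|g i|) ->
  (forall i, f n i @[n --> \oo] --> f0 i)%classic ->
  (forall n, hsum (f n) (L n)) -> hsum f0 L0 -> (L n @[n --> \oo] --> L0)%classic.
Proof.
move=> ag fg ff0 hf hf0; apply/cvgrPdist_lt => e e0.
have e3 : 0 < e / 3 by rewrite divr_gt0.
have f0g i : `|f0 i| <= `|g i| by apply: norm_lim_le (ff0 i) _ => n; exact: fg.
have [s us hs] := asum_tail Kc ag e3.
have h0 : `|L0 - \sum_(i <- s) f0 i| <= e / 3.
  apply: hsum_tail_le hf0 us _ => t ut st; apply: le_trans (ltW (hs t ut st)).
  exact: ler_sum.
have hn n : `|L n - \sum_(i <- s) f n i| <= e / 3.
  apply: hsum_tail_le (hf n) us _ => t ut st; apply: le_trans (ltW (hs t ut st)).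
  exact: ler_sum.
have /cvgrPdist_lt/(_ _ e3) := @cvg_bigsum _ s _ _ ff0.
apply: filterS => n hd.
have -> : e = e / 3 + e / 3 + e / 3 by field.
have := ltr_leD hd (hn n); rewrite -[X in _ + X]normrN => /(le_lt_trans (ler_normD _ _)) h1.
rewrite -addrA; apply: le_lt_trans (ler_ltD h0 h1); apply: le_trans (ler_normD _ _).
by rewrite le_eqVlt; apply/orP; left; apply/eqP; congr `|_|; ring.
Qed.

End Sequences.
Arguments seq_cvgZ {K} c [u l] _ [t] _.

(** * Completeness of the complex numbers *)

Section ComplexCompleteness.
Context {R : realType}.

Lemma hsum_ge0_real {I : eqType} (g : I -> R) M :
  (forall i, 0 <= g i) -> (forall s, uniq s -> \sum_(i <- s) g i <= M) ->
  exists l, hsum g l.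
Proof.
move=> g0 hM.
pose E : set R := [set x | exists2 s, uniq s & x = \sum_(i <- s) g i]%classic.
have hE : has_sup E.
  split; first by exists 0, [::] => //; rewrite big_nil.
  by exists M => x [s us ->]; exact: hM.
exists (sup E) => e e0; have [x [s us xE] xl] := sup_adherent e0 hE.
exists s => t ut st.
have h1 : \sum_(i <- t) g i <= sup E by apply: sup_upper_bound => //; exists t.
have h2 : \sum_(i <- s) g i <= \sum_(i <- t) g i by apply: ler_sum_subset.
rewrite ltr_norml; apply/andP; split; first by rewrite xE in xl; lra.
lra.
Qed.

Lemma hsum_real_complex {I : eqType} (g : I -> R) l :
  hsum g l -> hsum (fun i => (g i)%:C%C) l%:C%C.
Proof.
move=> h e; rewrite ltcE /= => /andP[/eqP e1 e2]; have [s hs] := h _ e2.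
exists s => t ut st; have := hs t ut st.
rewrite -(rmorph_sum (real_complex R)) -rmorphB normc_def /= expr0n addr0 sqrtr_sqr.
by rewrite ltcE /= e1 eqxx.
Qed.

(** Real and imaginary parts are treated alike: if [h] is real-valued and bounded by the modulus,
    then [h (f i) + |f i|] and [|f i|] are nonnegative with bounded finite sums, hence summable to
    their suprema, and [h (f i)] is their difference. *)
Lemma complex_hcomplete : hcomplete R[i].
Proof.
move=> I f [M hM].
have bound (h : R[i] -> R) : (forall x, `|h x| <= complex.Re `|x|) ->
    exists l, hsum (fun i => (h (f i))%:C%C) l.
  move=> hb.
  have hs s : uniq s -> \sum_(i <- s) complex.Re `|f i| <= complex.Re M.
    move=> us; have := hM s us; rewrite lecE => /andP[_].
    congr (_ <= _).
    elim: s {us} => [|a s IH]; first by rewrite !big_nil.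
    by rewrite !big_cons raddfD /= IH.
  have [||l1 h1] := @hsum_ge0_real _ (fun i => h (f i) + complex.Re `|f i|)
      (complex.Re M + complex.Re M).
    by move=> i; have := hb (f i); rewrite ler_norml; lra.
    move=> s us; apply: le_trans (lerD (hs s us) (hs s us)).
    rewrite -big_split /=; apply: ler_sum => i _.
    have := hb (f i); rewrite ler_norml => /andP[_ le_h].
    by rewrite lerD2r.
  have [|l2 h2] := @hsum_ge0_real _ (fun i => complex.Re `|f i|) (complex.Re M) _ hs.
    by move=> i; have := hb (f i); have := normr_ge0 (h (f i)); lra.
  exists ((l1 + (-1) * l2)%:C%C); apply: hsum_real_complex.
  by apply: eq_hsum (hsumD h1 (hsumZ (-1) h2)) => i; ring.
have [|x hx] := bound (fun x => complex.Re x).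
  by move=> x; have := normc_ge_Re x; rewrite lecE => /andP[].
have [|y hy] := bound (fun x => complex.Im x).
  move=> w; rewrite normc_def /= -sqrtr_sqr ler_sqrt ?addr_ge0 ?sqr_ge0 //.
  by rewrite lerDr sqr_ge0.
exists (x + 'i%C * y).
by apply: eq_hsum (hsumD hx (hsumZ 'i%C hy)) => i; rewrite [RHS]complexE.
Qed.

End ComplexCompleteness.
(** * Infinite products *)

Section Products.
Context {K : numFieldType} (Kc : hcomplete K).
Implicit Types (a b q x y Q : K) (m n : nat).

(** In the partial order of [K], [0 <= l] amounts to [|l| = l], a closed condition because the norm
    is continuous. *)
Lemma lim_ge0 (u : nat -> K) (l : K) :
  (u n @[n --> \oo] --> l)%classic -> (forall n, 0 <= u n) -> 0 <= l.
Proof.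
move=> h u0; apply/normr_idP; apply: (seq_cvg_unique (cvg_norm h)).
by under eq_fun do rewrite ger0_norm //.
Qed.

Lemma lim_le (u v : nat -> K) (l m : K) :
  (u n @[n --> \oo] --> l)%classic -> (v n @[n --> \oo] --> m)%classic ->
  (forall n, u n <= v n) -> l <= m.
Proof.
move=> hu hv uv; rewrite -subr_ge0; apply: lim_ge0 (cvgB hv hu) _ => n /=.
by rewrite /= subr_ge0.
Qed.

Lemma cvg_expr0 q : `|q| < 1 -> (q ^+ n @[n --> \oo] --> (0 : K))%classic.
Proof.
move=> q1; have [|l /hsum_cvg0//] := Kc (f := fun n : nat => q ^+ n).
apply: asum_le (asum_geometric (normr_ge0 q) q1) => n.
by rewrite normrX [leRHS]ger0_norm ?exprn_ge0.
Qed.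

Definition qfin a q n : K := \prod_(j < n) (1 - a * q ^+ j).

Lemma qfin0 a q : qfin a q 0 = 1. Proof. by rewrite /qfin big_ord0. Qed.

Lemma qfinSr a q n : qfin a q n.+1 = qfin a q n * (1 - a * q ^+ n).
Proof. by rewrite /qfin big_ord_recr. Qed.

Lemma qfinS a q n : qfin a q n.+1 = (1 - a) * qfin (a * q) q n.
Proof.
rewrite /qfin big_ord_recl /= expr0 mulr1; congr (_ * _).
by apply: eq_bigr => j _; rewrite exprS mulrA.
Qed.

Lemma qfinD a q m n : qfin a q (m + n) = qfin a q m * qfin (a * q ^+ m) q n.
Proof.
elim: n => [|n IH]; first by rewrite addn0 qfin0 mulr1.
by rewrite addnS !qfinSr IH exprD !mulrA.
Qed.

Lemma small_shift a q e : `|q| < 1 -> 0 < e -> exists m, `|a| * `|q| ^+ m < e.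
Proof.
move=> q1 e0; have : (a * q ^+ n @[n --> \oo] --> (0 : K))%classic.
  by rewrite -(mulr0 a); apply: cvgM; [exact: cvg_cst|exact: cvg_expr0].
move=> /cvgrPdist_lt/(_ e e0)[m _ /(_ m (leqnn m))].
by rewrite sub0r normrN normrM normrX => ?; exists m.
Qed.

Lemma qfinN_ge1 y Q n : 0 <= y -> 0 <= Q -> 1 <= qfin (- y) Q n.
Proof.
move=> y0 Q0; elim: n => [|n IH]; first by rewrite qfin0.
rewrite qfinSr mulNr opprK; apply: mulr_ege1 => //.
by rewrite lerDl mulr_ge0 ?exprn_ge0.
Qed.

Lemma qfinN_ge0 y Q n : 0 <= y -> 0 <= Q -> 0 <= qfin (- y) Q n.
Proof. by move=> y0 Q0; apply: le_trans (qfinN_ge1 n y0 Q0). Qed.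

(** Elementary substitute for the exponential bound of [prod (1 + y Q^j)]: with [S] the geometric
    sum, [qfin (- y) Q n * (1 - y * S n) <= 1] by induction, and [y * S n <= 1/2] by the choice of
    [y]. *)
Lemma qfinN_small y Q n : 0 <= y -> 0 <= Q -> Q < 1 -> y * 2 <= 1 - Q ->
  qfin (- y) Q n <= 2.
Proof.
move=> y0 Q0 Q1 yQ; have d0 : 0 < 1 - Q by rewrite subr_gt0.
pose S m : K := \sum_(k < m) Q ^+ k.
have S0 m : 0 <= S m by apply: sumr_ge0 => i _; rewrite exprn_ge0.
have yS m : y * S m <= 2^-1.
  apply: (@le_trans _ _ ((1 - Q) / 2 * (1 - Q)^-1)).
    by apply: ler_pM => //; [rewrite ler_pdivlMr|exact: geometric_sum_le].
  by rewrite mulrAC divff ?mul1r // gt_eqF.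
have h : qfin (- y) Q n * (1 - y * S n) <= 1.
  elim: n => [|n IH]; first by rewrite qfin0 /S big_ord0 mulr0 subr0 mulr1.
  apply: le_trans IH; rewrite qfinSr -mulrA; apply: ler_wpM2l; first exact: qfinN_ge0.
  have t0 : 0 <= y * Q ^+ n by rewrite mulr_ge0 ?exprn_ge0.
  rewrite /S big_ord_recr /= -/(S n) -subr_ge0.
  rewrite (_ : _ - _ = y * Q ^+ n * (y * S n + y * Q ^+ n)); last by ring.
  by rewrite mulr_ge0 // addr_ge0 // mulr_ge0.
have h2 : 2^-1 <= 1 - y * S n.
  by rewrite lerBrDr -lerBrDl; apply: le_trans (yS n) _; rewrite [leRHS](_ : _ = 2^-1) //; field.
rewrite -[leRHS]mul1r -ler_pdivrMr //; apply: le_trans h.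
by apply: ler_wpM2l => //; exact: qfinN_ge0.
Qed.

Lemma norm_qfin_le a q n : `|qfin a q n| <= qfin (- `|a|) `|q| n.
Proof.
rewrite normr_prod; apply: ler_prod => j _; rewrite normr_ge0 /=.
by rewrite (le_trans (ler_normB _ _)) // normr1 normrM normrX mulNr opprK.
Qed.

Lemma qfinN_bounded y Q : 0 <= y -> 0 <= Q -> Q < 1 -> exists M, forall n, qfin (- y) Q n <= M.
Proof.
move=> y0 Q0 Q1; have d0 : 0 < (1 - Q) / 2 by rewrite divr_gt0 // subr_gt0.
have [|m hm] := @small_shift y Q _ _ d0; first by rewrite ger0_norm.
rewrite !ger0_norm // in hm; exists (qfin (- y) Q m * 2) => n.
have [nm|mn] := leqP n m.
  rewrite -(subnKC nm) qfinD -mulrA -[leLHS]mulr1 ler_wpM2l ?qfinN_ge0 //.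
  rewrite mulNr; apply: mulr_ege1; last by rewrite ler1n.
  by rewrite qfinN_ge1 // mulr_ge0 ?exprn_ge0.
rewrite -(subnKC (ltnW mn)) qfinD ler_wpM2l ?qfinN_ge0 //.
rewrite mulNr qfinN_small ?mulr_ge0 ?exprn_ge0 //.
by rewrite -ler_pdivlMr // ltW.
Qed.

(** The increments [- qfin a q n * a q^n] are bounded times geometric, hence absolutely summable;
    completeness gives a limit, which is then the one that [limn] selects. *)
Lemma qfin_cvg a q : `|q| < 1 -> (qfin a q n @[n --> \oo] --> qpoch_inf a q)%classic.
Proof.
move=> q1; have [M hM] := qfinN_bounded (normr_ge0 a) (normr_ge0 q) q1.
have [|l /hsum_series hl] := Kc (f := fun n : nat => qfin a q n.+1 - qfin a q n).
  apply: asum_le (asumZ (`|a| * M) (asum_geometric (normr_ge0 q) q1)) => n.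
  rewrite qfinSr mulrBr mulr1 addrAC subrr add0r normrN !normrM !normrX !normr_id.
  rewrite mulrC -!mulrA ler_wpM2l // mulrC ler_wpM2r ?exprn_ge0 //.
  apply: le_trans (norm_qfin_le a q n) _; apply: le_trans (hM n) _.
  by rewrite real_ler_norm // ger0_real // (le_trans _ (hM 0%N)) // qfin0.
have h : (qfin a q n @[n --> \oo] --> l + 1)%classic.
  apply: eq_seq_cvg (seq_cvgD hl (@cvg_cst _ (1 : K) nat (\oo)%classic _)) => n.
  by rewrite /series /= (telescope_sumr (qfin a q)) // qfin0 subrK.
by rewrite /qpoch_inf (cvg_lim (@norm_hausdorff K K) h).
Qed.

Arguments qfin_cvg a [q] _ [t] _.

Lemma qpoch_infE a q (l : K) : `|q| < 1 -> (qfin a q n @[n --> \oo] --> l)%classic ->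
  qpoch_inf a q = l.
Proof. by move=> q1 h; exact: (seq_cvg_unique (qfin_cvg a q1) h). Qed.

Lemma qpoch_inf_split n a q : `|q| < 1 ->
  qpoch_inf a q = qfin a q n * qpoch_inf (a * q ^+ n) q.
Proof.
move=> q1; apply: qpoch_infE => //.
rewrite -(cvg_shiftn n).
apply: (@eq_seq_cvg _ (fun m => qfin a q n * qfin (a * q ^+ n) q m)) => [m|].
  by rewrite /= addnC qfinD.
apply: seq_cvgZ; exact: qfin_cvg.
Qed.

Lemma qpoch_infS a q : `|q| < 1 -> qpoch_inf a q = (1 - a) * qpoch_inf (a * q) q.
Proof. by move=> q1; rewrite (qpoch_inf_split 1) // /qfin big_ord1 expr0 expr1 mulr1. Qed.

Lemma qpoch_inf0 q : `|q| < 1 -> qpoch_inf 0 q = 1.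
Proof.
move=> q1; apply: qpoch_infE => //; under eq_fun do
  (rewrite /qfin; under eq_bigr do rewrite mul0r subr0); under eq_fun do rewrite big1 //.
exact: cvg_cst.
Qed.

Lemma norm_expS_lt1 q n : `|q| < 1 -> `|q ^+ n.+1| < 1.
Proof. by move=> q1; rewrite normrX exprn_ilt1. Qed.

Lemma qpoch_inf_even_odd a q : `|q| < 1 ->
  qpoch_inf a q = qpoch_inf a (q ^+ 2) * qpoch_inf (a * q) (q ^+ 2).
Proof.
move=> q1; have q2 := @norm_expS_lt1 q 1 q1.
have h2 : (qfin a q n.*2 @[n --> \oo] --> qpoch_inf a q)%classic.
  apply: (@seq_cvg_sub _ (qfin a q) double) => [n|]; last exact: qfin_cvg.
  by rewrite -addnn leq_addr.
apply: (seq_cvg_unique h2).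
apply: eq_seq_cvg (seq_cvgM (qfin_cvg a q2) (qfin_cvg (a * q) q2)) => n.
elim: n => [|m IH]; first by rewrite !qfin0 mulr1.
rewrite doubleS !qfinSr -IH -exprM -mul2n.
have -> : q ^+ (2 * m).+1 = q ^+ (2 * m) * q by rewrite exprSr.
by ring.
Qed.

Lemma qpoch_inf_sqr a q : `|q| < 1 ->
  qpoch_inf (a ^+ 2) (q ^+ 2) = qpoch_inf a q * qpoch_inf (- a) q.
Proof.
move=> q1; have q2 := @norm_expS_lt1 q 1 q1.
apply: qpoch_infE => //.
apply: eq_seq_cvg (seq_cvgM (qfin_cvg a q1) (qfin_cvg (- a) q1)) => n.
rewrite /qfin -big_split /=; apply: eq_bigr => j _.
by rewrite -exprM mulnC exprM; ring.
Qed.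

(** Passes from a nonvanishing infinite product to its linear factors, which for [k >= 0] are the
    denominators of the bilateral series. *)
Lemma qpoch_inf_factor_neq0 a q j : `|q| < 1 -> qpoch_inf a q != 0 -> 1 - a * q ^+ j != 0.
Proof.
move=> q1; rewrite (qpoch_inf_split j.+1) // qfinSr -!mulrA mulf_eq0 negb_or.
by case/andP=> _; rewrite mulf_eq0 negb_or => /andP[].
Qed.

(** Weierstrass' inequality: the modulus is at least [1 - |a| * S n] with [S] the geometric sum in
    [|q|], and the subtracted term is at most [1/2]. *)
Lemma qfin_small_ge a q n : `|q| < 1 -> `|a| * 2 <= 1 - `|q| -> 2^-1 <= `|qfin a q n|.
Proof.
move=> q1 aq; have d0 : 0 < 1 - `|q| by rewrite subr_gt0.
pose S m : K := \sum_(k < m) `|q| ^+ k.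
have S0 m : 0 <= S m by apply: sumr_ge0 => i _; rewrite exprn_ge0.
have aS m : `|a| * S m <= 2^-1.
  apply: (@le_trans _ _ ((1 - `|q|) / 2 * (1 - `|q|)^-1)).
    apply: ler_pM => //; first by rewrite ler_pdivlMr.
    exact: geometric_sum_le.
  by rewrite mulrAC divff ?mul1r // gt_eqF.
have h2 m : 2^-1 <= 1 - `|a| * S m.
  by rewrite lerBrDr -lerBrDl; apply: le_trans (aS m) _; rewrite [leRHS](_ : _ = 2^-1) //; field.
apply: le_trans (h2 n) _; elim: n => [|n IH].
  by rewrite qfin0 normr1 /S big_ord0 mulr0 subr0.
have t0 : 0 <= `|a| * `|q| ^+ n by rewrite mulr_ge0 ?exprn_ge0.
have t1 : 0 <= 1 - `|a| * `|q| ^+ n.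
  rewrite subr_ge0; apply: (@le_trans _ _ (`|a| * S n.+1)).
    by rewrite ler_wpM2l // /S big_ord_recr /= lerDr; exact: S0.
  by apply: le_trans (aS _) _; rewrite invf_le1 ?ler1n.
apply: (@le_trans _ _ ((1 - `|a| * S n) * (1 - `|a| * `|q| ^+ n))).
  rewrite /S big_ord_recr /= -/(S n) -subr_ge0.
  rewrite (_ : _ - _ = `|a| * S n * (`|a| * `|q| ^+ n)); last by ring.
  by rewrite mulr_ge0 // mulr_ge0.
rewrite qfinSr normrM; apply: ler_pM => //; first by rewrite (le_trans _ (h2 n)) // invr_ge0.
by have := lerB_dist 1 (a * q ^+ n); rewrite normr1 normrM normrX.
Qed.

Lemma qfin_bounded_away a q : `|q| < 1 -> (forall j, 1 - a * q ^+ j != 0) ->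
  exists2 c, 0 < c & forall n, c <= `|qfin a q n|.
Proof.
move=> q1 hj; have d0 : 0 < (1 - `|q|) / 2 by rewrite divr_gt0 // subr_gt0.
have [m hm] := small_shift a q1 d0.
have nz n : qfin a q n != 0 by apply/prodf_neq0 => j _.
have tail n : 2^-1 <= `|qfin (a * q ^+ m) q n|.
  by apply: qfin_small_ge => //; rewrite normrM normrX -ler_pdivlMr // ltW.
(* The sum of the inverses stands in for their maximum. *)
pose M := \sum_(k < m.+1) `|qfin a q k|^-1.
have hM k : (k <= m)%N -> `|qfin a q k|^-1 <= M.
  move=> km; have kS : (k < m.+1)%N by [].
  rewrite /M (bigD1 (Ordinal kS)) //= lerDl sumr_ge0 // => i _.
  by rewrite invr_ge0.
have M0 : 0 < M by apply: lt_le_trans (hM 0%N _); rewrite // invr_gt0 normr_gt0.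
exists (M^-1 / 2) => [|n]; first by rewrite divr_gt0 // invr_gt0.
have head k : (k <= m)%N -> M^-1 <= `|qfin a q k|.
  move=> km; rewrite -[leRHS]invrK lef_pV2 ?hM // posrE ?invr_gt0 ?normr_gt0 //.
have [nm|mn] := leqP n m.
  apply: le_trans (head n nm); rewrite ler_piMr ?invr_ge0 ?ltW //.
  by rewrite invf_lt1 // ltr1n.
rewrite -(subnKC (ltnW mn)) qfinD normrM.
by apply: ler_pM; rewrite ?invr_ge0 ?ler0n ?head ?(ltW M0).
Qed.

Lemma cvg_neq0 (u : nat -> K) (l c : K) :
  (u n @[n --> \oo] --> l)%classic -> 0 < c -> (forall n, c <= `|u n|) -> l != 0.
Proof.
move=> /cvgrPdist_lt h c0 hc; have [N _ /(_ N (leqnn N))] := h c c0.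
move=> /= hN; apply/eqP => l0; move: hN; rewrite l0 sub0r normrN => /lt_geF.
by rewrite hc.
Qed.

Lemma qpoch_inf_neq0 a q : `|q| < 1 -> (forall j, 1 - a * q ^+ j != 0) ->
  qpoch_inf a q != 0.
Proof.
move=> q1 hj; have [c c0 hc] := qfin_bounded_away q1 hj.
exact: cvg_neq0 (qfin_cvg a q1) c0 hc.
Qed.

Lemma one_sub_neq0 x : `|x| < 1 -> 1 - x != 0.
Proof. by move=> x1; rewrite subr_eq0; apply: contraTneq x1 => <-; rewrite normr1 ltxx. Qed.

Lemma one_sub_expS_neq0 q j : `|q| < 1 -> 1 - q * q ^+ j != 0.
Proof.
by move=> q1; rewrite one_sub_neq0 // -exprS normrX exprn_ilt1.
Qed.

Lemma qfin_self_neq0 q n : `|q| < 1 -> qfin q q n != 0.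
Proof. by move=> q1; apply/prodf_neq0 => j _; exact: one_sub_expS_neq0. Qed.

Lemma qpoch_inf_self_neq0 q : `|q| < 1 -> qpoch_inf q q != 0.
Proof. by move=> q1; apply: qpoch_inf_neq0 => // j; exact: one_sub_expS_neq0. Qed.

Lemma inv_qfin_bounded q : `|q| < 1 -> exists2 M : K, 0 < M & forall n, `|(qfin q q n)^-1| <= M.
Proof.
move=> q1; have [|c c0 hc] := @qfin_bounded_away q q q1.
  by move=> j; exact: one_sub_expS_neq0.
exists c^-1 => [|n]; first by rewrite invr_gt0.
by rewrite normfV lef_pV2 // posrE ?normr_gt0 ?qfin_self_neq0.
Qed.

(* [qpoch_inf (- y) Q] with [y, Q >= 0] is the majorant of all the products. *)

Lemma qfinN_le_inf y Q n : 0 <= y -> 0 <= Q -> Q < 1 -> qfin (- y) Q n <= qpoch_inf (- y) Q.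
Proof.
move=> y0 Q0 Q1; have Q1' : `|Q| < 1 by rewrite ger0_norm.
apply: (@lim_le (fun=> qfin (- y) Q n) (fun m => qfin (- y) Q (m + n)%N)).
- exact: cvg_cst.
- by rewrite (cvg_shiftn n); exact: qfin_cvg.
move=> m; rewrite addnC qfinD -[leLHS]mulr1 ler_wpM2l ?qfinN_ge0 // mulNr.
by rewrite qfinN_ge1 // mulr_ge0 ?exprn_ge0.
Qed.

Lemma qpoch_infN_ge1 y Q : 0 <= y -> 0 <= Q -> Q < 1 -> 1 <= qpoch_inf (- y) Q.
Proof. by move=> y0 Q0 Q1; have := qfinN_le_inf 0 y0 Q0 Q1; rewrite qfin0. Qed.

Lemma qpoch_infN_ge0 y Q : 0 <= y -> 0 <= Q -> Q < 1 -> 0 <= qpoch_inf (- y) Q.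
Proof. by move=> y0 Q0 Q1; apply: le_trans (qpoch_infN_ge1 y0 Q0 Q1). Qed.

Lemma qfinN_le y y' Q n : 0 <= y -> y <= y' -> 0 <= Q -> qfin (- y) Q n <= qfin (- y') Q n.
Proof.
move=> y0 yy Q0; apply: ler_prod => j _; rewrite !mulNr !opprK.
by rewrite addr_ge0 ?mulr_ge0 ?exprn_ge0 // lerD2l ler_wpM2r ?exprn_ge0.
Qed.

Lemma qpoch_infN_le y y' Q : 0 <= y -> y <= y' -> 0 <= Q -> Q < 1 ->
  qpoch_inf (- y) Q <= qpoch_inf (- y') Q.
Proof.
move=> y0 yy Q0 Q1; have Q1' : `|Q| < 1 by rewrite ger0_norm.
by apply: (lim_le (qfin_cvg (- y) Q1') (qfin_cvg (- y') Q1')) => n; exact: qfinN_le.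
Qed.

Lemma norm_qpoch_inf_le a q : `|q| < 1 -> `|qpoch_inf a q| <= qpoch_inf (- `|a|) `|q|.
Proof.
move=> q1; apply: norm_lim_le (qfin_cvg a q1) _ => n.
exact: le_trans (norm_qfin_le a q n) (qfinN_le_inf _ _ _ _).
Qed.

Lemma norm_qfin_le_inf a q n : `|q| < 1 -> `|qfin a q n| <= qpoch_inf (- `|a|) `|q|.
Proof. by move=> q1; apply: le_trans (norm_qfin_le a q n) (qfinN_le_inf _ _ _ _). Qed.

(** Induction on the partial products, one factor of the difference at a time. The geometric sum
    collects the changes of the individual factors, and all other factors are at most [1 + B |q|^j],
    so the constant depends only on [B] and [|q|]. *)
Lemma qpoch_inf_lipschitz a b q B : `|q| < 1 -> `|a| <= B -> `|b| <= B ->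
  `|qpoch_inf a q - qpoch_inf b q| <= `|a - b| * ((1 - `|q|)^-1 * qpoch_inf (- B) `|q|).
Proof.
move=> q1 aB bB; have B0 : 0 <= B by apply: le_trans aB.
pose S m : K := \sum_(k < m) `|q| ^+ k.
have S0 m : 0 <= S m by apply: sumr_ge0 => i _; rewrite exprn_ge0.
have fb n : `|qfin b q n| <= qfin (- B) `|q| n.
  exact: le_trans (norm_qfin_le b q n) (qfinN_le _ _ _ _).
have fa n : `|1 - a * q ^+ n| <= 1 + B * `|q| ^+ n.
  apply: le_trans (ler_normB _ _) _; rewrite normr1 lerD2l normrM normrX.
  by rewrite ler_wpM2r ?exprn_ge0.
have h n : `|qfin a q n - qfin b q n| <= `|a - b| * (S n * qfin (- B) `|q| n).
  elim: n => [|n IH]; first by rewrite !qfin0 subrr normr0 /S big_ord0 mul0r mulr0.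
  rewrite !qfinSr (_ : _ - _ = (qfin a q n - qfin b q n) * (1 - a * q ^+ n)
      + (b - a) * (qfin b q n * q ^+ n)); last by ring.
  apply: le_trans (ler_normD _ _) _; rewrite !normrM [`|b - a|]distrC normrX.
  have P0 := qfinN_ge0 n B0 (normr_ge0 q).
  have t1 : 1 <= 1 + B * `|q| ^+ n by rewrite lerDl mulr_ge0 ?exprn_ge0.
  apply: (@le_trans _ _ (`|a - b| * (S n * qfin (- B) `|q| n) * (1 + B * `|q| ^+ n)
     + `|a - b| * (qfin (- B) `|q| n * (1 + B * `|q| ^+ n) * `|q| ^+ n))).
    apply: lerD; first exact: ler_pM.
    rewrite ler_wpM2l // ler_wpM2r ?exprn_ge0 //; apply: le_trans (fb n) _.
    by rewrite -{1}[qfin _ _ _]mulr1 ler_wpM2l.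
  rewrite /S big_ord_recr /= -/(S n) mulNr opprK le_eqVlt; apply/orP; left; apply/eqP.
  by ring.
apply: norm_lim_le (cvgB (qfin_cvg a q1) (qfin_cvg b q1)) _ => n /=.
apply: le_trans (h n) _; rewrite ler_wpM2l //; apply: ler_pM => //.
- exact: qfinN_ge0.
- exact: geometric_sum_le.
- exact: qfinN_le_inf.
Qed.

Lemma qpoch_inf_continuous (u : nat -> K) (a q : K) : `|q| < 1 ->
  (u n @[n --> \oo] --> a)%classic ->
  (qpoch_inf (u n) q @[n --> \oo] --> qpoch_inf a q)%classic.
Proof.
move=> q1 ua; pose B := `|a| + 1.
pose L := (1 - `|q|)^-1 * qpoch_inf (- B) `|q|.
have B0 : 0 <= B by rewrite addr_ge0.
have L0 : 0 < L.
  rewrite mulr_gt0 ?invr_gt0 ?subr_gt0 //.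
  exact: lt_le_trans (qpoch_infN_ge1 B0 _ _).
apply/cvgrPdist_lt => e e0.
have /cvgrPdist_lt h := ua.
have e1 : 0 < e / L by rewrite divr_gt0.
have h1 := h _ e1; have h2 := h 1 ltr01; apply: filterS2 h1 h2 => n h1 h2.
apply: (@le_lt_trans _ _ (`|a - u n| * L)); last by rewrite -ltr_pdivlMr.
apply: qpoch_inf_lipschitz => //; first by rewrite lerDl.
rewrite -[u n](subrK a) addrC; apply: le_trans (ler_normD _ _) _.
by rewrite lerD2l distrC ltW.
Qed.

End Products.
Arguments qfin_cvg {K} Kc a [q] _ [t] _.
(** * Theta functions *)

Section Theta.
Context {K : numFieldType} (Kc : hcomplete K).
Implicit Types (x y q Q : K) (k r : int).

Lemma int_ind_step (P : int -> Prop) :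
  P 0 -> (forall k, P k <-> P (k + 1)) -> forall k, P k.
Proof.
move=> P0 PS; have pos n : P (Posz n).
  by elim: n => // n /PS; rewrite -addn1 PoszD.
case=> // n; elim: n => [|n IH]; first by apply/PS.
by apply/PS; rewrite (_ : Negz n.+1 + 1 = Negz n) //; lia.
Qed.

Lemma exprzS q k : q != 0 -> q ^ (k + 1) = q ^ k * q.
Proof. by move=> q0; rewrite expfzDr // expr1z. Qed.

(** Identities among the Gaussian factors [jt] below are checked through this: same value at [0] and
    same ratio of consecutive terms. The nonvanishing ratio allows the downward steps. *)
Lemma int_rec_eq (c u v : int -> K) : (forall k, c k != 0) -> u 0 = v 0 ->
  (forall k, u (k + 1) = u k * c k) -> (forall k, v (k + 1) = v k * c k) -> u =1 v.
Proof.
move=> c0 uv0 uS vS; apply: int_ind_step => // k; rewrite uS vS; split=> [->//|].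
exact: mulIf.
Qed.

Lemma binz2S k : binz2 (k + 1) = binz2 k + k.
Proof.
rewrite /binz2 (_ : (k + 1) * (k + 1 - 1) = k * 2 + k * (k - 1)); last by ring.
by rewrite divzMDl // addrC.
Qed.

(** The term of the Jacobi triple product, and at the same time the quasi-period factor of
    [theta x q] under [x -> x q^k]. *)
Definition jt x q k : K := (- x) ^ k * q ^ binz2 k.

Lemma jt0 x q : jt x q 0 = 1.
Proof. by rewrite /jt /binz2 mul0r div0z !expr0z mulr1. Qed.

Lemma jtS x q k : x != 0 -> q != 0 -> jt x q (k + 1) = jt x q k * (- x * q ^ k).
Proof.
by move=> x0 q0; rewrite /jt exprzS ?oppr_eq0 // binz2S expfzDr //; ring.
Qed.

Lemma jt_neq0 x q k : x != 0 -> q != 0 -> jt x q k != 0.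
Proof. by move=> x0 q0; rewrite mulf_neq0 ?expfz_neq0 ?oppr_eq0. Qed.

Lemma jtstep_neq0 x q k : x != 0 -> q != 0 -> - x * q ^ k != 0.
Proof. by move=> x0 q0; rewrite mulf_neq0 ?expfz_neq0 ?oppr_eq0. Qed.

Lemma jtD x q k r : x != 0 -> q != 0 -> jt x q (k + r) = jt x q k * jt (x * q ^ k) q r.
Proof.
move=> x0 q0; have xq0 : x * q ^ k != 0 by rewrite mulf_neq0 ?expfz_neq0.
move: r; apply: (@int_rec_eq (fun r => - x * q ^ (k + r))).
- by move=> r; exact: jtstep_neq0.
- by rewrite addr0 jt0 mulr1.
- by move=> r; rewrite addrA jtS.
- by move=> r; rewrite jtS // expfzDr //; ring.
Qed.

Lemma jt_nat x q n : jt x q (Posz n) = \prod_(j < n) (- (x * q ^+ j)).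
Proof.
elim: n => [|n IH]; first by rewrite big_ord0 jt0.
rewrite big_ord_recr /= -IH /jt -addn1 PoszD binz2S.
have -> : binz2 n = Posz 'C(n, 2).
  elim: (n) => [|m IHm]; first by rewrite /binz2 mul0r div0z bin0n.
  by rewrite -addn1 PoszD binz2S IHm addn1 binS bin1 PoszD.
rewrite -!PoszD -!exprnP !exprD expr1; ring.
Qed.

Lemma norm_exprz x k : `|x ^ k| = `|x| ^ k.
Proof. by case: k => n; rewrite ?NegzE -?exprnN ?normfV normrX. Qed.

Lemma jt_norm x q k : `|jt x q k| = jt (- `|x|) `|q| k.
Proof. by rewrite /jt normrM !norm_exprz normrN opprK. Qed.

Definition theta x q : K := qpoch_inf x q * qpoch_inf (q / x) q.

Lemma theta_step x q : `|q| < 1 -> q != 0 -> x != 0 -> theta x q = - x * theta (x * q) q.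
Proof.
move=> q1 q0 x0; rewrite /theta (qpoch_infS Kc x) //.
rewrite [q / (x * q)](_ : _ = x^-1); last by field; rewrite ?q0 ?x0.
by rewrite [qpoch_inf x^-1 q](qpoch_infS Kc) // [x^-1 * q]mulrC; field.
Qed.

Lemma theta_shift x q k : `|q| < 1 -> q != 0 -> x != 0 ->
  theta (x * q ^ k) q * jt x q k = theta x q.
Proof.
move=> q1 q0 x0; move: k; apply: int_ind_step => [|k]; first by rewrite expr0z jt0 !mulr1.
have xq0 : x * q ^ k != 0 by rewrite mulf_neq0 ?expfz_neq0.
suff -> : theta (x * q ^ (k + 1)) q * jt x q (k + 1) = theta (x * q ^ k) q * jt x q k by [].
by rewrite exprzS // jtS // (theta_step q1 q0 xq0) [x * (q ^ k * q)]mulrA; ring.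
Qed.

Lemma theta_shift_div x q k : `|q| < 1 -> q != 0 -> x != 0 ->
  theta (x * q ^ k) q = theta x q / jt x q k.
Proof. by move=> q1 q0 x0; rewrite -(theta_shift k q1 q0 x0) mulfK // jt_neq0. Qed.

(** Each of the [n] additional factors is [1 - x q^(-j) = (- x q^(-j)) (1 - q^j / x)], and
    [jt x q (- n)] is the inverse of the product of the monomials. *)
Lemma qpoch_inf_reflect x q n : `|q| < 1 -> q != 0 -> x != 0 ->
  qpoch_inf (x * q ^ (- n%:Z)) q * jt x q (- n%:Z) = qpoch_inf x q * qfin (q / x) q n.
Proof.
move=> q1 q0 x0; elim: n => [|n IH]; first by rewrite oppr0 expr0z jt0 qfin0 !mulr1.
have e : - n%:Z = - n.+1%:Z + 1 by lia.
rewrite qfinSr mulrA -IH e jtS // exprzS // [x * (q ^ _ * q)]mulrA.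
rewrite [qpoch_inf (x * q ^ (- n.+1%:Z)) q](qpoch_infS Kc) //.
set P := qpoch_inf (_ * q) q; set J := jt _ _ _.
have -> : q ^ (- n.+1%:Z) = (q * q ^+ n)^-1 by rewrite -exprnN exprS.
by field; rewrite ?x0 ?q0 expf_neq0.
Qed.

End Theta.
(** * Classical q-series identities *)

Section QSeriesIdentities.
Context {K : numFieldType} (Kc : hcomplete K) (q : K) (q0 : q != 0) (q1 : `|q| < 1).
Implicit Types (x y w C A u : K) (k r : int).

Lemma normq_gt0 : 0 < `|q|. Proof. by rewrite normr_gt0. Qed.

(** Each factor satisfies [D Q^j <= (1 + (D / Q) Q^j) Q] with [Q = |q|]: the product of the brackets
    stays bounded and the factors [Q] give geometric decay. *)
Lemma prod_gauss_le (D : K) n : 0 <= D ->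
  \prod_(j < n) (D * `|q| ^+ j) <= qpoch_inf (- (D / `|q|)) `|q| * `|q| ^+ n.
Proof.
move=> D0; have nq0 := normq_gt0.
have DQ0 : 0 <= D / `|q| by rewrite divr_ge0.
apply: (@le_trans _ _ (qfin (- (D / `|q|)) `|q| n * `|q| ^+ n)); last first.
  by rewrite ler_wpM2r ?exprn_ge0 // qfinN_le_inf.
rewrite -[X in `|q| ^+ X]card_ord -prodr_const -big_split /=.
apply: ler_prod => j _; rewrite mulr_ge0 ?exprn_ge0 //= mulNr opprK mulrDl mul1r.
rewrite [X in _ <= _ + X](_ : _ = D * `|q| ^+ j) ?lerDr //.
by rewrite mulrAC divfK // gt_eqF.
Qed.

Lemma asum_prod_gauss (D : K) : 0 <= D -> asum (fun n => \prod_(j < n) (D * `|q| ^+ j)).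
Proof.
move=> D0; apply: asum_le (asumZ (qpoch_inf (- (D / `|q|)) `|q|)
   (asum_geometric (normr_ge0 q) q1)) => n.
have P0 : 0 <= qpoch_inf (- (D / `|q|)) `|q| by rewrite qpoch_infN_ge0 // divr_ge0.
rewrite [leLHS]ger0_norm; last by apply: prodr_ge0 => j _; rewrite mulr_ge0 ?exprn_ge0.
by rewrite [leRHS]ger0_norm ?prod_gauss_le // mulr_ge0 ?exprn_ge0.
Qed.

Lemma norm_shift_le C n : `|C * q ^+ n| <= `|C|.
Proof. by rewrite normrM ler_piMr // normrX exprn_ile1 // ltW. Qed.

(** For [w != 0] this is the term of the basic hypergeometric series [1phi1 (C / w; C; q, w)]
    multiplied by [(C; q)_oo]. The form chosen has no [C / w] and no [(C; q)_s] in a denominator, so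
    [w = 0], [C = 0] and the zeros of [(C; q)_oo] need no separate treatment. *)
Definition cauchy_term w C (s : nat) : K :=
  \prod_(j < s) (- (q ^+ j * (w - C * q ^+ j))) * qpoch_inf (C * q ^+ s) q / qfin q q s.

Lemma cauchy_term_le w B : 0 <= B -> exists2 g : nat -> K, asum g &
  forall C s, `|C| <= B -> `|cauchy_term w C s| <= `|g s|.
Proof.
move=> B0; have [M M0 hM] := inv_qfin_bounded Kc q1.
have D0 : 0 <= `|w| + B by rewrite addr_ge0.
exists (fun s => qpoch_inf (- B) `|q| * M * \prod_(j < s) ((`|w| + B) * `|q| ^+ j)).
  exact/asumZ/asum_prod_gauss.
move=> C s CB; rewrite /cauchy_term !normrM -[leLHS]mulrA [leLHS]mulrC.
have E0 : 0 <= qpoch_inf (- B) `|q| by rewrite qpoch_infN_ge0.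
rewrite [`|qpoch_inf (- B) `|q| |]ger0_norm // [`|M|]ger0_norm ?(ltW M0) //.
apply: ler_pM => //; first by rewrite mulr_ge0.
  apply: ler_pM => //; apply: le_trans (norm_qpoch_inf_le Kc _ q1) _.
  by apply: qpoch_infN_le => //; apply: le_trans (norm_shift_le _ _) _.
rewrite [leRHS]ger0_norm; last by apply: prodr_ge0 => j _; rewrite mulr_ge0 ?exprn_ge0.
rewrite normr_prod; apply: ler_prod => j _.
rewrite normr_ge0 /= normrN normrM normrX mulrC ler_wpM2r ?exprn_ge0 //.
rewrite (le_trans (ler_normB _ _)) // lerD2l.
exact: le_trans (norm_shift_le _ _) _.
Qed.

Lemma cauchy_sum_exists w C : exists l, hsum (cauchy_term w C) l.
Proof.
have [g ag hg] := cauchy_term_le w (normr_ge0 C).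
by apply: Kc; apply: asum_le ag => s; apply: hg.
Qed.

(** Says that the terms at [C] and at [C q] differ by a telescoping quantity, with certificate
    [C q^s * cauchy_term w (C * q) s]. *)
Lemma cauchy_term_rec w C s : cauchy_term w C s.+1 =
  cauchy_term w (C * q) s.+1 * (1 - C * q ^+ s.+1) + C * q ^+ s * cauchy_term w (C * q) s.
Proof.
rewrite /cauchy_term [in LHS]big_ord_recl [in RHS]big_ord_recr /= expr0 mulr1 mul1r.
set R := \prod_(i < s) - (q ^+ i * (w - C * q * q ^+ i)); set P2 := qpoch_inf (C * q * q ^+ s.+1) q.
have -> : \prod_(i < s) - (q ^+ bump 0 i * (w - C * q ^+ bump 0 i)) = R * q ^+ s.
  rewrite -[X in q ^+ X]card_ord -prodr_const -big_split /=; apply: eq_bigr => j _.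
  by rewrite /bump add1n exprS mulrA; ring.
have -> : C * q * q ^+ s = C * q ^+ s.+1 by rewrite exprS; ring.
rewrite [qpoch_inf (C * q ^+ s.+1) q](qpoch_infS Kc) //.
have -> : C * q ^+ s.+1 * q = C * q * q ^+ s.+1 by ring.
rewrite -/P2 qfinSr; have := qfin_self_neq0 s.+1 q1; rewrite qfinSr mulf_eq0 negb_or.
rewrite exprS => /andP[d0 d1].
by field; rewrite d0 d1.
Qed.

Lemma cauchy_sum_shift w C l : hsum (cauchy_term w C) l -> hsum (cauchy_term w (C * q)) l.
Proof.
move=> h; have [m hm] := cauchy_sum_exists w (C * q).
pose B s : K := if s is t.+1 then C * q ^+ t * cauchy_term w (C * q) t else 0.
suff -> : l = m by [].
have hd := hsumD h (hsumZ (-1) hm).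
have B0 : (B n @[n --> \oo] --> (0 : K))%classic.
  rewrite -(cvg_shiftS B) /=.
  have hz : (C * q ^+ n @[n --> \oo] --> C * 0)%classic by apply: seq_cvgZ; exact: cvg_expr0.
  by have := seq_cvgM hz (hsum_cvg0 hm); rewrite !mulr0.
have := hsum_telescope hd (B := B) _ B0; rewrite /= => /(_ _)/wrap[|].
  case=> [|s]; rewrite /B.
    rewrite /cauchy_term !big_ord0 qfin0 !expr0 !mulr1 !mul1r !divr1 (qpoch_infS Kc C) //.
    by ring.
  by rewrite cauchy_term_rec !exprS; ring.
by move=> /eqP; rewrite mulN1r subr_eq0 => /eqP.
Qed.

(** The sum is unchanged under [C -> C q], hence equals its limit at [C = 0] and does not depend on
    [C] at all. At [C = w] the factor [j = 0] kills every term but the first, which is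
    [(w; q)_oo]. *)
Lemma cauchy_sum w C : hsum (cauchy_term w C) (qpoch_inf w q).
Proof.
have zero D l : hsum (cauchy_term w D) l -> hsum (cauchy_term w 0) l.
  move=> h; have [m hm] := cauchy_sum_exists w 0.
  have hn n : hsum (cauchy_term w (D * q ^+ n)) l.
    by elim: n => [|n IH]; rewrite ?expr0 ?mulr1 // exprSr mulrA; apply: cauchy_sum_shift.
  have [g ag hg] := cauchy_term_le w (normr_ge0 D).
  have lm : ((fun=> l) n @[n --> \oo] --> m)%classic.
    apply: (tannery Kc ag _ _ hn hm) => [n s|s]; first exact/hg/norm_shift_le.
    have c0 : (D * q ^+ n @[n --> \oo] --> (0 : K))%classic.
      by rewrite -(mulr0 D); apply: seq_cvgZ; exact: cvg_expr0.
    rewrite /cauchy_term; apply: seq_cvgM; last exact: cvg_cst.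
    apply: seq_cvgM.
      apply: (@cvg_bigprod _ _ (index_enum _)
        (fun n (j : 'I_s) => - (q ^+ j * (w - D * q ^+ n * q ^+ j)))
        (fun j : 'I_s => - (q ^+ j * (w - 0 * q ^+ j)))) => j.
      apply: cvgN; apply: seq_cvgZ; apply: cvgB; first exact: cvg_cst.
      by apply: cvgM => //; exact: cvg_cst.
    apply: qpoch_inf_continuous => //; apply: seq_cvgM => //; exact: cvg_cst.
  by rewrite (seq_cvg_unique (@cvg_cst _ l nat (\oo)%classic _) lm).
have hw : hsum (cauchy_term w w) (qpoch_inf w q).
  move=> e e0; exists [:: 0%N] => t ut st.
  rewrite (@big_uniq_subset _ _ _ [:: 0%N]) // big_seq1 big1 => [|[|s] // _].
    by rewrite /cauchy_term big_ord0 expr0 qfin0 mul1r mulr1 divr1 addr0 subrr normr0.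
  by rewrite /cauchy_term big_ord_recl expr0 mulr1 subrr mulr0 oppr0 !mul0r.
have [l hl] := cauchy_sum_exists w C.
by rewrite (hsum_unique (zero _ _ hw) (zero _ _ hl)).
Qed.

Lemma euler_sum x : hsum (fun s => jt x q (Posz s) / qfin q q s) (qpoch_inf x q).
Proof.
apply: eq_hsum (cauchy_sum x 0) => s.
rewrite /cauchy_term mul0r qpoch_inf0 // mulr1 jt_nat; congr (_ / _).
by apply: eq_bigr => j _; rewrite mul0r subr0 mulrC.
Qed.

End QSeriesIdentities.

(** * Lebesgue's identity and its analogue with a linear factor *)

Section BasicSums.
Context {K : numFieldType} (Kc : hcomplete K).
Implicit Types (x v q A u : K).

Definition bterm q x v (s : nat) : K := jt x q (Posz s) * qfin v q s / qfin q q s.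

Lemma jt_nat_norm x q n : `|jt x q (Posz n)| = \prod_(j < n) (`|x| * `|q| ^+ j).
Proof.
rewrite jt_nat normr_prod; apply: eq_bigr => j _.
by rewrite normrN normrM normrX.
Qed.

Lemma bterm_le q x B : q != 0 -> `|q| < 1 -> 0 <= B -> exists2 g : nat -> K, asum g &
  forall v s, `|v| <= B -> `|bterm q x v s| <= `|g s|.
Proof.
move=> q0 q1 B0; have [M M0 hM] := inv_qfin_bounded Kc q1.
exists (fun s => qpoch_inf (- B) `|q| * M * \prod_(j < s) (`|x| * `|q| ^+ j)).
  exact/asumZ/(asum_prod_gauss Kc q0 q1).
move=> v s vB; rewrite /bterm -mulrA normrM [X in _ * X <= _]normrM [leLHS]mulrC jt_nat_norm.
have E0 : 0 <= qpoch_inf (- B) `|q| by rewrite qpoch_infN_ge0.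
rewrite !normrM [`|qpoch_inf (- B) `|q| |]ger0_norm // [`|M|]ger0_norm ?(ltW M0) //.
have pr0 : 0 <= \prod_(j < s) (`|x| * `|q| ^+ j).
  by apply: prodr_ge0 => j _; rewrite mulr_ge0 ?exprn_ge0.
rewrite [X in _ <= _ * X]ger0_norm // ler_wpM2r //.
apply: ler_pM => //; apply: le_trans (norm_qfin_le_inf Kc _ _ q1) _.
exact: qpoch_infN_le.
Qed.

Lemma bterm_sum_exists q x v : q != 0 -> `|q| < 1 -> exists l, hsum (bterm q x v) l.
Proof.
move=> q0 q1; have [g ag hg] := bterm_le x q0 q1 (normr_ge0 v).
by apply: Kc; apply: asum_le ag => s; apply: hg.
Qed.

Lemma bterm_cvg q x (v : nat -> K) s : (v n @[n --> \oo] --> (0 : K))%classic ->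
  (bterm q x (v n) s @[n --> \oo] --> jt x q (Posz s) / qfin q q s)%classic.
Proof.
move=> v0; rewrite /bterm.
apply: seq_cvgM; last exact: cvg_cst.
suff h : (qfin (v n) q s @[n --> \oo] --> (1 : K))%classic.
  by have := seq_cvgZ (jt x q s) h; rewrite mulr1.
suff : (\prod_(j < s) (1 - v n * q ^+ j) @[n --> \oo]
    --> \prod_(j < s) (1 - 0 * q ^+ j))%classic.
  rewrite (_ : \prod_(j < s) (1 - 0 * q ^+ j) = 1) //.
  by rewrite big1 // => j _; rewrite mul0r subr0.
apply: (@cvg_bigprod _ _ (index_enum _) (fun n (j : 'I_s) => 1 - v n * q ^+ j)
  (fun j => 1 - 0 * q ^+ j)) => j.
apply: cvgB; first exact: cvg_cst.
by apply: cvgM => //; exact: cvg_cst.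
Qed.

Lemma qfin_succ2 v q s : (1 - v * q) * qfin (v * q ^+ 2) q s.+1 =
  qfin (v * q) q s * (1 - v * q ^+ s.+1) * (1 - v * q ^+ s.+2).
Proof.
have -> : v * q ^+ 2 = v * q * q by ring.
rewrite -qfinS !qfinSr; congr (_ * (1 - _) * (1 - _)); rewrite -mulrA -exprS //.
Qed.

(** The certificate sits at the intermediate parameter [A q], since [(A; q)_(s+1)] and
    [(1 - A q) (A q^2; q)_(s+1)] both contain [(A q; q)_s]. *)
Lemma lebesgue_rec q A l m : q != 0 -> `|q| < 1 ->
  hsum (bterm q (- q) A) l -> hsum (bterm q (- q) (A * q ^+ 2)) m -> l = (1 - A * q) * m.
Proof.
move=> q0 q1 hl hm; have [o ho] := bterm_sum_exists (- q) (A * q) q0 q1.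
pose B s : K := if s is t.+1 then - (A * q ^+ t.+1 * bterm q (- q) (A * q) t) else 0.
have hd := hsumD hl (hsumZ (- (1 - A * q)) hm).
have B0 : (B n @[n --> \oo] --> (0 : K))%classic.
  have c : (q ^+ n.+1 @[n --> \oo] --> (0 : K))%classic.
    by rewrite (cvg_shiftS (fun n => q ^+ n)); exact: cvg_expr0.
  have := seq_cvgZ (-1) (seq_cvgM (seq_cvgZ A c) (hsum_cvg0 ho)); rewrite !mulr0 => h.
  by rewrite -(cvg_shiftS B); apply: eq_seq_cvg h => n; rewrite mulN1r.
have := hsum_telescope hd (B := B) _ B0; rewrite /= => /(_ _)/wrap[|].
  case=> [|s]; rewrite /B /bterm.
    by rewrite !qfin0 jt0 !mulr1 !divr1; ring.
  rewrite [qfin A q s.+1]qfinS; set T := _ + _.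
  have -> : T = (jt (- q) q s.+1 * ((1 - A) * qfin (A * q) q s)
     - jt (- q) q s.+1 * ((1 - A * q) * qfin (A * q ^+ 2) q s.+1)) / qfin q q s.+1.
    by rewrite /T; ring.
  rewrite qfin_succ2 !jt_nat !big_ord_recr /=.
  set N := \prod_(i < s) _; set P := qfin (A * q) q s.
  rewrite ![qfin _ _ s.+1]qfinSr -/P.
  have := qfin_self_neq0 s.+1 q1; rewrite qfinSr mulf_eq0 negb_or.
  rewrite !exprS => /andP[d0 d1].
  by field; rewrite d0 d1.
by move=> /eqP; rewrite mulNr subr_eq0 => /eqP.
Qed.

(** Iteration gives [f A = (A q; q^2)_n f (A q^(2n))], and the series at argument tending to [0]
    tends to Euler's sum for [(- q; q)_oo]. *)
Lemma lebesgue_sum q A : q != 0 -> `|q| < 1 ->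
  hsum (bterm q (- q) A) (qpoch_inf (- q) q * qpoch_inf (A * q) (q ^+ 2)).
Proof.
move=> q0 q1; have q2 := @norm_expS_lt1 _ q 1 q1.
have [f hf] := choice (fun v => bterm_sum_exists (- q) v q0 q1).
have fE n : f A = qfin (A * q) (q ^+ 2) n * f (A * (q ^+ 2) ^+ n).
  elim: n => [|n ->]; first by rewrite qfin0 expr0 mul1r mulr1.
  rewrite qfinSr -mulrA; congr (_ * _).
  rewrite (lebesgue_rec q0 q1 (hf _) (hf _)) [_ ^+ n.+1]exprSr mulrA; congr ((1 - _) * _).
  by rewrite mulrAC.
suff fA : qpoch_inf (- q) q * qpoch_inf (A * q) (q ^+ 2) = f A by rewrite fA; exact: hf.
rewrite mulrC; have c0 : (A * (q ^+ 2) ^+ n @[n --> \oo] --> (0 : K))%classic.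
  by rewrite -(mulr0 A); apply: seq_cvgZ; exact: cvg_expr0.
have fc : (f (A * (q ^+ 2) ^+ n) @[n --> \oo] --> qpoch_inf (- q) q)%classic.
  have [g ag hg] := bterm_le (- q) q0 q1 (normr_ge0 A).
  apply: (tannery Kc ag _ _ (fun n => hf _) (euler_sum Kc q0 q1 (- q))) => [n s|s].
    exact/hg/norm_shift_le.
  exact: bterm_cvg.
have h := seq_cvgM (qfin_cvg Kc (A * q) q2) fc.
apply: (seq_cvg_unique h); apply: eq_seq_cvg (@cvg_cst _ (f A) nat (\oo)%classic _) => n.
exact: fE.
Qed.

(** Both terms contain [(u^2 q^2; q^2)_s], and the factor [1 + u] of the recurrence is split off
    from [1 - u^2]. *)
Lemma prod_quad_rec q u l m : q != 0 -> `|q| < 1 ->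
  hsum (fun s => (1 + u * (q ^+ 2) ^+ s) * bterm (q ^+ 2) q (u ^+ 2) s) l ->
  hsum (fun s => (1 + u * q * (q ^+ 2) ^+ s) * bterm (q ^+ 2) q ((u * q) ^+ 2) s) m ->
  l = (1 + u) * m.
Proof.
move=> q0 q1; have q2 := @norm_expS_lt1 _ q 1 q1; have p0 : q ^+ 2 != 0 by rewrite expf_neq0.
have -> : (u * q) ^+ 2 = u ^+ 2 * q ^+ 2 by ring.
set p := q ^+ 2 in q2 p0 *; move=> hl hm.
have [o ho] := bterm_sum_exists q (u ^+ 2 * p) p0 q2.
pose B s : K := if s is t.+1 then u * (1 + u) * q * p ^+ t * bterm p q (u ^+ 2 * p) t else 0.
have hd := hsumD hl (hsumZ (- (1 + u)) hm).
have B0 : (B n @[n --> \oo] --> (0 : K))%classic.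
  have := seq_cvgM (seq_cvgZ (u * (1 + u) * q) (cvg_expr0 Kc q2)) (hsum_cvg0 ho).
  by rewrite !mulr0 => h; rewrite -(cvg_shiftS B); apply: eq_seq_cvg h => n.
have := hsum_telescope hd (B := B) _ B0; rewrite /= => /(_ _)/wrap[|].
  case=> [|s]; rewrite /B /bterm.
    by rewrite !qfin0 jt0 !expr0 !mulr1 !divr1; ring.
  rewrite [qfin (u ^+ 2) p s.+1]qfinS [qfin (u ^+ 2 * p) p s.+1]qfinSr.
  rewrite !jt_nat !big_ord_recr /=.
  set N := \prod_(i < s) _; set P := qfin (u ^+ 2 * p) p s.
  have := qfin_self_neq0 s.+1 q2; rewrite ![qfin p p s.+1]qfinSr mulf_eq0 negb_or.
  rewrite !exprS => /andP[d0 d1].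
  by rewrite /p in d0 d1 *; field; rewrite d0 d1.
by move=> /eqP; rewrite mulNr subr_eq0 => /eqP.
Qed.

(** Here [f u = (- u; q)_n f (u q^n)], and the limit at [0] is Euler's sum in base [q^2], with value
    [(q; q^2)_oo]. *)
Lemma prod_quad_sum q u : q != 0 -> `|q| < 1 ->
  hsum (fun s => (1 + u * (q ^+ 2) ^+ s) * bterm (q ^+ 2) q (u ^+ 2) s)
       (qpoch_inf q (q ^+ 2) * qpoch_inf (- u) q).
Proof.
move=> q0 q1; have q2 := @norm_expS_lt1 _ q 1 q1; have p0 : q ^+ 2 != 0 by rewrite expf_neq0.
pose a v s := (1 + v * (q ^+ 2) ^+ s) * bterm (q ^+ 2) q (v ^+ 2) s.
have ale B : 0 <= B -> exists2 g : nat -> K, asum g &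
    forall v s, `|v| <= B -> `|a v s| <= `|g s|.
  move=> B0; have [g ag hg] := bterm_le q p0 q2 (exprn_ge0 2 B0).
  exists (fun s => (1 + B) * g s); first exact: asumZ.
  move=> v s vB; rewrite /a normrM [leRHS]normrM; apply: ler_pM => //; last first.
    by apply: hg; rewrite normrX lerXn2r ?nnegrE.
  rewrite (le_trans (ler_normD _ _)) // normr1 ger0_norm ?addr_ge0 // lerD2l.
  by apply: le_trans (norm_shift_le _ _ _) _.
have aex v : exists l, hsum (a v) l.
  have [g ag hg] := ale _ (normr_ge0 v).
  by apply: Kc; apply: asum_le ag => s; apply: hg.
have [f hf] := choice aex.
have fE n : f u = qfin (- u) q n * f (u * q ^+ n).
  elim: n => [|n ->]; first by rewrite qfin0 expr0 mul1r mulr1.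
  rewrite qfinSr -mulrA; congr (_ * _).
  have := hf (u * q ^+ n * q); rewrite -[u * q ^+ n * q]mulrA -exprSr => h.
  rewrite (@prod_quad_rec q (u * q ^+ n) _ (f (u * q ^+ n.+1)) q0 q1 (hf _)).
    by rewrite mulNr opprK.
  by rewrite -[u * q ^+ n * q]mulrA -exprSr.
suff fu : qpoch_inf q (q ^+ 2) * qpoch_inf (- u) q = f u by rewrite fu; exact: hf.
rewrite mulrC; have c0 : (u * q ^+ n @[n --> \oo] --> (0 : K))%classic.
  by rewrite -(mulr0 u); apply: seq_cvgZ; exact: cvg_expr0.
have fc : (f (u * q ^+ n) @[n --> \oo] --> qpoch_inf q (q ^+ 2))%classic.
  have [g ag hg] := ale _ (normr_ge0 u).
  apply: (tannery Kc ag _ _ (fun n => hf _) (euler_sum Kc p0 q2 q)) => [n s|s].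
    exact/hg/norm_shift_le.
  have c1 : (1 + u * q ^+ n * (q ^+ 2) ^+ s @[n --> \oo] --> 1 + 0 * (q ^+ 2) ^+ s)%classic.
    by apply: seq_cvgD; [exact: cvg_cst|apply: seq_cvgM => //; exact: cvg_cst].
  have c2 : ((u * q ^+ n) ^+ 2 @[n --> \oo] --> (0 : K))%classic.
    by under eq_fun do rewrite expr2; have := seq_cvgM c0 c0; rewrite mulr0.
  by have := seq_cvgM c1 (@bterm_cvg (q ^+ 2) q _ s c2); rewrite mul0r addr0 mul1r.
have h := seq_cvgM (qfin_cvg Kc (- u) q1) fc.
apply: (seq_cvg_unique h); apply: eq_seq_cvg (@cvg_cst _ (f u) nat (\oo)%classic _) => n.
exact: fE.
Qed.

End BasicSums.

(** * Triple product, rearrangement of double sums, majorants *)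

Section TripleProduct.
Context {K : numFieldType} (Kc : hcomplete K).
Implicit Types (x y q Q : K) (k r : int).

Lemma jt_opp x q k : x != 0 -> q != 0 -> jt x q (- k) = jt (q / x) q k.
Proof.
move=> x0 q0; have qx0 : q / x != 0 by rewrite mulf_neq0 ?invr_eq0.
move: k; apply: (@int_rec_eq _ (fun k => - (q / x) * q ^ k)).
- by move=> k; exact: jtstep_neq0.
- by rewrite oppr0 !jt0.
- move=> k; pose m := - (k + 1).
  have e : q ^ m * q ^ k = q^-1 by rewrite -expfzDr // (_ : m + k = -1) // /m; ring.
  rewrite -/m (_ : - k = m + 1); last by rewrite /m; ring.
  rewrite jtS //.
  have -> : jt x q m * (- x * q ^ m) * (- (q / x) * q ^ k)
    = jt x q m * (x / x) * (q * (q ^ m * q ^ k)) by ring.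
  by rewrite e !divff // !mulr1.
- by move=> k; rewrite jtS.
Qed.

Lemma asum_jt x q : `|q| < 1 -> q != 0 -> x != 0 -> asum (jt x q).
Proof.
move=> q1 q0 x0; apply: asum_int.
  apply: asum_le (asum_prod_gauss Kc q0 q1 (normr_ge0 x)) => n.
  rewrite jt_nat_norm real_ler_norm // ger0_real // prodr_ge0 // => j _.
  by rewrite mulr_ge0 ?exprn_ge0.
have qx0 : q / x != 0 by rewrite mulf_neq0 ?invr_eq0.
have h := asum_prod_gauss Kc q0 q1 (normr_ge0 (q / x)).
apply: asum_le (asum_inj succn_inj h) => n.
rewrite NegzE jt_opp // jt_nat_norm real_ler_norm // ger0_real // prodr_ge0 // => j _.
by rewrite mulr_ge0 ?exprn_ge0.
Qed.

(** Euler's sum for [(x q^(-N); q)_oo], reindexed by [k = s - N] and reflected, sums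
    [jt x q k / (q; q)_(k + N)] over [k >= - N] to [(x; q)_oo (q / x; q)_N]. As [N] grows, dominated
    convergence replaces every denominator by [(q; q)_oo]. *)
Lemma jacobi_triple_product x q : `|q| < 1 -> q != 0 -> x != 0 ->
  hsum (jt x q) (qpoch_inf q q * theta x q).
Proof.
move=> q1 q0 x0; have P0 := qpoch_inf_self_neq0 Kc q1.
pose m (N : nat) (k : int) : option nat := if k + N is Posz n then Some n else None.
pose F (N : nat) k : K := if m N k is Some n then jt x q k / qfin q q n else 0.
have hF N : hsum (F N) (qpoch_inf x q * qfin (q / x) q N).
  have hK : pcancel (fun s : nat => s%:Z - N%:Z) (m N).
    by move=> s; rewrite /m subrK.
  have mK : ocancel (m N) (fun s : nat => s%:Z - N%:Z).
    by move=> k; rewrite /m; case e: (k + N) => [n|n] //=; rewrite -e addrK.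
  have f0 k : m N k = None -> F N k = 0 by rewrite /F => ->.
  apply/(hsum_pcan _ hK mK f0).
  rewrite -(qpoch_inf_reflect Kc) // mulrC.
  apply: eq_hsum (hsumZ _ (euler_sum Kc q0 q1 _)) => s.
  by rewrite /F hK [s%:Z - _]addrC jtD // mulrA.
have [L hL] := Kc (asum_jt q1 q0 x0).
have hL' := hsumZ (qpoch_inf q q)^-1 hL.
have [M M0 hM] := inv_qfin_bounded Kc q1.
have c : (qpoch_inf x q * qfin (q / x) q N @[N --> \oo] --> (qpoch_inf q q)^-1 * L)%classic.
  apply: (tannery Kc (asumZ M (asum_jt q1 q0 x0)) _ _ hF hL') => [N k|k].
    rewrite /F normrM; case: (m N k) => [n|]; last by rewrite normr0 mulr_ge0.
    rewrite normrM mulrC ler_wpM2r // (le_trans (hM n)) // real_ler_norm //.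
    by rewrite ger0_real ?ltW.
  rewrite -(cvg_shiftn `|k|%N) /=.
  pose d : nat := `|(k + Posz `|k|%N)%R|%N.
  have e N : F (N + `|k|)%N k = (qfin q q (N + d)%N)^-1 * jt x q k.
    rewrite /F /m (_ : k + Posz (N + `|k|)%N = Posz (N + d)%N) /d; last by lia.
    by rewrite mulrC.
  under eq_fun do rewrite e.
  apply: seq_cvgM; last exact: cvg_cst.
  by apply: cvgV => //; rewrite (cvg_shiftn d); exact: qfin_cvg.
have c' := seq_cvgZ (qpoch_inf x q) (qfin_cvg Kc (q / x) q1).
have e := seq_cvg_unique c' c.
by rewrite /theta e mulrA divff // mul1r.
Qed.

(** The majorant separates the variables, so [F] is summable over [int * nat]. Its rows give [g];
    the shear [(r, s) -> (r + s, s)] turns diagonals into rows and gives [h]. *)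
Lemma double_sum (F : int * nat -> K) (W : int -> K) Q (g h : int -> K) :
  asum W -> 0 <= Q -> Q < 1 -> (forall k s, `|F (k, s)| <= `|W k| * Q ^+ s) ->
  (forall k, hsum (fun s => F (k, s)) (g k)) ->
  (forall r, hsum (fun s : nat => F (r + s%:Z, s)) (h r)) ->
  asum g /\ exists2 l, hsum g l & hsum h l.
Proof.
move=> aW Q0 Q1 FW hg hh; have aQ := asum_geometric Q0 Q1; split.
  have [M hM] := aQ; apply: asum_le (asumZ M aW) => k.
  apply: hsum_norm_le (hg k) _ => s us; rewrite normrM mulrC.
  apply: (@le_trans _ _ (\sum_(i <- s) `|W k| * Q ^+ i)); first exact: ler_sum.
  rewrite -mulr_sumr ler_wpM2l //; have := hM s us.
  under eq_bigr do rewrite ger0_norm ?exprn_ge0 //.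
  move=> h1; apply: le_trans (h1) (real_ler_norm _).
  by apply: ger0_real; apply: le_trans h1; apply: sumr_ge0 => i _; rewrite exprn_ge0.
have aF : asum F.
  apply: asum_le (asum_prod aW aQ) => -[k s] /=.
  by apply: le_trans (FW k s) _; rewrite normrM [X in _ <= _ * X]ger0_norm ?exprn_ge0.
have [l hl] := Kc aF; exists l; first exact: fubini_hsum hl hg.
pose f (x : int * nat) : int * nat := (x.1 + x.2%:Z, x.2).
pose f' (x : int * nat) : int * nat := (x.1 - x.2%:Z, x.2).
have fK : cancel f f' by case=> r s; rewrite /f /f' /= addrK.
have f'K : cancel f' f by case=> r s; rewrite /f /f' /= subrK.
have hl' : hsum (fun i : int * nat => F (f i)) l by apply/(hsum_bij _ _ fK f'K).
exact: fubini_hsum hl' hh.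
Qed.

Lemma qpoch_inf_shift_neg x q n : `|q| < 1 -> q != 0 ->
  qpoch_inf (x * q ^ (- n%:Z)) q = qpoch_inf x q * \prod_(j < n) (1 - x * q ^- j.+1).
Proof.
move=> q1 q0; elim: n => [|n IH]; first by rewrite oppr0 expr0z big_ord0 !mulr1.
have e : x * q ^ (- n.+1%:Z) * q = x * q ^ (- n%:Z).
  by rewrite -mulrA -exprzS //; congr (_ * _ ^ _); lia.
by rewrite (qpoch_infS Kc) // e IH big_ord_recr /= -exprnN; ring.
Qed.

(* Since [w - C p^j = - C (p^j + bt / p)] for [w = - bt C / p], the finite products coming from
   [(- bt p^-s; p)_oo] are those of [cauchy_sum]. *)
Lemma inner_sum (C bt p : K) : `|p| < 1 -> p != 0 ->
  hsum (fun s : nat => \prod_(j < s) (C * (p ^+ j) ^+ 2) * qpoch_inf (- bt * p ^ (- s%:Z)) p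
          * qpoch_inf (C * p ^+ s) p / qfin p p s)
       (qpoch_inf (- bt) p * qpoch_inf (- (bt * C / p)) p).
Proof.
move=> p1 p0; apply: eq_hsum (hsumZ _ (cauchy_sum Kc p0 p1 (- (bt * C / p)) C)) => s.
rewrite qpoch_inf_shift_neg // /cauchy_term.
have -> : \prod_(j < s) - (p ^+ j * (- (bt * C / p) - C * p ^+ j)) =
    \prod_(j < s) (C * (p ^+ j) ^+ 2) * \prod_(j < s) (1 - - bt * p ^- j.+1).
  rewrite -big_split /=; apply: eq_bigr => j _.
  by rewrite [p ^+ _.+1]exprS; field; rewrite ?expf_neq0 ?p0.
by ring.
Qed.

Lemma exprz_gt0 Q k : 0 < Q -> 0 < Q ^ k.
Proof. by case: k => n h; rewrite ?NegzE -?exprnN ?invr_gt0 exprn_gt0. Qed.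

Lemma jtN_gt0 y Q k : 0 < y -> 0 < Q -> 0 < jt (- y) Q k.
Proof. by move=> y0 Q0; rewrite /jt opprK mulr_gt0 ?exprz_gt0. Qed.

(** The companion factor in a theta function of negative argument is at least [1]; quasi-periodicity
    then makes the growth in [k] explicit. *)
Lemma qpoch_infN_le_theta y Q k : 0 < y -> 0 < Q -> Q < 1 ->
  qpoch_inf (- (y * Q ^ k)) Q <= theta (- y) Q / jt (- y) Q k.
Proof.
move=> y0 Q0 Q1; have nQ1 : `|Q| < 1 by rewrite gtr0_norm.
have yk := mulr_gt0 y0 (exprz_gt0 k Q0).
have yn0 : - y != 0 by rewrite oppr_eq0 gt_eqF.
have Qn0 : Q != 0 by rewrite gt_eqF.
rewrite -(theta_shift_div Kc k nQ1 Qn0 yn0) /theta mulNr.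
rewrite -[leLHS]mulr1 ler_wpM2l ?qpoch_infN_ge0 ?(ltW yk) ?(ltW Q0) //.
by rewrite invrN mulrN qpoch_infN_ge1 ?(ltW Q0) // divr_ge0 ?(ltW yk) ?(ltW Q0).
Qed.

(** For [k >= 0] the product at [- B T^(-k)] grows like [1 / jt (- B) T (- k)], which consumes half
    of the quadratic exponent in base [T^2]; the rest is the summable family [jt (- D) T]. For
    [k < 0] that product is at most its value at [k = 0], and the hypothesis with [c2] and [mu]
    supplies geometric decay. *)
Lemma asum_weight_gen (T Y B kappa c1 c2 mu : K) (E : int -> K) :
  0 < T -> T < 1 -> 0 < Y -> 0 < B -> 0 < kappa -> 0 <= mu -> mu < 1 ->
  (forall k, 0 <= E k) -> (forall n : nat, E n%:Z <= c1) ->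
  (forall n : nat, kappa ^ Negz n * jt (- Y) (T ^+ 2) (Negz n) * E (Negz n) <= c2 * mu ^+ n) ->
  asum (fun k : int => kappa ^ k * jt (- Y) (T ^+ 2) k
     * qpoch_inf (- (B * T ^ (- k))) T * E k).
Proof.
move=> T0 T1 Y0 B0 kap0 mu0 mu1 E0 Ec1 Ec2.
have TT0 : 0 < T ^+ 2 by rewrite exprn_gt0.
have nT1 : `|T| < 1 by rewrite gtr0_norm.
have Tn0 : T != 0 by rewrite gt_eqF.
have TTn0 : T ^+ 2 != 0 by rewrite gt_eqF.
have EB (y : K) : 0 < y -> 0 <= qpoch_inf (- y) T.
  by move=> y0; rewrite qpoch_infN_ge0 ?(ltW y0) ?(ltW T0).
have pos k : 0 < kappa ^ k * jt (- Y) (T ^+ 2) k.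
  exact: mulr_gt0 (exprz_gt0 k kap0) (jtN_gt0 k Y0 TT0).
have posB k : 0 < B * T ^ (- k) by rewrite mulr_gt0 ?exprz_gt0.
have thB : 0 <= theta (- B) T.
  by rewrite /theta mulr_ge0 ?EB // invrN mulrN EB // divr_gt0.
have lhs0 k := mulr_ge0 (mulr_ge0 (ltW (pos k)) (EB _ (posB k))) (E0 k).
have c10 : 0 <= c1 := le_trans (E0 0) (Ec1 0%N).
have E1B := EB _ B0.
apply: asum_int.
  (* Consecutive ratios are [kappa Y T^(2k)] above and [(T / B) T^k] below; their quotient is
     [D T^k]. *)
  pose D := kappa * Y * B / T; have D0 : 0 < D by rewrite !mulr_gt0 ?invr_gt0.
  have aD : asum (fun n : nat => jt (- D) T n%:Z).
    by apply: asum_inj (asum_jt nT1 Tn0 _) => [i j []//|]; rewrite oppr_eq0 gt_eqF.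
  have e k : kappa ^ k * jt (- Y) (T ^+ 2) k / jt (- B) T (- k) = jt (- D) T k.
    have nz (y : K) : 0 < y -> - y != 0 by move=> ?; rewrite oppr_eq0 gt_eqF.
    rewrite jt_opp // ?nz //.
    have TB0 : T / - B != 0 by rewrite mulf_neq0 ?invr_eq0 ?nz.
    move: k; apply: (@int_rec_eq _ (fun k => - - D * T ^ k)).
    - by move=> k; rewrite opprK mulf_neq0 ?expfz_neq0 ?gt_eqF.
    - by rewrite expr0z !jt0 mulr1 divr1.
    - move=> k; rewrite !jtS ?nz // exprzS ?gt_eqF // expr2 expfzMl /D.
      have := jt_neq0 k TB0 Tn0; set J := jt (T / - B) T k => J0.
      by field; rewrite ?J0 ?expfz_neq0 ?Tn0 ?gt_eqF.
    - by move=> k; rewrite jtS ?nz.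
  apply: asum_le (asumZ (theta (- B) T * c1) aD) => n.
  rewrite (ger0_norm (lhs0 _)).
  rewrite (ger0_norm (mulr_ge0 (mulr_ge0 thB c10) (ltW (jtN_gt0 _ D0 T0)))) -e.
  rewrite [leRHS](_ : _ = kappa ^ n * jt (- Y) (T ^+ 2) n
    * (theta (- B) T / jt (- B) T (- n%:Z)) * c1); last by ring.
  apply: (ler_pM (mulr_ge0 (ltW (pos _)) (EB _ (posB _))) (E0 _)) => //.
  by rewrite ler_wpM2l ?(ltW (pos _)) // qpoch_infN_le_theta.
apply: asum_le (asumZ (qpoch_inf (- B) T * c2) (asum_geometric mu0 mu1)) => n.
rewrite (ger0_norm (lhs0 _)) mulrAC [leLHS]mulrC.
apply: le_trans (real_ler_norm _); last first.
  rewrite -mulrA; apply: realM; first exact: ger0_real.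
  by apply: ger0_real; apply: le_trans (Ec2 n); exact: mulr_ge0 (ltW (pos _)) (E0 _).
rewrite -[leRHS]mulrA; apply: ler_pM => //; first exact: EB.
  exact: mulr_ge0 (ltW (pos _)) (E0 _).
apply: qpoch_infN_le; rewrite ?(ltW (posB _)) ?(ltW T0) //.
by rewrite NegzE opprK ler_piMr ?(ltW B0) // exprn_ile1 ?(ltW T0) ?(ltW T1).
Qed.

(** For [k < 0] the last product is bounded by a constant over [jt (- Y) (T ^+ 2) k] and cancels the
    Gaussian factor entirely, so convergence rests on [kappa > 1], with ratio [kappa^-1]. *)
Lemma asum_weight (T Y B kappa : K) : 0 < T -> T < 1 -> 0 < Y -> 0 < B -> 1 < kappa ->
  asum (fun k : int => kappa ^ k * jt (- Y) (T ^+ 2) k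
     * qpoch_inf (- (B * T ^ (- k))) T * qpoch_inf (- (Y * (T ^+ 2) ^ k)) (T ^+ 2)).
Proof.
move=> T0 T1 Y0 B0 k1; have kap0 : 0 < kappa by apply: lt_trans k1.
have TT0 : 0 < T ^+ 2 by rewrite exprn_gt0.
have TT1 : T ^+ 2 < 1 by rewrite exprn_ilt1 // ltW.
have posY k : 0 < Y * (T ^+ 2) ^ k by rewrite mulr_gt0 ?exprz_gt0.
have i1 : kappa^-1 < 1 by rewrite invf_lt1.
have i0 : 0 <= kappa^-1 by rewrite invr_ge0 ltW.
apply: (asum_weight_gen (c1 := qpoch_inf (- Y) (T ^+ 2))
  (c2 := theta (- Y) (T ^+ 2) * kappa^-1) T0 T1 Y0 B0 kap0 i0 i1) => [k|n|n].
- by rewrite qpoch_infN_ge0 ?(ltW (posY _)) ?(ltW TT0).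
- apply: qpoch_infN_le; rewrite ?(ltW (posY _)) ?(ltW TT0) //.
  by rewrite ler_piMr ?(ltW Y0) // exprn_ile1 // ?(ltW TT0) ?(ltW TT1).
have -> : kappa ^ Negz n = kappa^-1 * kappa^-1 ^+ n by rewrite NegzE -exprnN -exprVn exprS.
have J0 := jtN_gt0 (Negz n) Y0 TT0; set J := jt _ _ _ in J0 *.
rewrite [leRHS](_ : _ = kappa^-1 * kappa^-1 ^+ n * J
    * (theta (- Y) (T ^+ 2) / J)); last by field; rewrite ?gt_eqF.
rewrite ler_wpM2l //; last exact: qpoch_infN_le_theta.
exact: mulr_ge0 (mulr_ge0 i0 (exprn_ge0 n i0)) (ltW J0).
Qed.

End TripleProduct.
(** * Bilateral transformations *)

Section CubeTransformation.
Context {K : numFieldType} (Kc : hcomplete K).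
Implicit Types (x y z q b C : K) (k r : int) (s n : nat).

Lemma jt_natE x q n : jt x q n%:Z = (- x) ^+ n * q ^+ 'C(n, 2).
Proof.
rewrite jt_nat; elim: n => [|n IH]; first by rewrite big_ord0 mulr1.
by rewrite big_ord_recr /= IH binS bin1 exprD exprS; ring.
Qed.

Lemma jt_sqr x q k : x != 0 -> q != 0 -> jt x q k ^+ 2 = jt (- x ^+ 2) (q ^+ 2) k.
Proof.
move=> x0 q0; have xx0 : - x ^+ 2 != 0 by rewrite oppr_eq0 expf_neq0.
have qq0 : q ^+ 2 != 0 by rewrite expf_neq0.
move: k; apply: (@int_rec_eq _ (fun k => x ^+ 2 * (q ^+ 2) ^ k)).
- by move=> k; rewrite mulf_neq0 ?expfz_neq0 ?expf_neq0.
- by rewrite !jt0 expr1n.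
- by move=> k; rewrite jtS // [in RHS]expr2 expfzMl; ring.
- by move=> k; rewrite jtS // opprK.
Qed.

Lemma jt_sqr_nat x q n : jt x q n%:Z ^+ 2 = \prod_(j < n) (x ^+ 2 * (q ^+ j) ^+ 2).
Proof.
rewrite jt_nat -prodrXl; apply: eq_bigr => j _.
by rewrite sqrrN exprMn.
Qed.

(** The right side is the denominator that reflection produces on a diagonal; the left side comes
    from the theta shift and from Lebesgue's series. *)
Lemma jt_merge_nat C q n :
  jt C (q ^+ 2) n%:Z * jt (- q) q n%:Z = jt (C * q ^+ n) q n%:Z.
Proof.
rewrite !jt_natE opprK -mulNr [in RHS]exprMn.
have -> : (- C) ^+ n * (q ^+ 2) ^+ 'C(n, 2) * (q ^+ n * q ^+ 'C(n, 2)) =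
  (- C) ^+ n * (q ^+ (2 * 'C(n, 2) + n) * q ^+ 'C(n, 2)) by rewrite exprD exprM; ring.
rewrite -mulrA -exprM; congr (_ * (_ ^+ _ * _)).
by elim: n => // n IH; rewrite binS bin1; lia.
Qed.

(** Since [|p|^j (1 + |V| |p|^j) <= 1 + |V| |p|^(2j)], the Gaussian factor of [jt] pays for passing
    to the squared base. In the uses [V] grows with [k], and in the squared base its product pairs
    with half of another product to form a theta function. *)
Lemma bterm_bound p x (V : K) s : `|p| < 1 ->
  `|jt x p s%:Z * qfin V p s| <= `|x| ^+ s * qpoch_inf (- `|V|) (`|p| ^+ 2).
Proof.
move=> p1; have pp1 : `|p| ^+ 2 < 1 by rewrite exprn_ilt1.
apply: (@le_trans _ _ (`|x| ^+ s * qfin (- `|V|) (`|p| ^+ 2) s)); last first.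
  by rewrite ler_wpM2l ?exprn_ge0 // qfinN_le_inf // exprn_ge0.
rewrite normrM jt_nat_norm normr_prod -big_split /=.
rewrite -[X in `|x| ^+ X]card_ord -prodr_const -big_split /=.
apply: ler_prod => j _; rewrite !mulr_ge0 ?exprn_ge0 //= -mulrA ler_wpM2l //.
have pj1 : `|p| ^+ j <= 1 by rewrite exprn_ile1 // ltW.
apply: (@le_trans _ _ (`|p| ^+ j * (1 + `|V| * `|p| ^+ j))).
  rewrite ler_wpM2l ?exprn_ge0 //.
  by rewrite (le_trans (ler_normB _ _)) // normr1 normrM normrX.
rewrite mulNr opprK mulrDr mulr1 lerD // -exprM mulnC exprM expr2.
by rewrite mulrCA.
Qed.

Lemma jt_neg_nat C q s : C != 0 -> q != 0 ->
  jt (C * (q ^+ 2) ^+ s) q (- s%:Z) = (jt (C * q ^+ s) q s%:Z)^-1.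
Proof.
move=> C0 q0; have Cs : C * q ^+ s != 0 by rewrite mulf_neq0 ?expf_neq0.
have := jtD s%:Z (- s%:Z) Cs q0; rewrite subrr jt0 -exprnP.
have -> : C * q ^+ s * q ^+ s = C * (q ^+ 2) ^+ s by rewrite -exprM mulnC exprM; ring.
by move=> h; rewrite -[RHS]mulr1 h mulKf // jt_neq0.
Qed.


Lemma norm_mul4_le (a b c d a' b' c' d' : K) :
  `|a| <= a' -> `|b| <= b' -> `|c| <= c' -> `|d| <= d' -> `|a * b * c * d| <= a' * b' * c' * d'.
Proof. by move=> ha hb hc hd; rewrite !normrM !ler_pM ?mulr_ge0. Qed.

(** Lebesgue's identity at [A = 1], where the series stops after its first term. *)
Lemma qpoch_inf_neg_mul q : `|q| < 1 -> q != 0 ->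
  qpoch_inf (- q) q * qpoch_inf q (q ^+ 2) = 1.
Proof.
move=> q1 q0; have := lebesgue_sum Kc 1 q0 q1; rewrite mul1r => h.
apply: (hsum_unique h) => e e0; exists [:: 0%N] => t ut st.
rewrite (@big_uniq_subset _ _ _ [:: 0%N]) // big_seq1 big1 => [|[|s] // _].
  by rewrite /bterm jt0 !qfin0 !mulr1 divr1 addr0 subrr normr0.
by rewrite /bterm qfinS subrr mul0r mulr0 mul0r.
Qed.

Section Expansion.
Variables (q z b : K).
Hypotheses (q0 : q != 0) (q1 : `|q| < 1) (z0 : z != 0).

(** For a suitable [b], [v k] is a constant times the term of the bilateral series; [F] is the
    expanded family and [h r] its sum over the diagonal [k - s = r]. *)
Let v k := jt z q k ^+ 2 * qpoch_inf (z ^+ 2 * (q ^+ 2) ^ k * q) (q ^+ 2)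
           * qpoch_inf (- b * q ^ (- k)) q.
Let h r := jt (z ^+ 2) (q ^+ 2) r * jt z q r ^+ 2
           * (qpoch_inf (- b * q ^ (- r)) q
              * qpoch_inf (- (b * q ^ (- r) * (z ^+ 2 * (q ^+ 2) ^ r) / q)) q).
Let F (i : int * nat) := jt (z ^+ 2) (q ^+ 2) i.1 * jt z q i.1 ^+ 2
   * qpoch_inf (- b * q ^ (- i.1)) q * (qpoch_inf (z ^+ 2 * (q ^+ 2) ^ i.1) q
   * bterm q (- q) (q / (z ^+ 2 * (q ^+ 2) ^ i.1)) i.2).

Let p1 : `|q ^+ 2| < 1. Proof. exact: norm_expS_lt1. Qed.
Let p0 : q ^+ 2 != 0. Proof. by rewrite expf_neq0. Qed.
Let zz0 : z ^+ 2 != 0. Proof. by rewrite expf_neq0. Qed.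
Let x0 k : z ^+ 2 * (q ^+ 2) ^ k != 0. Proof. by rewrite mulf_neq0 ?expfz_neq0. Qed.

(** With [x = z^2 q^(2k)], split [(x; q)_oo = (x; q^2)_oo (x q; q^2)_oo]; Lebesgue's identity at
    [A = q / x] supplies [(q^2 / x; q^2)_oo], which completes [theta x (q ^+ 2)]. *)
Lemma cube_rows k :
  hsum (fun s => F (k, s)) (theta (z ^+ 2) (q ^+ 2) * qpoch_inf (- q) q * v k).
Proof.
rewrite -(theta_shift Kc k p1 p0 zz0) /F /v /theta /=.
have := x0 k; set x := z ^+ 2 * _ => xn0.
have hs := hsumZ (qpoch_inf x q) (lebesgue_sum Kc (q / x) q0 q1).
set c := jt (z ^+ 2) _ _ * _ * _.
have := hsumZ c hs; congr (hsum _ _).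
rewrite (qpoch_inf_even_odd Kc x q1) /c.
have -> : q / x * q = q ^+ 2 / x by rewrite expr2; ring.
by ring.
Qed.

(** At [x = C q^(2s)] reflection turns [(x; q)_oo (q / x; q)_s] into
    [(C q^s; q)_oo / jt (C q^s) q s]. The denominator cancels by [jt_merge_nat], and [inner_sum]
    remains. *)
Lemma cube_diagonals r : hsum (fun s : nat => F (r + s%:Z, s)) (h r).
Proof.
have := x0 r; pose C := z ^+ 2 * (q ^+ 2) ^ r; rewrite -/C => C0.
have hs := hsumZ (jt (z ^+ 2) (q ^+ 2) r * jt z q r ^+ 2)
   (inner_sum Kc C (b * q ^ (- r)) q1 q0).
rewrite -[- (b * q ^ (- r))]mulNr in hs.
apply: eq_hsum hs => s; rewrite /F /bterm /=.
have -> : z ^+ 2 * (q ^+ 2) ^ (r + s) = C * (q ^+ 2) ^+ s by rewrite expfzDr // mulrA.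
have -> : q ^ (- (r + s%:Z)) = q ^ (- r) * q ^ (- s%:Z) by rewrite opprD expfzDr.
rewrite [- b * (_ * _)]mulrA; set x := C * (q ^+ 2) ^+ s.
have xn0 : x != 0 by rewrite mulf_neq0 ?expf_neq0.
have -> : qpoch_inf x q * (jt (- q) q s * qfin (q / x) q s / qfin q q s) =
    jt (- q) q s / qfin q q s * (qpoch_inf x q * qfin (q / x) q s) by ring.
rewrite -(qpoch_inf_reflect Kc) // jt_neg_nat // jtD // jtD // -/C [(_ * jt _ q s) ^+ 2]exprMn.
have -> : x * q ^ (- s%:Z) = C * q ^+ s.
  by rewrite /x -exprnN -exprM mulnC exprM expr2; field; rewrite expf_neq0.
rewrite -[jt (C * q ^+ s) q s]jt_merge_nat jt_sqr_nat.
have -> : (z * q ^ r) ^+ 2 = C by rewrite /C exprMn [in RHS]expr2 expfzMl.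
have j1 := jt_neq0 s%:Z C0 p0; have j2 := jt_neq0 s%:Z (_ : - q != 0) q0.
have dn := qfin_self_neq0 s q1.
set J1 := jt C _ _ in j1 *; set J2 := jt (- q) _ _ in j2 *.
by field; rewrite j1 j2 ?oppr_eq0 //.
Qed.


Let Q : K := `|q|.
Let Y : K := `|z| ^+ 2.
(** Shaped for [asum_weight] with [kappa = Q^-1]; [|b| + 1] keeps its parameter [B] positive when
    [b = 0]. *)
Let W k : K := Q^-1 ^ k * jt (- Y) (Q ^+ 2) k * qpoch_inf (- ((`|b| + 1) * Q ^ (- k))) Q
   * qpoch_inf (- (Y * (Q ^+ 2) ^ k)) (Q ^+ 2).

(** With [X = Y Q^(2k)], one of the two factors [jt (- Y) (Q ^+ 2) k] pays for the theta function
    formed by [(- X Q; Q^2)_oo] and [(- Q / X; Q^2)_oo], at the cost of [Q^-1 ^ k]; the other one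
    stays in [W]. *)
Lemma cube_bound : exists2 c, 0 <= c & forall k s, `|F (k, s)| <= c * `|W k| * Q ^+ s.
Proof.
have [M M0 hM] := inv_qfin_bounded Kc q1.
have Q0 : 0 < Q by rewrite normr_gt0.
have QQ0 : 0 < Q ^+ 2 by rewrite exprn_gt0.
have QQ1 : Q ^+ 2 < 1 by rewrite /Q exprn_ilt1.
have Qn0 : Q != 0 by rewrite gt_eqF.
have QQn0 : Q ^+ 2 != 0 by rewrite gt_eqF.
have nQ1 : `|Q| < 1 by rewrite normr_id.
have nQQ1 : `|Q ^+ 2| < 1 by rewrite gtr0_norm.
have Y0 : 0 < Y by rewrite exprn_gt0 // normr_gt0.
have YQ0 : 0 < Y * Q by rewrite mulr_gt0.
have nY0 : - Y != 0 by rewrite oppr_eq0 gt_eqF.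
have nYQ0 : - (Y * Q) != 0 by rewrite oppr_eq0 gt_eqF.
have E0 (y T : K) : 0 <= y -> 0 < T -> T < 1 -> 0 <= qpoch_inf (- y) T.
  by move=> y0 T0 T1; rewrite qpoch_infN_ge0 ?(ltW T0).
have th0 : 0 <= theta (- (Y * Q)) (Q ^+ 2).
  rewrite /theta invrN mulrN; apply: mulr_ge0; apply: E0 => //; first exact: ltW.
  by rewrite divr_ge0 // ltW.
exists (M * theta (- (Y * Q)) (Q ^+ 2)); first exact: mulr_ge0 (ltW M0) th0.
move=> k s; have X0 : 0 < Y * (Q ^+ 2) ^ k by rewrite mulr_gt0 ?exprz_gt0.
have B0 : 0 <= `|b| * Q ^ (- k) by rewrite mulr_ge0 ?(ltW (exprz_gt0 _ Q0)).
have BB0 : 0 <= (`|b| + 1) * Q ^ (- k).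
  by rewrite mulr_ge0 ?addr_ge0 ?(ltW (exprz_gt0 _ Q0)).
have J0 := jtN_gt0 k Y0 QQ0.
have K0 : 0 < Q^-1 ^ k by rewrite exprz_gt0 // invr_gt0.
set X := Y * (Q ^+ 2) ^ k in X0.
have nx : `|z ^+ 2 * (q ^+ 2) ^ k| = X by rewrite normrM norm_exprz !normrX.
have EX0 := E0 _ _ (ltW X0) QQ0 QQ1; have EB0 := E0 _ _ BB0 Q0 q1.
rewrite /W -/X (ger0_norm (mulr_ge0 (mulr_ge0 (mulr_ge0 (ltW K0) (ltW J0)) EB0) EX0)).
rewrite /F /= /bterm.
set x := z ^+ 2 * _ in nx *.
have -> : jt (z ^+ 2) (q ^+ 2) k * jt z q k ^+ 2 * qpoch_inf (- b * q ^ (- k)) q *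
     (qpoch_inf x q * (jt (- q) q s * qfin (q / x) q s / qfin q q s)) =
   (jt (z ^+ 2) (q ^+ 2) k * jt z q k ^+ 2) * qpoch_inf (- b * q ^ (- k)) q
    * (qpoch_inf x q * (jt (- q) q s * qfin (q / x) q s)) * (qfin q q s)^-1 by ring.
have nJ : `|jt (z ^+ 2) (q ^+ 2) k * jt z q k ^+ 2| = jt (- Y) (Q ^+ 2) k * jt (- Y) (Q ^+ 2) k.
  rewrite normrM (jt_norm (z ^+ 2)) [`|_ ^+ 2| in X in X * _]normrX.
  by rewrite (jt_sqr k z0 q0) jt_norm normrN !normrX.
have nB : `|qpoch_inf (- b * q ^ (- k)) q| <= qpoch_inf (- ((`|b| + 1) * Q ^ (- k))) Q.
  apply: le_trans (norm_qpoch_inf_le Kc _ q1) _; rewrite normrM normrN norm_exprz.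
  apply: qpoch_infN_le => //; rewrite ler_wpM2r ?(ltW (exprz_gt0 _ Q0)) //.
  by rewrite lerDl.
have nE : `|qpoch_inf x q * (jt (- q) q s * qfin (q / x) q s)| <=
   qpoch_inf (- X) Q * (Q ^+ s * qpoch_inf (- (Q / X)) (Q ^+ 2)).
  rewrite normrM; apply: ler_pM => //.
    by apply: le_trans (norm_qpoch_inf_le Kc _ q1) _; rewrite nx.
  have := bterm_bound (- q) (q / x) s q1.
  by rewrite normrN [`|q / x|]normrM normfV nx.
have eth : qpoch_inf (- X) Q * (Q ^+ s * qpoch_inf (- (Q / X)) (Q ^+ 2)) =
  Q ^+ s * qpoch_inf (- X) (Q ^+ 2) *
  (theta (- (Y * Q)) (Q ^+ 2) / jt (- (Y * Q)) (Q ^+ 2) k).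
  rewrite -(theta_shift_div Kc k nQQ1 QQn0 nYQ0) (qpoch_inf_even_odd Kc (- X) nQ1) /theta.
  have -> : - (Y * Q) * (Q ^+ 2) ^ k = - X * Q by rewrite /X; ring.
  have -> : Q ^+ 2 / (- X * Q) = - (Q / X) by field; rewrite gt_eqF // Qn0.
  by ring.
have ejt : jt (- Y) (Q ^+ 2) k = Q^-1 ^ k * jt (- (Y * Q)) (Q ^+ 2) k.
  move: (k); apply: (@int_rec_eq _ (fun k => Y * (Q ^+ 2) ^ k)).
  - by move=> i; rewrite mulf_neq0 ?expfz_neq0 ?gt_eqF.
  - by rewrite !jt0 expr0z mulr1.
  - by move=> i; rewrite jtS // opprK.
  - by move=> i; rewrite jtS // opprK exprzS ?invr_eq0 //; field.
rewrite eth in nE.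
have J1 := jtN_gt0 k YQ0 QQ0.
have nJ' : `|jt (z ^+ 2) (q ^+ 2) k * jt z q k ^+ 2| <= jt (- Y) (Q ^+ 2) k * jt (- Y) (Q ^+ 2) k.
  by rewrite nJ.
apply: le_trans (norm_mul4_le nJ' nB nE (hM s)) _; rewrite {1}ejt le_eqVlt.
apply/orP; left; apply/eqP; set J := jt _ _ _ in J1 *.
by field; rewrite gt_eqF.
Qed.

Lemma cube_transformation :
  asum (fun k => theta (z ^+ 2) (q ^+ 2) * qpoch_inf (- q) q * v k) /\
  exists2 l, hsum (fun k => theta (z ^+ 2) (q ^+ 2) * qpoch_inf (- q) q * v k) l & hsum h l.
Proof.
have [c c0 hc] := cube_bound.
have Q0 : 0 < Q by rewrite normr_gt0.
apply: (@double_sum _ Kc F (fun k => c * W k) Q) => //.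
- apply: asumZ; apply: asum_weight => //; rewrite ?exprn_gt0 ?normr_gt0 //.
    by rewrite ltr_pwDr.
  by rewrite invf_gt1.
- exact: ltW.
- by move=> k s; rewrite [`|c * W k|]normrM (ger0_norm c0).
- exact: cube_rows.
- exact: cube_diagonals.
Qed.

End Expansion.

End CubeTransformation.

(** * The transformation behind the three quadratic series *)

Section QuadraticTransformation.
Context {K : numFieldType} (Kc : hcomplete K).
Implicit Types (x y q C : K) (k r : int) (s n : nat).

Lemma exprz_sqr q k : q ^ (2 * k) = (q ^+ 2) ^ k.
Proof. by rewrite -exprz_exp. Qed.

(** Counterpart of [jt_merge_nat]. The odd index comes from the theta shift by [2 k + 1] and leaves
    the extra factor [y], which turns [1 + y^-1] into [1 + y]. *)
Lemma jt_odd_merge_nat y q s :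
  jt (- y) q (2 * s%:Z + 1) * jt q (q ^+ 2) s%:Z
  = y * jt (y ^+ 2 * q ^+ 2 * (q ^+ 2) ^+ s) (q ^+ 2) s%:Z.
Proof.
have -> : 2 * s%:Z + 1 = (2 * s + 1)%N%:Z by rewrite PoszD PoszM.
rewrite !jt_natE opprK.
have -> : 'C(2 * s + 1, 2) = (s * (2 * s + 1))%N.
  by rewrite bin2 addn1 /= mulnC -mulnA mul2n doubleK.
set D := (q ^+ 2) ^+ 'C(s, 2).
have -> : y ^+ (2 * s + 1) = y * (y ^+ 2) ^+ s by rewrite addn1 exprS exprM.
have e : q ^+ (s * (2 * s + 1)) * q ^+ s = (q ^+ 2 * (q ^+ 2) ^+ s) ^+ s.
  by rewrite -exprD -exprS -!exprM; congr (_ ^+ _); lia.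
have -> : - (y ^+ 2 * q ^+ 2 * (q ^+ 2) ^+ s) = -1 * (y ^+ 2 * (q ^+ 2 * (q ^+ 2) ^+ s)) by ring.
rewrite [(-1 * _) ^+ s]exprMn [(y ^+ 2 * _) ^+ s]exprMn -e -[- q]mulN1r [(-1 * q) ^+ s]exprMn.
by ring.
Qed.

Section Expansion.
Variables (q t b : K).
Hypotheses (q0 : q != 0) (q1 : `|q| < 1) (t0 : t != 0).
Let p := q ^+ 2.

Let v k := jt (t * q) p k ^+ 2 * qpoch_inf (- b * p ^ (- k)) p
           * qpoch_inf (t * p ^ k * q) q.
Let h r := jt (t * q) p r ^+ 2 * jt (- t) q (2 * r) * (1 + t * p ^ r)
           * (qpoch_inf (- b * p ^ (- r)) p
              * qpoch_inf (- (b * p ^ (- r) * (t * q * p ^ r) ^+ 2 / p)) p).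
Let F (i : int * nat) := jt (t * q) p i.1 ^+ 2 * qpoch_inf (- b * p ^ (- i.1)) p
   * jt (- t) q (2 * i.1 + 1) * (qpoch_inf ((t * p ^ i.1 * q) ^+ 2) p
   * ((1 + q / (t * p ^ i.1 * q) * p ^+ i.2)
      * bterm p q ((q / (t * p ^ i.1 * q)) ^+ 2) i.2)).

Let p1 : `|p| < 1. Proof. exact: norm_expS_lt1. Qed.
Let p0 : p != 0. Proof. by rewrite expf_neq0. Qed.
Let x0 k : t * p ^ k * q != 0. Proof. by rewrite !mulf_neq0 ?expfz_neq0. Qed.

(** With [x = t q^(2k+1)], split [(x^2; q^2)_oo = (x; q)_oo (- x; q)_oo]; [prod_quad_sum] at
    [u = q / x] supplies [(- q / x; q)_oo], which completes [theta (- x) q]. *)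
Lemma quadratic_rows k :
  hsum (fun s => F (k, s)) (qpoch_inf q p * theta (- t) q * v k).
Proof.
have nt0 : - t != 0 by rewrite oppr_eq0.
rewrite -(theta_shift Kc (2 * k + 1) q1 q0 nt0) /F /v /theta /=.
have -> : - t * q ^ (2 * k + 1) = - (t * p ^ k * q) by rewrite exprzS // exprz_sqr -/p; ring.
have := x0 k; set x := t * _ * q => xn0.
have hs := hsumZ (qpoch_inf (x ^+ 2) p) (prod_quad_sum Kc (q / x) q0 q1).
set c := jt (t * q) _ _ ^+ 2 * _ * _.
have := hsumZ c hs; congr (hsum _ _).
rewrite (qpoch_inf_sqr Kc x q1) /c invrN mulrN -/p.
by ring.
Qed.

Lemma quadratic_diagonals r : hsum (fun s : nat => F (r + s%:Z, s)) (h r).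
Proof.
pose C := (t * q * p ^ r) ^+ 2.
have C0 : C != 0 by rewrite /C expf_neq0 // !mulf_neq0 ?expfz_neq0.
have tq0 : t * q != 0 by rewrite mulf_neq0.
have nt0 : - t != 0 by rewrite oppr_eq0.
have y0 : t * p ^ r != 0 by rewrite mulf_neq0 ?expfz_neq0.
have hs := hsumZ (jt (t * q) p r ^+ 2 * jt (- t) q (2 * r) * (1 + t * p ^ r))
   (inner_sum Kc C (b * p ^ (- r)) p1 p0).
rewrite -[- (b * p ^ (- r))]mulNr in hs.
apply: eq_hsum hs => s; rewrite /F /bterm /=.
have -> : p ^ (- (r + s%:Z)) = p ^ (- r) * p ^ (- s%:Z) by rewrite opprD expfzDr.
rewrite [- b * (_ * _)]mulrA.
have -> : t * p ^ (r + s) * q = t * p ^ r * p ^+ s * q by rewrite expfzDr // mulrA.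
set y := t * p ^ r in y0 *; have ps0 : p ^+ s != 0 by rewrite expf_neq0.
have ex : (y * p ^+ s * q) ^+ 2 = C * (p ^+ 2) ^+ s.
  by rewrite /C /y -exprM mulnC exprM; ring.
have -> : (q / (y * p ^+ s * q)) ^+ 2 = p / (C * (p ^+ 2) ^+ s).
  by rewrite -ex expr_div_n.
(* On a diagonal the linear factor no longer depends on [s] and leaves the inner sum. *)
have -> : q / (y * p ^+ s * q) * p ^+ s = y^-1 by field; rewrite q0 y0 ps0.
rewrite ex; set x := C * (p ^+ 2) ^+ s.
have xn0 : x != 0 by rewrite (mulf_neq0 C0) // !expf_neq0.
have -> : qpoch_inf x p * ((1 + y^-1) * (jt q p s * qfin (p / x) p s / qfin p p s)) =
    (1 + y^-1) * jt q p s / qfin p p s * (qpoch_inf x p * qfin (p / x) p s) by ring.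
rewrite -(qpoch_inf_reflect Kc) // jt_neg_nat //.
have -> : x * p ^ (- s%:Z) = C * p ^+ s.
  by rewrite /x -exprnN -exprM mulnC exprM expr2; field; rewrite expf_neq0.
have -> : 2 * (r + s%:Z) + 1 = 2 * r + (2 * s%:Z + 1) by ring.
rewrite [jt (t * q) p (r + s)]jtD // [jt (- t) q (_ + _)]jtD // exprz_sqr -/p.
rewrite [(_ * jt _ p s) ^+ 2]exprMn jt_sqr_nat -/C [- t * p ^ r]mulNr -/y.
have e3 := jt_odd_merge_nat y q s.
have eC : y ^+ 2 * q ^+ 2 = C by rewrite /C /y; ring.
rewrite eC -/p in e3.
have Cs0 : C * p ^+ s != 0 by rewrite mulf_neq0.
have j1 := jt_neq0 s%:Z Cs0 p0; have dn := qfin_self_neq0 s p1.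
set J1 := jt (C * p ^+ s) _ _ in j1 e3 *.
set J2 := jt (- y) q _ in e3 *; set J3 := jt q p s in e3 *.
set A := jt (t * q) p r; set B := jt (- t) q _; set Pb := qpoch_inf (- b * _ * _) p.
set Pc := qpoch_inf (C * _) p; set G := \prod_(j < s) _.
have -> : A ^+ 2 * G * Pb * (B * J2) * ((1 + y^-1) * J3 / qfin p p s * (Pc * J1^-1))
  = A ^+ 2 * G * Pb * B * ((1 + y^-1) / qfin p p s * (Pc * J1^-1)) * (J2 * J3) by ring.
by rewrite e3; field; rewrite y0 j1 dn.
Qed.

Let Q : K := `|q|.
Let T : K := `|p|.
Let Y : K := `|t| ^+ 2 * T.
Let G (kappa : K) k : K := kappa ^ k * jt (- Y) (T ^+ 2) k
   * qpoch_inf (- ((`|b| + 1) * T ^ (- k))) T * qpoch_inf (- (Y * (T ^+ 2) ^ k)) (T ^+ 2).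
(** The linear factor is at most [1 + 1 / (|t| T^k)], whence a second weight whose [kappa] carries
    an additional [T^-1]. *)
Let W k : K := G Q^-1 k + `|t|^-1 * G (Q * T)^-1 k.

Lemma quadratic_bound : exists2 c, 0 <= c & forall k s, `|F (k, s)| <= c * `|W k| * Q ^+ s.
Proof.
have [M M0 hM] := inv_qfin_bounded Kc p1.
have Q0 : 0 < Q by rewrite normr_gt0.
have TQ : T = Q ^+ 2 by rewrite /T /p normrX.
have T0 : 0 < T by rewrite normr_gt0.
have Qn0 : Q != 0 by rewrite gt_eqF.
have Tn0 : T != 0 by rewrite gt_eqF.
have TT0 : 0 < T ^+ 2 by rewrite exprn_gt0.
have TT1 : T ^+ 2 < 1 by rewrite /T exprn_ilt1.
have TTn0 : T ^+ 2 != 0 by rewrite gt_eqF.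
have nT1 : `|T| < 1 by rewrite normr_id.
have nTT1 : `|T ^+ 2| < 1 by rewrite gtr0_norm.
have nt0 : 0 < `|t| by rewrite normr_gt0.
have tn0 : `|t| != 0 by rewrite gt_eqF.
have Y0 : 0 < Y by rewrite mulr_gt0 // exprn_gt0.
have YT0 : 0 < Y * T by rewrite mulr_gt0.
have nYT0 : - (Y * T) != 0 by rewrite oppr_eq0 gt_eqF.
have E0 (y V : K) : 0 <= y -> 0 < V -> V < 1 -> 0 <= qpoch_inf (- y) V.
  by move=> y0 V0 V1; rewrite qpoch_infN_ge0 ?(ltW V0).
have th0 : 0 <= theta (- (Y * T)) (T ^+ 2).
  rewrite /theta invrN mulrN; apply: mulr_ge0; apply: E0 => //; first exact: ltW.
  by rewrite divr_ge0 // ltW.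
exists (`|t| * M * theta (- (Y * T)) (T ^+ 2)).
  exact: mulr_ge0 (mulr_ge0 (normr_ge0 t) (ltW M0)) th0.
move=> k s; have X0 : 0 < Y * (T ^+ 2) ^ k by rewrite mulr_gt0 ?exprz_gt0.
have BB0 : 0 <= (`|b| + 1) * T ^ (- k).
  by rewrite mulr_ge0 ?addr_ge0 ?(ltW (exprz_gt0 _ T0)).
have J0 := jtN_gt0 k Y0 TT0.
set X := Y * (T ^+ 2) ^ k in X0.
have EX0 := E0 _ _ (ltW X0) TT0 TT1; have EB0 := E0 _ _ BB0 T0 p1.
have G0 kap : 0 < kap -> 0 <= G kap k.
  move=> kap0; have K0 : 0 < kap ^ k by rewrite exprz_gt0.
  exact: mulr_ge0 (mulr_ge0 (mulr_ge0 (ltW K0) (ltW J0)) EB0) EX0.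
have W0 : 0 <= W k.
  rewrite addr_ge0 ?G0 ?invr_gt0 //; apply: mulr_ge0; first by rewrite invr_ge0.
  by rewrite G0 // invr_gt0 mulr_gt0.
rewrite (ger0_norm W0) /F /= /bterm.
have := x0 k; set x := t * _ * q => xn0.
have nx : `|x ^+ 2| = X.
  rewrite normrX /x !normrM norm_exprz -/T -/Q /X /Y [(T ^+ 2) ^ k]expfzMl TQ; ring.
have nu : `|q / x| = (`|t| * T ^ k)^-1.
  by rewrite /x !(normrM, normfV) norm_exprz -/T -/Q; field; rewrite Qn0 tn0 expfz_neq0.
have -> : jt (t * q) p k ^+ 2 * qpoch_inf (- b * p ^ (- k)) p * jt (- t) q (2 * k + 1) *
  (qpoch_inf (x ^+ 2) p * ((1 + q / x * p ^+ s) *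
     (jt q p s * qfin ((q / x) ^+ 2) p s / qfin p p s))) =
  jt (t * q) p k ^+ 2 * qpoch_inf (- b * p ^ (- k)) p
  * (jt (- t) q (2 * k + 1) * (1 + q / x * p ^+ s)
  * (qpoch_inf (x ^+ 2) p * (jt q p s * qfin ((q / x) ^+ 2) p s))) * (qfin p p s)^-1 by ring.
have tq0 : t * q != 0 by rewrite mulf_neq0.
have nJ : `|jt (t * q) p k ^+ 2| <= jt (- Y) (T ^+ 2) k.
  rewrite (jt_sqr k tq0 p0) jt_norm normrN !normrX -/T normrM exprMn /Y TQ.
  exact: lexx.
have nB : `|qpoch_inf (- b * p ^ (- k)) p| <= qpoch_inf (- ((`|b| + 1) * T ^ (- k))) T.
  apply: le_trans (norm_qpoch_inf_le Kc _ p1) _; rewrite normrM normrN norm_exprz.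
  apply: qpoch_infN_le => //; rewrite ?mulr_ge0 ?(ltW (exprz_gt0 _ T0)) //.
  by rewrite ler_wpM2r ?(ltW (exprz_gt0 _ T0)) // lerDl.
have nE : `|qpoch_inf (x ^+ 2) p * (jt q p s * qfin ((q / x) ^+ 2) p s)| <=
   qpoch_inf (- X) T * (Q ^+ s * qpoch_inf (- (T / X)) (T ^+ 2)).
  rewrite normrM; apply: ler_pM => //.
    by apply: le_trans (norm_qpoch_inf_le Kc _ p1) _; rewrite nx.
  have := bterm_bound Kc q ((q / x) ^+ 2) s p1.
  by rewrite expr_div_n [`|q ^+ 2 / _|]normrM normfV nx.
have nU : `|1 + q / x * p ^+ s| <= 1 + (`|t| * T ^ k)^-1.
  by rewrite (le_trans (ler_normD _ _)) // normr1 lerD2l -nu norm_shift_le.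
have eth : qpoch_inf (- X) T * (Q ^+ s * qpoch_inf (- (T / X)) (T ^+ 2)) =
  Q ^+ s * qpoch_inf (- X) (T ^+ 2) *
  (theta (- (Y * T)) (T ^+ 2) / jt (- (Y * T)) (T ^+ 2) k).
  rewrite -(theta_shift_div Kc k nTT1 TTn0 nYT0) (qpoch_inf_even_odd Kc (- X) nT1) /theta.
  have -> : - (Y * T) * (T ^+ 2) ^ k = - X * T by rewrite /X; ring.
  have -> : T ^+ 2 / (- X * T) = - (T / X) by field; rewrite gt_eqF // Tn0.
  by ring.
have ejt : `|jt (- t) q (2 * k + 1)| = `|t| * Q^-1 ^ k * jt (- (Y * T)) (T ^+ 2) k.
  rewrite jt_norm normrN -/Q; move: (k).
  have mt0 : - `|t| != 0 by rewrite oppr_eq0.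
  apply: (@int_rec_eq _ (fun k => Q^-1 * (Y * T * (T ^+ 2) ^ k))).
  - by move=> i; rewrite mulf_neq0 ?invr_eq0 ?mulf_neq0 ?expfz_neq0 ?gt_eqF.
  - by rewrite mulr0 jtS // !jt0 !expr0z; ring.
  - move=> i; rewrite (_ : 2 * (i + 1) + 1 = 2 * i + 1 + 1 + 1); last by ring.
    rewrite !jtS // !exprzS // exprz_sqr -TQ [in RHS]expr2 expfzMl /Y.
    by rewrite TQ; field.
  - by move=> i; rewrite jtS // opprK exprzS ?invr_eq0 //; ring.
have J1 := jtN_gt0 k YT0 TT0; have K0 : 0 < Q^-1 ^ k by rewrite exprz_gt0 ?invr_gt0.
rewrite eth in nE.
have nM : `|jt (- t) q (2 * k + 1) * (1 + q / x * p ^+ s)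
    * (qpoch_inf (x ^+ 2) p * (jt q p s * qfin ((q / x) ^+ 2) p s))| <=
    `|t| * Q^-1 ^ k * jt (- (Y * T)) (T ^+ 2) k * (1 + (`|t| * T ^ k)^-1)
    * (Q ^+ s * qpoch_inf (- X) (T ^+ 2) *
       (theta (- (Y * T)) (T ^+ 2) / jt (- (Y * T)) (T ^+ 2) k)).
  rewrite normrM [X in X * _ <= _]normrM ejt; apply: ler_pM => //.
    apply: mulr_ge0 => //; apply: mulr_ge0 (ltW J1); exact: mulr_ge0 (normr_ge0 t) (ltW K0).
  rewrite ler_wpM2l //; apply: mulr_ge0 (ltW J1); exact: mulr_ge0 (normr_ge0 t) (ltW K0).
apply: le_trans (norm_mul4_le nJ nB nM (hM s)) _; rewrite le_eqVlt.
apply/orP; left; apply/eqP; rewrite /W /G -/X [(Q * T)^-1]invfM [(Q^-1 * _) ^ k]expfzMl.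
have -> : T^-1 ^ k = (T ^ k)^-1 by rewrite exprz_inv invr_expz.
set J := jt (- (Y * T)) _ _ in J1 *.
by field; rewrite tn0 expfz_neq0 ?gt_eqF.
Qed.

Lemma quadratic_transformation :
  asum (fun k => qpoch_inf q p * theta (- t) q * v k) /\
  exists2 l, hsum (fun k => qpoch_inf q p * theta (- t) q * v k) l & hsum h l.
Proof.
have [c c0 hc] := quadratic_bound.
have Q0 : 0 < Q by rewrite normr_gt0.
have T0 : 0 < T by rewrite normr_gt0.
have G1 kap : 1 < kap -> asum (G kap).
  move=> k1; apply: asum_weight => //; last by rewrite ltr_pwDr.
  by rewrite mulr_gt0 // exprn_gt0 // normr_gt0.
apply: (@double_sum _ Kc F (fun k => c * W k) Q) => //.
- apply: asumZ; apply: asumD; last apply: asumZ; apply: G1; rewrite invf_gt1 ?mulr_gt0 //.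
  by rewrite mulr_ilt1 // ltW.
- exact: ltW.
- by move=> k s; rewrite [`|c * W k|]normrM (ger0_norm c0).
- exact: quadratic_rows.
- exact: quadratic_diagonals.
Qed.

End Expansion.

End QuadraticTransformation.
(** * The four bilateral sums *)

Section BilateralSums.
Context {K : numFieldType} (Kc : hcomplete K).
Implicit Types (a q z : K) (k r : int) (n : nat).

(** Each coefficient is required to be nonzero only on the half-line where it is divided by. On the
    other one it may vanish: numerators such as [1 + z q^k] for [k >= 0], denominator factors for
    [k < 0]. *)
Lemma two_sided_rec (al be u v : int -> K) :
  (forall n, al n%:Z != 0) -> (forall n, be (Negz n) != 0) -> u 0 = v 0 ->
  (forall k, al k * u (k + 1) = be k * u k) -> (forall k, al k * v (k + 1) = be k * v k) ->
  u =1 v.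
Proof.
move=> al0 be0 uv0 hu hv.
have pos n : u n%:Z = v n%:Z.
  elim: n => // n IH; apply: (mulfI (al0 n)).
  by have := hu n; have := hv n; rewrite -PoszD addn1 => -> ->; rewrite IH.
case=> // n; elim: n => [|n IH].
  apply: (mulfI (be0 0%N)); rewrite -hu -hv.
  by rewrite (_ : Negz 0 + 1 = 0%:Z) // pos.
apply: (mulfI (be0 n.+1)); rewrite -hu -hv.
by rewrite (_ : Negz n.+1 + 1 = Negz n) ?IH //; lia.
Qed.

Lemma qpochS a q k : q != 0 -> (k < 0 -> 1 - a * q ^ k != 0) ->
  qpoch a q (k + 1) = qpoch a q k * (1 - a * q ^ k).
Proof.
move=> q0; case: k => n h; first by rewrite -PoszD addn1 /= big_ord_recr.
have d0 : 1 - a * q ^- n.+1 != 0 by rewrite exprnN -NegzE h.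
have eN : qpoch a q (Negz n) * (1 - a * q ^ Negz n) = \prod_(j < n) (1 - a * q ^- j.+1)^-1.
  by rewrite /= big_ord_recr /= NegzE -exprnN divfK.
rewrite eN; case: n {h d0 eN} => [|n]; first by rewrite big_ord0 /= big_ord0.
by rewrite (_ : Negz n.+1 + 1 = Negz n) //; lia.
Qed.

(** For [k < 0] the reciprocal is a polynomial, thanks to [0^-1 = 0], and the recurrence survives
    vanishing factors; hence the condition for [k >= 0] alone, opposite to [qpochS]. *)
Lemma qpoch_invS a q k : q != 0 -> (0 <= k -> 1 - a * q ^ k != 0) ->
  (1 - a * q ^ k) * (qpoch a q (k + 1))^-1 = (qpoch a q k)^-1.
Proof.
move=> q0; case: k => n h.
  rewrite -PoszD addn1 /= big_ord_recr /= invfM mulrC divfK //.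
  exact: h.
have eN : (qpoch a q (Negz n))^-1 =
    (1 - a * q ^ Negz n) * \prod_(j < n) (1 - a * q ^- j.+1).
  rewrite /= -prodfV big_ord_recr /= invrK mulrC NegzE -exprnN; congr (_ * _).
  by apply: eq_bigr => j _; rewrite invrK.
rewrite eN; congr (_ * _); case: n {h eN} => [|n].
  by rewrite big_ord0 /= big_ord0 invr1.
rewrite (_ : Negz n.+1 + 1 = Negz n); last by lia.
by rewrite /= -prodfV; apply: eq_bigr => j _; rewrite invrK.
Qed.

Lemma exprz_oppS q k : q != 0 -> q ^ (- (k + 1)) * q = q ^ (- k).
Proof. by move=> q0; rewrite -exprzS //; congr (_ ^ _); ring. Qed.

Lemma qpoch0 a q : qpoch a q 0 = 1. Proof. by rewrite /= big_ord0. Qed.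

Lemma hsum_divr {I : eqType} (f : I -> K) c l : c != 0 ->
  hsum (fun i => c * f i) l -> hsum f (l / c).
Proof.
move=> c0 /(hsumZ c^-1); rewrite mulrC; apply: eq_hsum => i.
by rewrite mulrA mulVf // mul1r.
Qed.

Lemma asum_divr {I : eqType} (f : I -> K) c : c != 0 -> asum (fun i => c * f i) -> asum f.
Proof.
move=> c0 /(asumZ c^-1); apply: asum_le => i.
by rewrite mulrA mulVf // mul1r.
Qed.

Lemma theta_neg x q : theta (- x) q = qpoch_inf (- x) q * qpoch_inf (- (q / x)) q.
Proof. by rewrite /theta invrN mulrN. Qed.

(** With [b = q / z] the two products on the diagonal form [theta (- z q^r) q]. Its quasi-period
    factor absorbs [jt (- z) q r] and leaves [jt (z ^+ 3) (q ^+ 3) r]. *)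
Lemma bisum_cubic q z : q != 0 -> `|q| < 1 -> z != 0 ->
  (forall j : nat, 1 + z * q ^- j.+1 != 0) ->
  qpoch_inf (z ^+ 2) q * qpoch_inf (q ^+ 2 / z ^+ 2) (q ^+ 2) != 0 ->
  is_bisum
    (fun k : int => qpoch (- z) q k / qpoch (z ^+ 2 * q) (q ^+ 2) k * q ^ binz2 k * z ^ k)
    (qpoch_inf (- z) q * qpoch_inf q (q ^+ 2)
       / (qpoch_inf (z ^+ 2) q * qpoch_inf (q ^+ 2 / z ^+ 2) (q ^+ 2))
     * qpochs_inf [:: q ^+ 3; z ^+ 3; z ^- 3 * q ^+ 3] (q ^+ 3)).
Proof.
move=> q0 q1 z0 hz; rewrite (qpoch_inf_even_odd Kc (z ^+ 2) q1) -expr_div_n.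
rewrite (qpoch_inf_sqr Kc (q / z) q1).
rewrite !mulf_eq0 !negb_or -!andbA => /and4P[A0 B0 C0 D0].
have p0 : q ^+ 2 != 0 by rewrite expf_neq0.
have p1 : `|q ^+ 2| < 1 by exact: norm_expS_lt1.
have zz0 : z ^+ 2 != 0 by rewrite expf_neq0.
have nz0 : - z != 0 by rewrite oppr_eq0.
have PQ := qpoch_inf_neg_mul Kc q1 q0.
have PN0 : qpoch_inf (- q) q != 0.
  by apply: contra_eq_neq PQ => ->; rewrite mul0r eq_sym oner_eq0.
have [aV [l hv hl]] := cube_transformation Kc (q / z) q0 q1 z0.
have th0 : theta (z ^+ 2) (q ^+ 2) * qpoch_inf (- q) q != 0.
  by rewrite /theta -expr_div_n (qpoch_inf_sqr Kc (q / z) q1) !mulf_neq0.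
have el : l = theta (- z) q * (qpoch_inf (q ^+ 3) (q ^+ 3) * theta (z ^+ 3) (q ^+ 3)).
  apply: (hsum_unique hl).
  have q31 : `|q ^+ 3| < 1 by exact: norm_expS_lt1.
  have q30 : q ^+ 3 != 0 by rewrite expf_neq0.
  have z30 : z ^+ 3 != 0 by rewrite expf_neq0.
  apply: eq_hsum (hsumZ _ (jacobi_triple_product Kc q31 q30 z30)) => r.
  rewrite -(theta_shift Kc r q1 q0 nz0) mulNr theta_neg.
  have qr0 : q ^ r != 0 by rewrite expfz_neq0.
  have -> : q / z * q ^ (- r) * (z ^+ 2 * (q ^+ 2) ^ r) / q = z * q ^ r.
    by rewrite [in (q ^+ 2) ^ r]expr2 expfzMl -invr_expz; field; rewrite q0 z0 qr0.
  have -> : - (q / z) * q ^ (- r) = - (q / (z * q ^ r)).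
    by rewrite -invr_expz; field; rewrite z0 qr0.
  suff -> : jt (z ^+ 2) (q ^+ 2) r * jt z q r ^+ 2 = jt (- z) q r * jt (z ^+ 3) (q ^+ 3) r by ring.
  move: (r); apply: (@int_rec_eq _ (fun r => - z ^+ 4 * (q ^ r) ^+ 4)).
  - by move=> i; rewrite mulf_neq0 ?oppr_eq0 ?expf_neq0 ?expfz_neq0.
  - by rewrite !jt0 expr1n mulr1.
  - by move=> i; rewrite !jtS // [in (q ^+ 2) ^ i]expr2 expfzMl; ring.
  - move=> i; rewrite !jtS // [in (q ^+ 3) ^ i](_ : q ^+ 3 = q * q * q) ?expfzMl; ring.
(* The value of the transformed term at [k = 0], so that both sides of [eu] start at [1]. *)
pose d := qpoch_inf (z ^+ 2 * q) (q ^+ 2) * qpoch_inf (- (q / z)) q.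
have d0 : d != 0 by rewrite mulf_neq0.
have hu := hsumZ d^-1 (hsum_divr th0 hv).
have au := asumZ d^-1 (asum_divr th0 aV).
set u := fun k => _; set L := (X in is_bisum _ X).
have eu : (fun k => d^-1 * (jt z q k ^+ 2 * qpoch_inf (z ^+ 2 * (q ^+ 2) ^ k * q) (q ^+ 2)
           * qpoch_inf (- (q / z) * q ^ (- k)) q)) =1 u.
  apply: (@two_sided_rec (fun k => 1 - z ^+ 2 * q * (q ^+ 2) ^ k)
    (fun k => (1 - - z * q ^ k) * (z * q ^ k))).
  - by move=> n; apply: qpoch_inf_factor_neq0.
  - by move=> n; rewrite mulNr opprK !mulf_neq0 ?expfz_neq0 // NegzE -exprnN.
  - rewrite jt0 oppr0 !expr0z !mulr1 expr1n mul1r mulVf // /u !qpoch0.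
    by rewrite /binz2 mul0r div0z !expr0z !mulr1 divr1.
  - move=> k; have qk0 : q ^ k != 0 by rewrite expfz_neq0.
    rewrite jtS // (qpoch_infS Kc (z ^+ 2 * (q ^+ 2) ^ k * q) p1).
    rewrite (qpoch_infS Kc (- (q / z) * q ^ (- (k + 1))) q1).
    have -> : - (q / z) * q ^ (- (k + 1)) * q = - (q / z) * q ^ (- k).
      by rewrite -mulrA exprz_oppS.
    have -> : z ^+ 2 * (q ^+ 2) ^ (k + 1) * q = z ^+ 2 * (q ^+ 2) ^ k * q * q ^+ 2.
      by rewrite exprzS //; ring.
    have -> : q ^ (- (k + 1)) = (q ^ k * q)^-1 by rewrite -invr_expz exprzS.
    set J := jt _ _ _; set P1 := qpoch_inf _ _; set P2 := qpoch_inf _ _.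
    by field; rewrite d0 q0 z0 qk0.
  - move=> k; rewrite /u binz2S expfzDr // exprzS // qpochS //; last first.
      by case: k => // n _; rewrite mulNr opprK NegzE -exprnN.
    rewrite -(@qpoch_invS (z ^+ 2 * q) (q ^+ 2) k) //; last first.
      by case: k => // n _; apply: qpoch_inf_factor_neq0.
    by ring.
suff eL : L = d^-1 * (l / (theta (z ^+ 2) (q ^+ 2) * qpoch_inf (- q) q)).
  rewrite eL; apply: (hsum_is_bisum Kc); last exact: eq_hsum eu hu.
  by apply: asum_le au => k; rewrite -eu.
rewrite /L el /qpochs_inf !big_cons big_nil mulr1 theta_neg /theta.
rewrite [z ^- 3 * q ^+ 3]mulrC -[q ^+ 2 / z ^+ 2]expr_div_n (qpoch_inf_sqr Kc (q / z) q1) /d.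
have -> : qpoch_inf q (q ^+ 2) = (qpoch_inf (- q) q)^-1.
  by rewrite -[RHS]mulr1 -PQ mulKf.
by field; rewrite A0 B0 C0 D0 PN0.
Qed.

End BilateralSums.

(** * The series with products in base [q^8] *)

Section QuadraticSums.
Context {K : numFieldType} (Kc : hcomplete K).
Implicit Types (a q z t : K) (k r : int) (n : nat).

(** The Gaussian part of a diagonal sum: the square and the doubled index each contribute a base
    [q^4]. *)
Lemma jt_quartic q t r : q != 0 -> t != 0 ->
  jt (t * q) (q ^+ 2) r ^+ 2 * jt (- t) q (2 * r) = jt (- (t ^+ 4 * q ^+ 3)) (q ^+ 8) r.
Proof.
move=> q0 t0; have p0 : q ^+ 2 != 0 by rewrite expf_neq0.
have q80 : q ^+ 8 != 0 by rewrite expf_neq0.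
have tq0 : t * q != 0 by rewrite mulf_neq0.
have nt0 : - t != 0 by rewrite oppr_eq0.
have n0 : - (t ^+ 4 * q ^+ 3) != 0 by rewrite oppr_eq0 mulf_neq0 ?expf_neq0.
have e8 i : (q ^+ 8) ^ i = ((q ^+ 2) ^ i) ^+ 4.
  by rewrite (_ : q ^+ 8 = q ^+ 2 * q ^+ 2 * q ^+ 2 * q ^+ 2) ?expfzMl; ring.
move: r; apply: (@int_rec_eq _ (fun r => t ^+ 4 * q ^+ 3 * ((q ^+ 2) ^ r) ^+ 4)).
- by move=> i; rewrite !mulf_neq0 ?expf_neq0 ?expfz_neq0.
- by rewrite !jt0 expr1n mulr1.
- move=> i; rewrite (_ : 2 * (i + 1) = 2 * i + 1 + 1); last by ring.
  by rewrite !jtS // exprzS // exprz_sqr; ring.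
- by move=> i; rewrite jtS // e8 opprK.
Qed.

Lemma jt_scale x q c r : x != 0 -> q != 0 -> c != 0 -> jt (x * c) q r = jt x q r * c ^ r.
Proof. by move=> x0 q0 c0; rewrite /jt -mulNr expfzMl; ring. Qed.

Lemma qpoch_evenS a q k : q != 0 ->
  (0 <= k -> 1 - a * (q ^+ 2) ^ k != 0 /\ 1 - a * q * (q ^+ 2) ^ k != 0) ->
  (1 - a * (q ^+ 2) ^ k) * (1 - a * q * (q ^+ 2) ^ k) * (qpoch a q (2 * (k + 1)))^-1
  = (qpoch a q (2 * k))^-1.
Proof.
move=> q0 h; rewrite (_ : 2 * (k + 1) = 2 * k + 1 + 1); last by ring.
have e1 : a * q ^ (2 * k) = a * (q ^+ 2) ^ k by rewrite exprz_sqr.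
have e2 : a * q ^ (2 * k + 1) = a * q * (q ^+ 2) ^ k by rewrite exprzS // exprz_sqr; ring.
rewrite -(@qpoch_invS _ a q (2 * k)) // ?e1; last by move=> k0; apply: (h _).1; lia.
rewrite -(@qpoch_invS _ a q (2 * k + 1)) // ?e2; last by move=> k0; apply: (h _).2; lia.
by rewrite mulrA.
Qed.

Lemma qpoch_inf_step2 a q : `|q| < 1 ->
  qpoch_inf a q = (1 - a) * (1 - a * q) * qpoch_inf (a * q ^+ 2) q.
Proof.
by move=> q1; rewrite (qpoch_infS Kc a q1) (qpoch_infS Kc (a * q) q1) mulrA -[a * q * q]mulrA.
Qed.

Lemma factor2_neq0 a q n : `|q| < 1 -> qpoch_inf a q != 0 ->
  1 - a * (q ^+ 2) ^ n%:Z != 0 /\ 1 - a * q * (q ^+ 2) ^ n%:Z != 0.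
Proof.
move=> q1 h; rewrite -exprnP -exprM -mulrA -exprS.
by split; apply: (qpoch_inf_factor_neq0 Kc).
Qed.

Lemma double_succ_ge0 k : 0 <= 2 * k + 1 -> 0 <= k.
Proof. by lia. Qed.

Lemma double_succ2_ge0 k : 0 <= 2 * k + 1 + 1 -> 0 <= k \/ k = -1.
Proof. by lia. Qed.

(** With [b = 0] the products on a diagonal are [1], and the linear factor [1 + z q^(2r)] splits the
    sum into two triple products whose arguments differ by [q^2]. *)
Lemma bisum_octic_pair q z : q != 0 -> `|q| < 1 -> z != 0 ->
  qpochs_inf [:: z ^+ 2; q ^+ 2 / z ^+ 2; q] (q ^+ 2) != 0 ->
  is_bisum
    (fun k : int => q ^ (2 * k ^+ 2) / qpoch z q (2 * k + 1) * z ^ (2 * k))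
    (qpoch_inf (q / z) q / qpochs_inf [:: z ^+ 2; q ^+ 2 / z ^+ 2; q] (q ^+ 2)
     * qpoch_inf (q ^+ 8) (q ^+ 8)
     * (qpochs_inf [:: - z ^+ 4 * q ^+ 3; - z ^- 4 * q ^+ 5] (q ^+ 8)
        + z * qpochs_inf [:: - z ^+ 4 * q ^+ 5; - z ^- 4 * q ^+ 3] (q ^+ 8))).
Proof.
move=> q0 q1 z0; rewrite /qpochs_inf !big_cons !big_nil !mulr1 -expr_div_n.
rewrite !(qpoch_inf_sqr Kc _ q1) !mulf_eq0 !negb_or => /andP[] /andP[A0 B0] /andP[].
move=> /andP[C0 D0] E0.
have p0 : q ^+ 2 != 0 by rewrite expf_neq0.
have p1 : `|q ^+ 2| < 1 by exact: norm_expS_lt1.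
have zq0 : z * q != 0 by rewrite mulf_neq0.
have [aV [l hv hl]] := quadratic_transformation Kc 0 q0 q1 z0.
have th0 : qpoch_inf q (q ^+ 2) * theta (- z) q != 0.
  by rewrite theta_neg !mulf_neq0.
have el : l = qpoch_inf (q ^+ 8) (q ^+ 8) *
    (theta (- (z ^+ 4 * q ^+ 3)) (q ^+ 8) + z * theta (- (z ^+ 4 * q ^+ 5)) (q ^+ 8)).
  apply: (hsum_unique hl).
  have q81 : `|q ^+ 8| < 1 by exact: norm_expS_lt1.
  have q80 : q ^+ 8 != 0 by rewrite expf_neq0.
  have n3 : - (z ^+ 4 * q ^+ 3) != 0 by rewrite oppr_eq0 mulf_neq0 ?expf_neq0.
  have n5 : - (z ^+ 4 * q ^+ 5) != 0 by rewrite oppr_eq0 mulf_neq0 ?expf_neq0.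
  rewrite mulrDr [_ * (z * _)]mulrCA.
  have hs := hsumD (jacobi_triple_product Kc q81 q80 n3)
     (hsumZ z (jacobi_triple_product Kc q81 q80 n5)).
  apply: eq_hsum hs => r; rewrite jt_quartic //.
  have -> : - (z ^+ 4 * q ^+ 5) = - (z ^+ 4 * q ^+ 3) * q ^+ 2 by ring.
  by rewrite jt_scale // !(oppr0, mul0r) !qpoch_inf0 //; ring.
(* The series has the term [1 / (1 - z)] at [k = 0], so the normalization is [(z; q)_oo] although
   the transformed term there is [(z q; q)_oo]. *)
pose d := qpoch_inf z q.
have hu := hsumZ d^-1 (hsum_divr th0 hv).
have au := asumZ d^-1 (asum_divr th0 aV).
set u := fun k => _; set L := (X in is_bisum _ X).
have eu : (fun k => d^-1 * (jt (z * q) (q ^+ 2) k ^+ 2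
    * qpoch_inf (- 0 * (q ^+ 2) ^ (- k)) (q ^+ 2) * qpoch_inf (z * (q ^+ 2) ^ k * q) q)) =1 u.
  have z1 : 1 - z != 0 by have := qpoch_inf_factor_neq0 Kc 0 q1 A0; rewrite expr0 mulr1.
  have zqP : qpoch_inf (z * q) q != 0.
    by move: A0; rewrite (qpoch_infS Kc) // mulf_eq0 negb_or => /andP[].
  apply: (@two_sided_rec _ (fun k => (1 - z * q * (q ^+ 2) ^ k) * (1 - z * q * q * (q ^+ 2) ^ k))
    (fun k => (z * q * (q ^+ 2) ^ k) ^+ 2)).
  - by move=> n; have [h1 h2] := factor2_neq0 n q1 zqP; rewrite mulf_neq0.
  - by move=> n; rewrite expf_neq0 // mulf_neq0 ?expfz_neq0.
  - rewrite jt0 !oppr0 !expr0z !mulr1 expr1n mul1r qpoch_inf0 // mul1r /u /d.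
    rewrite (qpoch_infS Kc z q1) invfM mulfVK //.
    rewrite (_ : 2 * 0 ^+ 2 = 0 :> int) // ?mulr0 ?add0r !expr0z.
    by rewrite mulr1 mul1r /= big_ord1 expr0 mulr1.
  - move=> k; rewrite jtS // (qpoch_inf_step2 (z * (q ^+ 2) ^ k * q) q1).
    rewrite !oppr0 !mul0r !qpoch_inf0 //.
    have -> : z * (q ^+ 2) ^ (k + 1) * q = z * (q ^+ 2) ^ k * q * q ^+ 2.
      by rewrite exprzS //; ring.
    set J := jt _ _ _; set P1 := qpoch_inf _ _; by ring.
  - move=> k; rewrite /u (_ : 2 * (k + 1) + 1 = 2 * k + 1 + 1 + 1); last by ring.
    have e1 : z * q ^ (2 * k + 1) = z * q * (q ^+ 2) ^ k by rewrite exprzS // exprz_sqr; ring.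
    have e2 : z * q ^ (2 * k + 1 + 1) = z * q * q * (q ^+ 2) ^ k.
      by rewrite !exprzS // exprz_sqr; ring.
    rewrite -(@qpoch_invS _ z q (2 * k + 1)) // ?e1; last first.
      by move=> /double_succ_ge0; case: (k) => // n _; case: (factor2_neq0 n q1 zqP).
    rewrite -(@qpoch_invS _ z q (2 * k + 1 + 1)) // ?e2; last first.
      (* At [k = -1] the index [2 k + 2] is already [0], and the factor is [1 - z]. *)
      move=> /double_succ2_ge0[|->]; first by case: (k) => // n _; case: (factor2_neq0 n q1 zqP).
      by rewrite -invr_expz expr1z (_ : z * q * q / q ^+ 2 = z) //; field.
    have -> : 2 * (k + 1) ^+ 2 = 2 * k ^+ 2 + 2 * (2 * k) + 2 by ring.
    have -> : 2 * (k + 1) = 2 * k + 2 by ring.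
    have -> : q ^ (2 * k ^+ 2 + 2 * (2 * k) + 2) = q ^ (2 * k ^+ 2) * ((q ^+ 2) ^ k) ^+ 2 * q ^+ 2.
      rewrite !expfzDr // [q ^ (2 * (2 * k))]exprz_sqr.
      by rewrite [_ ^ (2 * k)]exprz_sqr [((q ^+ 2) ^+ 2) ^ k]expfzMl.
    have -> : z ^ (2 * k + 2) = z ^ (2 * k) * z ^+ 2 by rewrite expfzDr.
    by ring.
suff eL : L = d^-1 * (l / (qpoch_inf q (q ^+ 2) * theta (- z) q)).
  rewrite eL; apply: (hsum_is_bisum Kc); last exact: eq_hsum eu hu.
  by apply: asum_le au => k; rewrite -eu.
rewrite /L el !theta_neg /d.
have -> : q ^+ 8 / (z ^+ 4 * q ^+ 3) = z ^- 4 * q ^+ 5 by field; rewrite q0 z0.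
have -> : q ^+ 8 / (z ^+ 4 * q ^+ 5) = z ^- 4 * q ^+ 3 by field; rewrite q0 z0.
rewrite !mulNr.
by field; rewrite A0 B0 C0 D0 E0.
Qed.

End QuadraticSums.

(** * The series with two products in base [q^6] *)

Section QuadraticSumsCubicBase.
Context {K : numFieldType} (Kc : hcomplete K).
Implicit Types (a q z t : K) (k r : int) (n : nat).

(** Splits base [q^8] into [q^2] and [q^6]: the first factor is absorbed by a theta function in base
    [q^2], the second is a triple product term. *)
Lemma jt_sextic q t x r : q != 0 -> t != 0 -> x != 0 ->
  jt (t * q) (q ^+ 2) r ^+ 2 * jt (- t) q (2 * r)
  = jt (- x) (q ^+ 2) r * jt (- (t ^+ 4 * q ^+ 3 / x)) (q ^+ 6) r.
Proof.
move=> q0 t0 x0; rewrite jt_quartic //.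
have p0 : q ^+ 2 != 0 by rewrite expf_neq0.
have q60 : q ^+ 6 != 0 by rewrite expf_neq0.
have q80 : q ^+ 8 != 0 by rewrite expf_neq0.
have nx0 : - x != 0 by rewrite oppr_eq0.
have y0 : t ^+ 4 * q ^+ 3 != 0 by rewrite mulf_neq0 ?expf_neq0.
have yx0 : t ^+ 4 * q ^+ 3 / x != 0 by rewrite mulf_neq0 ?invr_eq0.
have ny0 : - (t ^+ 4 * q ^+ 3) != 0 by rewrite oppr_eq0.
have nyx0 : - (t ^+ 4 * q ^+ 3 / x) != 0 by rewrite oppr_eq0.
have e8 i : (q ^+ 8) ^ i = (q ^+ 2) ^ i * (q ^+ 6) ^ i by rewrite -expfzMl -exprD.
move: r; apply: (@int_rec_eq _ (fun r => t ^+ 4 * q ^+ 3 * (q ^+ 8) ^ r)).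
- by move=> i; rewrite !mulf_neq0 ?expf_neq0 ?expfz_neq0.
- by rewrite !jt0 mulr1.
- by move=> i; rewrite jtS // opprK.
- by move=> i; rewrite !jtS // e8; field.
Qed.

(** With [t = z / q] and [b = q^2 / z] the products on a diagonal form
    [theta (- z q^(2r)) (q ^+ 2)]. The linear factor yields triple products at [- z^3 / q] and
    [- z^3 q]; the former is moved by one period [q^6]. *)
Lemma bisum_sextic_pair q z : q != 0 -> `|q| < 1 -> z != 0 ->
  (forall j : nat, 1 + z * (q ^+ 2) ^- j.+1 != 0) ->
  qpochs_inf [:: z ^+ 2; q ^+ 2 / z ^+ 2; q] (q ^+ 2) != 0 ->
  is_bisum
    (fun k : int => qpoch (- z) (q ^+ 2) k / qpoch z q (2 * k) * q ^ (k * (k - 1)) * z ^ k)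
    (qpoch_inf (q / z) q * qpoch_inf (- z) (q ^+ 2)
     / qpochs_inf [:: z ^+ 2; q ^+ 2 / z ^+ 2; q] (q ^+ 2)
     * qpoch_inf (q ^+ 6) (q ^+ 6)
     * (qpochs_inf [:: - z ^+ 3 * q; - z ^- 3 * q ^+ 5] (q ^+ 6)
        + z ^+ 2 * qpochs_inf [:: - z ^+ 3 * q ^+ 5; - z ^- 3 * q] (q ^+ 6))).
Proof.
move=> q0 q1 z0 hz; rewrite /qpochs_inf !big_cons !big_nil !mulr1 -expr_div_n.
rewrite !(qpoch_inf_sqr Kc _ q1) !mulf_eq0 !negb_or => /andP[] /andP[A0 B0] /andP[].
move=> /andP[C0 D0] E0.
have p0 : q ^+ 2 != 0 by rewrite expf_neq0.
have p1 : `|q ^+ 2| < 1 by exact: norm_expS_lt1.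
have nz0 : - z != 0 by rewrite oppr_eq0.
have t0 : z / q != 0 by rewrite mulf_neq0 ?invr_eq0.
have nt0 : - (z / q) != 0 by rewrite oppr_eq0.
have [aV [l hv hl]] := quadratic_transformation Kc (q ^+ 2 / z) q0 q1 t0.
have et : z / q * q = z by rewrite divfK.
have eth : theta (- (z / q)) q = z / q * theta (- z) q.
  by rewrite (theta_step Kc q1 q0 nt0) opprK mulNr et.
have th0 : qpoch_inf q (q ^+ 2) * theta (- (z / q)) q != 0.
  by rewrite eth theta_neg !mulf_neq0 ?invr_eq0.
have q61 : `|q ^+ 6| < 1 by exact: norm_expS_lt1.
have q60 : q ^+ 6 != 0 by rewrite expf_neq0.
have n1 : - (z ^+ 3 * q) != 0 by rewrite oppr_eq0 mulf_neq0 ?expf_neq0.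
have n5 : - (z ^+ 3 / q) != 0 by rewrite oppr_eq0 mulf_neq0 ?invr_eq0 ?expf_neq0.
have el : l = theta (- z) (q ^+ 2) * (qpoch_inf (q ^+ 6) (q ^+ 6) *
    (z / q * (theta (- (z ^+ 3 * q)) (q ^+ 6) + z ^+ 2 * theta (- (z ^+ 3 * q ^+ 5)) (q ^+ 6)))).
  apply: (hsum_unique hl).
  have hs := hsumZ (theta (- z) (q ^+ 2)) (hsumD (jacobi_triple_product Kc q61 q60 n5)
     (hsumZ (z / q) (jacobi_triple_product Kc q61 q60 n1))).
  have e5 : theta (- (z ^+ 3 / q)) (q ^+ 6) = z ^+ 3 / q * theta (- (z ^+ 3 * q ^+ 5)) (q ^+ 6).
    by rewrite (theta_step Kc q61 q60 n5) opprK (_ : - (z ^+ 3 / q) * q ^+ 6 =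
      - (z ^+ 3 * q ^+ 5)) //; field.
  rewrite e5 in hs.
  have -> : qpoch_inf (q ^+ 6) (q ^+ 6) *
    (z / q * (theta (- (z ^+ 3 * q)) (q ^+ 6) + z ^+ 2 * theta (- (z ^+ 3 * q ^+ 5)) (q ^+ 6)))
   = qpoch_inf (q ^+ 6) (q ^+ 6) * (z ^+ 3 / q * theta (- (z ^+ 3 * q ^+ 5)) (q ^+ 6))
     + z / q * (qpoch_inf (q ^+ 6) (q ^+ 6) * theta (- (z ^+ 3 * q)) (q ^+ 6)).
    by move: (theta _ _) (theta (- (z ^+ 3 * q)) _) => X1 X2; field.
  apply: eq_hsum hs => r; rewrite -(theta_shift Kc r p1 p0 nz0) mulNr theta_neg.
  have pr0 : (q ^+ 2) ^ r != 0 by rewrite expfz_neq0.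
  rewrite (@jt_sextic q (z / q) z) //.
  have -> : (z / q) ^+ 4 * q ^+ 3 / z = z ^+ 3 / q by field; rewrite q0 z0.
  have -> : q ^+ 2 / z * (q ^+ 2) ^ (- r) * (z / q * q * (q ^+ 2) ^ r) ^+ 2 / q ^+ 2
     = z * (q ^+ 2) ^ r by rewrite -invr_expz; field; rewrite q0 z0 pr0.
  have -> : - (q ^+ 2 / z) * (q ^+ 2) ^ (- r) = - (q ^+ 2 / (z * (q ^+ 2) ^ r)).
    by rewrite -invr_expz; field; rewrite z0 pr0.
  have -> : jt (- (z ^+ 3 * q)) (q ^+ 6) r = jt (- (z ^+ 3 / q)) (q ^+ 6) r * (q ^+ 2) ^ r.
    by rewrite -jt_scale //; congr (jt _ _ _); field.
  set J1 := jt _ _ _; set J2 := jt _ _ _; set P1 := qpoch_inf _ _; set P2 := qpoch_inf _ _.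
  by field.
pose d := qpoch_inf (- (q ^+ 2 / z)) (q ^+ 2) * qpoch_inf z q.
have F0 : qpoch_inf (- (q ^+ 2 / z)) (q ^+ 2) != 0.
  move: D0; rewrite (qpoch_inf_even_odd Kc) // mulf_eq0 negb_or => /andP[_].
  by rewrite (_ : - (q / z) * q = - (q ^+ 2 / z)) //; ring.
have d0 : d != 0 by rewrite mulf_neq0.
have hu := hsumZ d^-1 (hsum_divr th0 hv).
have au := asumZ d^-1 (asum_divr th0 aV).
set u := fun k => _; set L := (X in is_bisum _ X).
have eu : (fun k => d^-1 * (jt (z / q * q) (q ^+ 2) k ^+ 2
    * qpoch_inf (- (q ^+ 2 / z) * (q ^+ 2) ^ (- k)) (q ^+ 2)
    * qpoch_inf (z / q * (q ^+ 2) ^ k * q) q)) =1 u.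
  apply: (@two_sided_rec _ (fun k => (1 - z * (q ^+ 2) ^ k) * (1 - z * q * (q ^+ 2) ^ k))
    (fun k => (1 - - z * (q ^+ 2) ^ k) * (z * (q ^+ 2) ^ k))).
  - by move=> n; have [h1 h2] := factor2_neq0 Kc n q1 A0; rewrite mulf_neq0.
  - by move=> n; rewrite mulNr opprK !mulf_neq0 ?expfz_neq0 // NegzE -exprnN.
  - rewrite jt0 !oppr0 !expr0z !mulr1 expr1n mul1r et mulVf // /u mulr0 !qpoch0.
    by rewrite mul0r !expr0z !mulr1 divr1.
  - move=> k; have pk0 : (q ^+ 2) ^ k != 0 by rewrite expfz_neq0.
    rewrite et jtS //.
    have ez i : z / q * (q ^+ 2) ^ i * q = z * (q ^+ 2) ^ i by field.
    rewrite !ez (qpoch_inf_step2 Kc (z * (q ^+ 2) ^ k) q1).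
    rewrite (qpoch_infS Kc (- (q ^+ 2 / z) * (q ^+ 2) ^ (- (k + 1))) p1).
    have -> : - (q ^+ 2 / z) * (q ^+ 2) ^ (- (k + 1)) * q ^+ 2 = - (q ^+ 2 / z) * (q ^+ 2) ^ (- k).
      by rewrite -mulrA exprz_oppS.
    have -> : z * (q ^+ 2) ^ (k + 1) = z * (q ^+ 2) ^ k * q ^+ 2 by rewrite exprzS //; ring.
    have -> : (q ^+ 2) ^ (- (k + 1)) = ((q ^+ 2) ^ k * q ^+ 2)^-1 by rewrite -invr_expz exprzS.
    set J := jt _ _ _; set P1 := qpoch_inf _ _; set P2 := qpoch_inf _ _.
    by field; rewrite d0 q0 z0 pk0.
  - move=> k; rewrite /u qpochS //; last first.
      by case: k => // n _; rewrite mulNr opprK NegzE -exprnN.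
    rewrite -(@qpoch_evenS _ z q k) //; last first.
      by case: k => // n _; apply: factor2_neq0.
    have -> : (k + 1) * (k + 1 - 1) = k * (k - 1) + 2 * k by ring.
    rewrite expfzDr // exprz_sqr exprzS //; ring.
suff eL : L = d^-1 * (l / (qpoch_inf q (q ^+ 2) * theta (- (z / q)) q)).
  rewrite eL; apply: (hsum_is_bisum Kc); last exact: eq_hsum eu hu.
  by apply: asum_le au => k; rewrite -eu.
rewrite /L el eth !theta_neg /d.
have -> : q ^+ 6 / (z ^+ 3 * q) = z ^- 3 * q ^+ 5 by field; rewrite q0 z0.
have -> : q ^+ 6 / (z ^+ 3 * q ^+ 5) = z ^- 3 * q by field; rewrite q0 z0.
rewrite !mulNr.
by field; rewrite A0 B0 C0 D0 E0 F0 q0 z0.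
Qed.

End QuadraticSumsCubicBase.

(** * The series with a single product in base [q^6], including [z = -1] *)

Section QuadraticSumsSextic.
Context {K : numFieldType} (Kc : hcomplete K) (q : K) (q0 : q != 0) (q1 : `|q| < 1).
Implicit Types (a z t : K) (k r : int) (n : nat).
Let p := q ^+ 2.
Let p0 : p != 0. Proof. by rewrite expf_neq0. Qed.
Let p1 : `|p| < 1. Proof. exact: norm_expS_lt1. Qed.
Let q61 : `|q ^+ 6| < 1. Proof. exact: norm_expS_lt1. Qed.
Let q60 : q ^+ 6 != 0. Proof. by rewrite expf_neq0. Qed.

Definition sextic_term t k : K := jt (t * q) p k ^+ 2 * qpoch_inf (- (p / t) * p ^ (- k)) p
   * qpoch_inf (t * p ^ k * q) q.

(** The common factor [1 + t] of [theta (- t) p] and [theta (- t) q] is cancelled, so the expression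
    keeps its meaning at [t = -1]. *)
Definition sextic_value t : K := qpoch_inf (- (t * p)) p * qpoch_inf (- (p / t)) p
   * qpoch_inf (q ^+ 6) (q ^+ 6)
   * (qpoch_inf (- (t ^+ 3 * q ^+ 3)) (q ^+ 6) * qpoch_inf (- (q ^+ 3 / t ^+ 3)) (q ^+ 6))
   / (qpoch_inf q p * qpoch_inf (- (t * q)) q * qpoch_inf (- (q / t)) q).

Lemma qpoch_inf_small_neq0 a b : `|b| < 1 -> `|a| < 1 -> qpoch_inf a b != 0.
Proof.
move=> b1 a1; apply: qpoch_inf_neq0 => // j; apply: one_sub_neq0.
by apply: le_lt_trans a1; exact: norm_shift_le.
Qed.

Lemma sextic_sum_generic t : t != 0 -> t != -1 ->
  qpoch_inf (- (t * q)) q != 0 -> qpoch_inf (- (q / t)) q != 0 ->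
  asum (sextic_term t) /\ hsum (sextic_term t) (sextic_value t).
Proof.
move=> t0 t1 A0 B0; have nt0 : - t != 0 by rewrite oppr_eq0.
have D0 : qpoch_inf q p != 0 by exact: qpoch_inf_small_neq0.
have [aV [l hv hl]] := quadratic_transformation Kc (p / t) q0 q1 t0.
have t10 : 1 + t != 0 by rewrite addrC -[1]opprK subr_eq0.
have eth : theta (- t) q = (1 + t) * (qpoch_inf (- (t * q)) q * qpoch_inf (- (q / t)) q).
  by rewrite theta_neg (qpoch_infS Kc (- t)) // opprK mulNr mulrA.
have th0 : qpoch_inf q p * theta (- t) q != 0 by rewrite eth !mulf_neq0.
have n3 : - (t ^+ 3 * q ^+ 3) != 0 by rewrite oppr_eq0 mulf_neq0 ?expf_neq0.
have el : l = theta (- t) p * (qpoch_inf (q ^+ 6) (q ^+ 6) * theta (- (t ^+ 3 * q ^+ 3)) (q ^+ 6)).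
  apply: (hsum_unique hl).
  apply: eq_hsum (hsumZ (theta (- t) p) (jacobi_triple_product Kc q61 q60 n3)) => r.
  have pr0 : p ^ r != 0 by rewrite expfz_neq0.
  rewrite -(theta_shift Kc r p1 p0 nt0) mulNr theta_neg (@jt_sextic _ q t t) //.
  have -> : t ^+ 4 * q ^+ 3 / t = t ^+ 3 * q ^+ 3 by field.
  rewrite -/p.
  have -> : p / t * p ^ (- r) * (t * q * p ^ r) ^+ 2 / p = t * p ^ r * p.
    rewrite -invr_expz; move: pr0; set X := p ^ r => X0; rewrite /p.
    by field; rewrite q0 t0 X0.
  have -> : - (p / t) * p ^ (- r) = - (p / (t * p ^ r)).
    by rewrite -invr_expz; field; rewrite t0 pr0.
  (* The linear factor [1 + t p^r] completes the product starting at [- t p^(r+1)], so only one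
     triple product appears. *)
  rewrite (qpoch_infS Kc (- (t * p ^ r)) p1) opprK mulNr.
  set J1 := jt _ _ _; set J2 := jt _ _ _; set P1 := qpoch_inf _ _; set P2 := qpoch_inf _ _.
  by ring.
split; first exact: asum_divr th0 aV.
have := hsum_divr th0 hv; congr (hsum _ _).
rewrite el eth !theta_neg (qpoch_infS Kc (- t) p1) opprK mulNr /sextic_value.
have -> : q ^+ 6 / (t ^+ 3 * q ^+ 3) = q ^+ 3 / t ^+ 3 by field; rewrite q0 t0.
by field; rewrite A0 B0 D0 t10.
Qed.

Let Q : K := `|q|.
Let T : K := `|p|.

(** On the unit circle the moduli of all arguments are independent of [t], hence the choice of that
    path to [-1]. Here [kappa = 1]: for [k < 0], [jt (- T) (T ^+ 2) k] is
    [Q^-1 ^ k * jt (- Q) Q (2 * k)], the last factor offsets the growth of [E], and the ratio [Q]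
    remains. *)
Lemma sextic_term_le : exists2 g : int -> K, asum g &
  forall t k, `|t| = 1 -> `|sextic_term t k| <= `|g k|.
Proof.
have Q0 : 0 < Q by rewrite normr_gt0.
have TQ : T = Q ^+ 2 by rewrite /T /p normrX.
have T0 : 0 < T by rewrite normr_gt0.
have TT0 : 0 < T ^+ 2 by rewrite exprn_gt0.
have Qn0 : Q != 0 by rewrite gt_eqF.
have Tn0 : T != 0 by rewrite gt_eqF.
have TTn0 : T ^+ 2 != 0 by rewrite gt_eqF.
pose E k : K := qpoch_inf (- (Q * Q ^ (2 * k))) Q.
have pE k : 0 < Q * Q ^ (2 * k) by rewrite mulr_gt0 ?exprz_gt0.
have E0 k : 0 <= E k by rewrite qpoch_infN_ge0 ?(ltW (pE k)) ?(ltW Q0).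
have nT0 : - T != 0 by rewrite oppr_eq0.
have nQ0 : - Q != 0 by rewrite oppr_eq0.
have ej k : jt (- T) (T ^+ 2) k = Q^-1 ^ k * jt (- Q) Q (2 * k).
  move: k; apply: (@int_rec_eq _ (fun k => T * (T ^ k) ^+ 2)).
  - by move=> i; rewrite mulf_neq0 ?expf_neq0 ?expfz_neq0.
  - by rewrite !jt0 expr0z mulr1.
  - by move=> i; rewrite jtS // opprK [(T ^+ 2) ^ i]expfzMl.
  - move=> i; rewrite (_ : 2 * (i + 1) = 2 * i + 1 + 1); last by ring.
    rewrite !jtS // !exprzS ?invr_eq0 // exprz_sqr -TQ.
    by rewrite [X in _ = _ * (X * _)]TQ; field.
pose g k : K := 1 ^ k * jt (- T) (T ^+ 2) k * qpoch_inf (- (T * T ^ (- k))) T * E k.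
have ag : asum g.
  apply: (asum_weight_gen Kc (c1 := qpoch_inf (- Q) Q) (c2 := theta (- Q) Q * Q)
    T0 p1 T0 T0 ltr01 (ltW Q0) q1 E0) => n.
    apply: qpoch_infN_le; rewrite ?(ltW (pE _)) ?(ltW Q0) //.
    by rewrite ler_piMr ?(ltW Q0) // exprn_ile1 ?(ltW Q0) ?(ltW q1).
  rewrite exp1rz mul1r ej.
  have J0 := jtN_gt0 (2 * Negz n) Q0 Q0; set J := jt _ _ _ in J0 *.
  have -> : Q^-1 ^ Negz n = Q * Q ^+ n by rewrite exprz_inv NegzE opprK -exprnP exprS.
  rewrite [leRHS](_ : _ = Q * Q ^+ n * J * (theta (- Q) Q / J)); last by field; rewrite gt_eqF.
  rewrite ler_wpM2l //; last exact: qpoch_infN_le_theta.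
  exact: mulr_ge0 (mulr_ge0 (ltW Q0) (exprn_ge0 n (ltW Q0))) (ltW J0).
exists g => // t k t1; have t0 : t != 0 by rewrite -normr_gt0 t1.
have tq0 : t * q != 0 by rewrite mulf_neq0.
rewrite /g exp1rz mul1r normrM [X in X * _ <= _]normrM.
have BB0 : 0 <= qpoch_inf (- (T * T ^ (- k))) T.
  by rewrite qpoch_infN_ge0 ?(ltW T0) ?mulr_ge0 ?(ltW T0) ?(ltW (exprz_gt0 _ T0)).
have J0 := ltW (jtN_gt0 k T0 TT0).
rewrite (ger0_norm (mulr_ge0 (mulr_ge0 J0 BB0) (E0 k))).
rewrite (jt_sqr k tq0 p0) jt_norm normrN !normrX -/T [`|t * q|]normrM t1 mul1r -/Q -TQ.
apply: ler_pM => //.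
- by apply: mulr_ge0 => //.
- rewrite ler_wpM2l //; apply: le_trans (norm_qpoch_inf_le Kc _ p1) _.
  by rewrite normrM normrN normrM normfV t1 invr1 mulr1 norm_exprz.
- apply: le_trans (norm_qpoch_inf_le Kc _ q1) _.
  by rewrite !normrM t1 mul1r norm_exprz -/T -/Q /E mulrC exprz_sqr -TQ.
Qed.

Lemma cvg_exprz (u : nat -> K) (l : K) k : l != 0 -> (u n @[n --> \oo] --> l)%classic ->
  (u n ^ k @[n --> \oo] --> l ^ k)%classic.
Proof.
move=> l0 ul; have pos (m : nat) : (u n ^+ m @[n --> \oo] --> l ^+ m)%classic.
  elim: m => [|m IH]; first by under eq_fun do rewrite expr0; exact: cvg_cst.
  by under eq_fun do rewrite exprS; rewrite exprS; apply: seq_cvgM.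
case: k => m; first exact: pos.
by apply: cvgV; [rewrite expf_neq0|exact: pos].
Qed.

(** Since [|e n| = 1], the arguments [- e n q] and [- q / e n] stay in the open unit disc and the
    generic case applies. The series converge by domination, the closed form by continuity. *)
Lemma sextic_sum_limit (e : nat -> K) : (forall n, `|e n| = 1) -> (forall n, e n != -1) ->
  (e n @[n --> \oo] --> (-1 : K))%classic ->
  asum (sextic_term (-1)) /\ hsum (sextic_term (-1)) (sextic_value (-1)).
Proof.
move=> e1 eN ce; have [g ag hg] := sextic_term_le.
have N1 : `|-1 : K| = 1 by rewrite normrN normr1.
have aN : asum (sextic_term (-1)) by apply: asum_le ag => k; exact: hg.
split=> //; have [l hl] := Kc aN.
have n10 : (-1 : K) != 0 by rewrite oppr_eq0 oner_eq0.
have ci : ((e n)^-1 @[n --> \oo] --> (-1 : K)^-1)%classic by apply: cvgV.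
have small (t a : K) : `|t| = 1 -> `|a| < 1 -> `|- (t * a)| < 1 /\ `|- (a / t)| < 1.
  by move=> t1 a1; rewrite !normrN !normrM normfV t1 invr1 mul1r mulr1.
have hs n : hsum (sextic_term (e n)) (sextic_value (e n)).
  have e0 : e n != 0 by rewrite -normr_gt0 e1.
  have [s1 s2] := small _ _ (e1 n) q1.
  by have [] := sextic_sum_generic e0 (eN n) (qpoch_inf_small_neq0 q1 s1)
    (qpoch_inf_small_neq0 q1 s2).
have c1 : (sextic_value (e n) @[n --> \oo] --> l)%classic.
  apply: (tannery Kc ag _ _ hs hl) => [n k|k]; first exact: hg.
  rewrite /sextic_term; apply: seq_cvgM; last first.
    apply: qpoch_inf_continuous => //; apply: seq_cvgM; last exact: cvg_cst.
    by apply: seq_cvgM => //; exact: cvg_cst.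
  apply: seq_cvgM.
    under eq_fun do rewrite expr2; rewrite expr2 /jt.
    have cj : ((- (e n * q)) ^ k * p ^ binz2 k @[n --> \oo] -->
        (- (-1 * q)) ^ k * p ^ binz2 k)%classic.
      apply: seq_cvgM; last exact: cvg_cst.
      apply: cvg_exprz; first by rewrite mulN1r opprK.
      by apply: cvgN; apply: seq_cvgM => //; exact: cvg_cst.
    exact: seq_cvgM.
  apply: qpoch_inf_continuous => //; apply: seq_cvgM; last exact: cvg_cst.
  by apply: cvgN; apply: seq_cvgZ.
have cP (a b : K) (u : nat -> K) (m : K) : `|b| < 1 -> (u n @[n --> \oo] --> m)%classic ->
    (qpoch_inf (- (a * u n)) b @[n --> \oo] --> qpoch_inf (- (a * m)) b)%classic.
  by move=> b1 um; apply: qpoch_inf_continuous => //; apply: cvgN; apply: seq_cvgZ.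
have cP' (a b : K) (u : nat -> K) (m : K) : `|b| < 1 -> (u n @[n --> \oo] --> m)%classic ->
    (qpoch_inf (- (u n * a)) b @[n --> \oo] --> qpoch_inf (- (m * a)) b)%classic.
  by move=> b1 um; under eq_fun do rewrite mulrC; rewrite mulrC; exact: cP.
have c2 : (sextic_value (e n) @[n --> \oo] --> sextic_value (-1))%classic.
  have [s1 s2] := small _ _ N1 q1.
  have c3 := @cvg_exprz e _ 3 n10 ce.
  rewrite /sextic_value; apply: seq_cvgM.
    apply: seq_cvgM; last apply: seq_cvgM.
    - apply: seq_cvgM; last exact: cvg_cst.
      by apply: seq_cvgM; [exact: cP'|exact: cP].
    - exact: cP'.
    - apply: cP => //; apply: cvgV => //; rewrite expf_neq0 //.
  apply: cvgV.
    by rewrite !mulf_neq0 ?qpoch_inf_small_neq0.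
  apply: seq_cvgM; last exact: cP.
  by apply: seq_cvgM; [exact: cvg_cst|exact: cP'].
by rewrite (seq_cvg_unique c2 c1).
Qed.

End QuadraticSumsSextic.
Lemma bisum_sextic {K : numFieldType} (Kc : hcomplete K) (q z : K) : q != 0 -> `|q| < 1 -> z != 0 ->
  (exists e : nat -> K, [/\ forall n, `|e n| = 1, forall n, e n != -1
     & (e n @[n --> \oo] --> (-1 : K))%classic]) ->
  (forall j : nat, 1 + z * (q ^+ 2) ^- j.+1 != 0) ->
  qpochs_inf [:: z ^+ 2 * q ^+ 2; q ^+ 2 / z ^+ 2; q] (q ^+ 2) != 0 ->
  is_bisum
    (fun k : int => qpoch (- z) (q ^+ 2) k / qpoch (z * q) q (2 * k)
                    * q ^ (k * (k + 1)) * z ^ k)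
    (qpoch_inf (q / z) q * qpoch_inf (- z * q ^+ 2) (q ^+ 2)
     / qpochs_inf [:: z ^+ 2 * q ^+ 2; q ^+ 2 / z ^+ 2; q] (q ^+ 2)
     * qpochs_inf [:: q ^+ 6; - z ^+ 3 * q ^+ 3; - z ^- 3 * q ^+ 3] (q ^+ 6)).
Proof.
move=> q0 q1 z0 [e [e1 eN ce]] hz.
rewrite /qpochs_inf !big_cons !big_nil !mulr1 -[q ^+ 2 / z ^+ 2]expr_div_n -exprMn.
rewrite !(qpoch_inf_sqr Kc _ q1) !mulf_eq0 !negb_or => /andP[] /andP[A0 B0] /andP[].
move=> /andP[C0 D0] E0.
have p0 : q ^+ 2 != 0 by rewrite expf_neq0.
have p1 : `|q ^+ 2| < 1 by exact: norm_expS_lt1.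
have zq0 : z * q != 0 by rewrite mulf_neq0.
have [aV hV] : asum (sextic_term q z) /\ hsum (sextic_term q z) (sextic_value q z).
  (* The factors of [theta (- z) q] other than [1 + z] are nonzero by [B0] and [D0]. *)
  have [->|zN1] := eqVneq z (-1); first exact: (sextic_sum_limit Kc q0 q1 e1 eN ce).
  exact: sextic_sum_generic.
pose d := qpoch_inf (- (q ^+ 2 / z)) (q ^+ 2) * qpoch_inf (z * q) q.
have F0 : qpoch_inf (- (q ^+ 2 / z)) (q ^+ 2) != 0.
  move: D0; rewrite (qpoch_inf_even_odd Kc) // mulf_eq0 negb_or => /andP[_].
  by rewrite (_ : - (q / z) * q = - (q ^+ 2 / z)) //; ring.
have d0 : d != 0 by rewrite mulf_neq0.
have hu := hsumZ d^-1 hV; have au := asumZ d^-1 aV.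
set u := fun k => _; set L := (X in is_bisum _ X).
have eu : (fun k => d^-1 * sextic_term q z k) =1 u.
  rewrite /sextic_term.
  apply: (@two_sided_rec _
    (fun k => (1 - z * q * (q ^+ 2) ^ k) * (1 - z * q * q * (q ^+ 2) ^ k))
    (fun k => (1 - - z * (q ^+ 2) ^ k) * (z * q ^+ 2 * (q ^+ 2) ^ k))).
  - by move=> n; have [h1 h2] := factor2_neq0 Kc n q1 A0; rewrite mulf_neq0.
  - by move=> n; rewrite mulNr opprK !mulf_neq0 ?expfz_neq0 // NegzE -exprnN.
  - rewrite jt0 !oppr0 !expr0z !mulr1 expr1n mul1r mulVf // /u mulr0 !qpoch0.
    by rewrite mul0r !expr0z !mulr1 divr1.
  - move=> k; have pk0 : (q ^+ 2) ^ k != 0 by rewrite expfz_neq0.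
    rewrite jtS // (qpoch_inf_step2 Kc (z * (q ^+ 2) ^ k * q) q1).
    rewrite (qpoch_infS Kc (- (q ^+ 2 / z) * (q ^+ 2) ^ (- (k + 1))) p1).
    have -> : - (q ^+ 2 / z) * (q ^+ 2) ^ (- (k + 1)) * q ^+ 2 = - (q ^+ 2 / z) * (q ^+ 2) ^ (- k).
      by rewrite -mulrA exprz_oppS.
    have -> : z * (q ^+ 2) ^ (k + 1) * q = z * (q ^+ 2) ^ k * q * q ^+ 2.
      by rewrite exprzS //; ring.
    have -> : (q ^+ 2) ^ (- (k + 1)) = ((q ^+ 2) ^ k * q ^+ 2)^-1 by rewrite -invr_expz exprzS.
    set J := jt _ _ _; set P1 := qpoch_inf _ _; set P2 := qpoch_inf _ _.
    by field; rewrite d0 q0 z0 pk0.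
  - move=> k; rewrite /u qpochS //; last first.
      by case: k => // n _; rewrite mulNr opprK NegzE -exprnN.
    rewrite -(@qpoch_evenS _ (z * q) q k) //; last first.
      by case: k => // n _; apply: factor2_neq0.
    have -> : (k + 1) * (k + 1 + 1) = k * (k + 1) + 2 * k + 2 by ring.
    have -> : q ^ (k * (k + 1) + 2 * k + 2) = q ^ (k * (k + 1)) * (q ^+ 2) ^ k * q ^+ 2.
      by rewrite (expfzDr _ 2) // (expfzDr _ (2 * k)) // exprz_sqr.
    by rewrite exprzS //; ring.
suff eL : L = d^-1 * sextic_value q z.
  rewrite eL; apply: (hsum_is_bisum Kc); last exact: eq_hsum eu hu.
  by apply: asum_le au => k; rewrite -eu.
rewrite /L /sextic_value /d [- z ^- 3 * _]mulNr [z ^- 3 * _]mulrC !mulNr.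
by field; rewrite A0 B0 C0 D0 E0 F0.
Qed.

(** A Cayley transform: [- (1 + i x^n) / (1 - i x^n)] is up to sign a quotient of conjugates, hence
    of modulus [1], and it would be [-1] only for [x^n = 0]. *)
Lemma unit_circle_seq {C : numClosedFieldType} (Cc : hcomplete C) (x : C) :
  0 < x -> x < 1 ->
  exists e : nat -> C, [/\ forall n, `|e n| = 1, forall n, e n != -1
     & (e n @[n --> \oo] --> (-1 : C))%classic].
Proof.
move=> x0 x1; have xn n : 0 < x ^+ n by rewrite exprn_gt0.
have conjE n : (1 + 'i * x ^+ n)^* = 1 - 'i * x ^+ n.
  by rewrite rmorphD rmorphM /= conjCi rmorph1 mulNr (CrealP (ger0_real (ltW (xn n)))).
have nE n : `|1 - 'i * x ^+ n| = `|1 + 'i * x ^+ n| by rewrite -conjE norm_conjC.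
have ix n : 'i * x ^+ n != 0 :> C by rewrite mulf_neq0 ?neq0Ci ?gt_eqF.
have d0 n : 1 - 'i * x ^+ n != 0.
  rewrite subr_eq0; apply/eqP => h; have := ix n; have := conjE n.
  rewrite -h subrr rmorphD rmorph1 => /eqP; rewrite -[1 + 1]/(2%:R) pnatr_eq0.
  by [].
have s0 n : 1 + 'i * x ^+ n != 0 by rewrite -normr_gt0 -nE normr_gt0.
exists (fun n => - ((1 + 'i * x ^+ n) / (1 - 'i * x ^+ n))); split=> [n|n|].
- by rewrite normrN normrM normfV nE divff // normr_eq0.
- rewrite eqr_opp -subr_eq0.
  rewrite (_ : _ - 1 = 2 * ('i * x ^+ n) / (1 - 'i * x ^+ n)); last by field.
  by rewrite mulf_neq0 ?invr_eq0 // mulf_neq0 // pnatr_eq0.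
- have cx : ('i * x ^+ n @[n --> \oo] --> 'i * (0 : C))%classic.
    by apply: seq_cvgZ; apply: cvg_expr0 => //; rewrite gtr0_norm.
  rewrite mulr0 in cx.
  have c1 : (1 + 'i * x ^+ n @[n --> \oo] --> 1 + (0 : C))%classic.
    by apply: seq_cvgD => //; exact: cvg_cst.
  have c2 : (1 - 'i * x ^+ n @[n --> \oo] --> 1 - (0 : C))%classic.
    by apply: cvgB => //; exact: cvg_cst.
  have c3 : (- ((1 + 'i * x ^+ n) / (1 - 'i * x ^+ n)) @[n --> \oo] -->
      - ((1 + 0) / (1 - 0) : C))%classic.
    by apply: cvgN; apply: seq_cvgM => //; apply: cvgV => //; rewrite subr0 oner_eq0.
  by move: c3; rewrite addr0 subr0 divr1.
Qed.

Theorem theorem2p6 (R : realType) (q z : R[i])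
    (q_neq0 : q != 0) (q_lt1 : `|q| < 1) (z_neq0 : z != 0) :
  [/\ (forall j : nat, 1 + z * q ^- j.+1 != 0) ->
      (forall n : nat, qpoch (z ^+ 2 * q) (q ^+ 2) n%:Z != 0) ->
      qpoch_inf (z ^+ 2) q * qpoch_inf (q ^+ 2 / z ^+ 2) (q ^+ 2) != 0 ->
      is_bisum
        (fun k : int => qpoch (- z) q k / qpoch (z ^+ 2 * q) (q ^+ 2) k
                        * q ^ binz2 k * z ^ k)
        (qpoch_inf (- z) q * qpoch_inf q (q ^+ 2)
         / (qpoch_inf (z ^+ 2) q * qpoch_inf (q ^+ 2 / z ^+ 2) (q ^+ 2))
         * qpochs_inf [:: q ^+ 3; z ^+ 3; z ^- 3 * q ^+ 3] (q ^+ 3)),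
      (forall j : nat, 1 + z * (q ^+ 2) ^- j.+1 != 0) ->
      (forall n : nat, qpoch (z * q) q (2 * n%:Z) != 0) ->
      qpochs_inf [:: z ^+ 2 * q ^+ 2; q ^+ 2 / z ^+ 2; q] (q ^+ 2) != 0 ->
      is_bisum
        (fun k : int => qpoch (- z) (q ^+ 2) k / qpoch (z * q) q (2 * k)
                        * q ^ (k * (k + 1)) * z ^ k)
        (qpoch_inf (q / z) q * qpoch_inf (- z * q ^+ 2) (q ^+ 2)
         / qpochs_inf [:: z ^+ 2 * q ^+ 2; q ^+ 2 / z ^+ 2; q] (q ^+ 2)
         * qpochs_inf [:: q ^+ 6; - z ^+ 3 * q ^+ 3; - z ^- 3 * q ^+ 3]
                      (q ^+ 6)),
      (forall j : nat, 1 + z * (q ^+ 2) ^- j.+1 != 0) ->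
      (forall n : nat, qpoch z q (2 * n%:Z) != 0) ->
      qpochs_inf [:: z ^+ 2; q ^+ 2 / z ^+ 2; q] (q ^+ 2) != 0 ->
      is_bisum
        (fun k : int => qpoch (- z) (q ^+ 2) k / qpoch z q (2 * k)
                        * q ^ (k * (k - 1)) * z ^ k)
        (qpoch_inf (q / z) q * qpoch_inf (- z) (q ^+ 2)
         / qpochs_inf [:: z ^+ 2; q ^+ 2 / z ^+ 2; q] (q ^+ 2)
         * qpoch_inf (q ^+ 6) (q ^+ 6)
         * (qpochs_inf [:: - z ^+ 3 * q; - z ^- 3 * q ^+ 5] (q ^+ 6)
            + z ^+ 2
              * qpochs_inf [:: - z ^+ 3 * q ^+ 5; - z ^- 3 * q] (q ^+ 6)))
    & (forall n : nat, qpoch z q (2 * n%:Z + 1) != 0) ->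
      qpochs_inf [:: z ^+ 2; q ^+ 2 / z ^+ 2; q] (q ^+ 2) != 0 ->
      is_bisum
        (fun k : int => q ^ (2 * k ^+ 2) / qpoch z q (2 * k + 1)
                        * z ^ (2 * k))
        (qpoch_inf (q / z) q
         / qpochs_inf [:: z ^+ 2; q ^+ 2 / z ^+ 2; q] (q ^+ 2)
         * qpoch_inf (q ^+ 8) (q ^+ 8)
         * (qpochs_inf [:: - z ^+ 4 * q ^+ 3; - z ^- 4 * q ^+ 5] (q ^+ 8)
            + z
              * qpochs_inf [:: - z ^+ 4 * q ^+ 5; - z ^- 4 * q ^+ 3]
                           (q ^+ 8)))].
Proof.
have Kc := @complex_hcomplete R.
have nq0 : 0 < `|q| by rewrite normr_gt0.
split=> [hz _ h|hz _ h|hz _ h|_ h].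
- exact: bisum_cubic.
- by apply: bisum_sextic => //; apply: (unit_circle_seq Kc nq0).
- exact: bisum_sextic_pair.
- exact: bisum_octic_pair.
Qed.
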